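(* Let $k$ be an algebraic function field of transcendence degree one over its finite field of constants $k_0$, and let $d$ be a positive integer. There exists a constant $C=C(k,d)$, depending only on $k$ and $d$, such that for every finite field extension $K$ of $k$ with $[K:k]=d$ there exists $\alpha\in K$ with $K=k(\alpha)$ and $$h(1,\alpha)\leq \frac{g_K}{\delta(K/k)}+C,$$ where $g_K$ is the genus of $K$ regarded as a function field with field of constants $K_0$.
   Context: All fields are subfields of a fixed algebraic closure $\bar k$ of $k$. For a finite extension $M$ of $k$, $M_0$ denotes the algebraic closure of $k_0$ in $M$ (the field of constants of $M$), and $M$ is always regarded as a function field over $M_0$. The geometric degree is $\delta(M/k)=[M:k]/[M_0:k_0]$. For a place $v$ of $K$, $\mathrm{ord}_v$ is the normalized valuation (image in $\mathbb{Z}\cup\{\infty\}$), $K_v$ the residue class field, and $\deg_K v=[K_v:K_0]$. For $\mathbf{x}=(x_1,\dots,x_n)\in K^n\setminus\{0\}$ set $\mathrm{ord}_v(\mathbf{x})=\min_i \mathrm{ord}_v x_i$, let $(\mathbf{x})=\sum_v \mathrm{ord}_v(\mathbf{x})\, v$ (sum over all places of $K$) be its divisor, and define the height $h(\mathbf{x})=-\deg_K(\mathbf{x})/\delta(K/k)$, where $\deg_K$ of a divisor $\sum a_v v$ is $\sum a_v \deg_K v$. *)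

(* Defs.v *)
From HB Require Import structures.
From mathcomp Require Import all_boot all_order all_algebra all_field.
From mathcomp Require Import boolp classical_sets cardinality fsbigop.
From mathcomp Require Import constructive_ereal.

Set Implicit Arguments.
Unset Strict Implicit.
Unset Printing Implicit Defensive.

Import Order.TTheory GRing.Theory Num.Theory.
Local Open Scope classical_set_scope.
Local Open Scope ring_scope.

(* For a subfield E of F and E-subspaces W `<=` V of F, [has_dim E V W n]     *)
(* says that the E-vector space V / W has a basis of n elements; classes are  *)
(* given by representatives in V. The function [dimq] returns 0 when V / W is *)
(* infinite dimensional.                                                      *)
Section Dimension.
Variable F : fieldType.
Implicit Types E V W : set F.

Definition has_dim E V W (n : nat) : Prop :=
  exists b : 'I_n -> F,
    [/\ forall i, V (b i),
        forall c : 'I_n -> F, (forall i, E (c i)) ->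
          W (\sum_i c i * b i) -> forall i, c i = 0
      & forall y, V y -> exists c : 'I_n -> F,
          (forall i, E (c i)) /\ W (y - \sum_i c i * b i)].

Definition dimq E V W : nat := xget 0%N (has_dim E V W).

End Dimension.

Section FunctionField.
Variables (k0 F : fieldType) (j : {rmorphism k0 -> F}).

Definition constants : set F := [set x | algebraicOver j x].

Definition ratfield (t : F) : set F :=
  [set x | exists p q : {poly k0},
     (map_poly j q).[t] != 0 /\ x = (map_poly j p).[t] / (map_poly j q).[t]].

Definition function_field : Prop :=
  (exists t : F, ~ algebraicOver j t /\
     exists n : nat, has_dim (ratfield t) setT [set 0] n)
  /\ constants = range j.

(* A place is given by its normalized valuation; two places are equal as soon *)
(* as their valuations are.                                                   *)
Record place := Place {
  ord :> F -> \bar int;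
  ord_eqy : forall x, ord x = +oo%E <-> x = 0;
  ordM : forall x y, ord (x * y) = (ord x + ord y)%E;
  ordD : forall x y, (Order.min (ord x) (ord y) <= ord (x + y))%E;
  ord_const : forall x, constants x -> x != 0 -> ord x = 0%E;
  ord_range : range ord = [set e | e <> -oo%E]
}.

HB.instance Definition _ := gen_eqMixin place.
HB.instance Definition _ := gen_choiceMixin place.

Definition valring (v : place) : set F := [set x | (0 <= v x)%E].
Definition maxideal (v : place) : set F := [set x | (0 < v x)%E].

(* The degree over the field of constants of the residue class field          *)
(* valring v / maxideal v.                                                    *)
Definition pdeg (v : place) : nat := dimq constants (valring v) (maxideal v).

(* A divisor is a function D : place -> int with finite support. The sum      *)
(* below is a finite-support sum: it is only meaningful for divisors.         *)
Definition is_divisor (D : place -> int) : Prop := finite_set [set v | D v != 0].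

Definition divdeg (D : place -> int) : int :=
  \sum_(v \in [set: place]) D v * (pdeg v)%:Z.

Definition RRspace (D : place -> int) : set F :=
  [set x | forall v : place, (0 <= v x + (D v)%:E)%E].

Definition RRdim (D : place -> int) : nat := dimq constants (RRspace D) [set 0].

(* Riemann's definition: the genus is the maximum of deg D - l(D) + 1 over    *)
(* all divisors D.                                                            *)
Definition is_genus (g : int) : Prop :=
  (exists D, is_divisor D /\ g = divdeg D - (RRdim D)%:Z + 1) /\
  (forall D, is_divisor D -> divdeg D - (RRdim D)%:Z + 1 <= g).

Definition genus : int := xget 0 is_genus.

Definition ordv (v : place) (n : nat) (x : n.-tuple F) : \bar int :=
  \big[Order.min/+oo%E]_(y <- x) v y.

(* Only meaningful for a nonzero x, for which ordv v x is an integer.         *)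
Definition vdiv (n : nat) (x : n.-tuple F) (v : place) : int := fine (ordv v x).

End FunctionField.

Section Extension.
Variables (k0 k : fieldType) (iota : {rmorphism k0 -> k}) (K : fieldExtType k).

Definition const_emb : {rmorphism k0 -> K} := in_alg K \o iota.

Definition geomdeg : rat :=
  (\dim {:K})%:R / (dimq (range const_emb) (constants const_emb) [set 0])%:R.

Definition height (n : nat) (x : n.-tuple K) : rat :=
  - (divdeg (vdiv (j := const_emb) x))%:~R / geomdeg.

End Extension.

(* Main.v *)
Require Import Defs.
From HB Require Import structures.
From mathcomp Require Import all_boot all_order all_algebra all_field.
From mathcomp Require Import fingroup perm cyclic pgroup abelian.
From mathcomp Require Import boolp classical_sets cardinality fsbigop.
From mathcomp Require Import constructive_ereal.
From mathcomp Require Import zify ring.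

Set Implicit Arguments.
Unset Strict Implicit.
Unset Printing Implicit Defensive.

Import Order.TTheory GRing.Theory Num.Theory.
Local Open Scope classical_set_scope.
Local Open Scope ring_scope.

(* Let E be the field of constants of K, m = [E : k0], t in k transcendental
   over k0, and n' = g_K + C for a large constant C. Suppose that K has a place
   v of degree n' at which t is integral and the powers t^i, i < m n', are
   independent over k0 in the residue field. By Riemann's inequality some
   nonconstant alpha has a simple pole at v and no other pole, so that its
   height is n' / delta. As 1 / alpha is a uniformizer at v, the powers t^i,
   i < m n', are independent over k0(alpha); since [K : k0(alpha)] = m n' they
   form a basis, and K = k0(alpha)(t) = k(alpha).

   To find v, one first constructs y in K with O(g + 1) poles such that
   z^(p^r) lies in E(t, y) for every z in K. It is a root of a monic f over
   E[t], separable in Y, whose coefficients have degree O(g + 1). Let L be the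
   extension of E of degree n'. Stepanov's method bounds the number of a in L
   such that f(a, Y) is separable without roots in L: linear algebra yields
   G = sum c_{e,i,h,k} t^(e + h B) y^(i + k B), with B a power of #|E| close to
   the square root of #|L|, such that all coefficients of G mod f vanish at
   these a; and G != 0 because f remains irreducible over K(T). As
   2^(n' / 2) dominates O(g + 1), some a in L that generates L over k0 remains
   for which f(a, Y) has a simple root b in L, and the smooth point (a, b)
   of the plane model is the centre of the required place. *)

(** * Dimension over a subfield *)

(** The genus may enter the bound only with coefficient 1. The auxiliary coordinate y, with O(g + 1)
    poles, is therefore too expensive as an answer; it only provides an equation from which points
    are produced. The generator has a single pole, of degree just above what Riemann's inequality
    requires.

    Since [k] contains k0 and t but in general not E, independence of the powers of t is needed over
    k0(alpha), so residue degrees are counted over k0.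

    K may be inseparable over E(t), and then y generates only the separable part. Nothing is lost at
    the place, because the Frobenius map is bijective on a finite residue field.

    Saving a fixed proportion of the points of L is enough: Stepanov's count of the a without a root
    is about (1 - 1/(2r)) |L|, where r is the degree of f in Y. All other losses are small against
    |L| / (2r) once 2^(n' / 2) exceeds a fixed multiple of g + 1. Apart from g, the estimates
    involve K only through the characteristic and a bound for [K : k0(t)], which makes C uniform in
    K. *)

Definition subfield_set (F : fieldType) (S : set F) : Prop :=
  [/\ S 1, forall x y, S x -> S y -> S (x - y) & forall x y, S x -> S y -> S (x / y)].

Section SubfieldType.
Variables (F : fieldType) (S : set F) (HS : subfield_set S).

Definition sfpred : {pred F} := fun x => `[< S x >].

Lemma sfpred_closed : divring_closed sfpred.
Proof.
case: HS => S1 SB SD; split; first exact/asboolP.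
  by move=> x y /asboolP Sx /asboolP Sy; apply/asboolP/SB.
by move=> x y /asboolP Sx /asboolP Sy; apply/asboolP/SD.
Qed.

HB.instance Definition _ := GRing.isDivringClosed.Build F sfpred sfpred_closed.
(** Makes a subfield given as a set into a [fieldType], over which matrices and polynomials are
    available. The closure proof is an argument so that structure instances can be inferred from the
    type. *)
Definition sftype of subfield_set S := {x : F | x \in sfpred}.
HB.instance Definition _ := SubChoice.on (sftype HS).
HB.instance Definition _ := [SubChoice_isSubIntegralDomain of sftype HS by <:].
HB.instance Definition _ := [SubIntegralDomain_isSubField of sftype HS by <:].

Definition sfval : {rmorphism sftype HS -> F} := val.

Lemma sfval_range : range sfval = S.
Proof.
apply/seteqP; split=> [_ [x _ <-]|x Sx]; first exact/asboolP/(valP x).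
have xS : x \in sfpred by apply/asboolP.
by exists (Sub x xS) => //; rewrite /sfval /= SubK.
Qed.

End SubfieldType.

Definition subspace (F : fieldType) (S V : set F) : Prop :=
  V 0 /\ forall c u w, S c -> V u -> V w -> V (c * u + w).

Definition free_family (F : fieldType) (S V W : set F) n (b : 'I_n -> F) : Prop :=
  (forall i, V (b i)) /\
  forall c : 'I_n -> F, (forall i, S (c i)) ->
    W (\sum_i c i * b i) -> forall i, c i = 0.

Definition indep (F : fieldType) (S V W : set F) n : Prop :=
  exists b : 'I_n -> F, free_family S V W b.

Section SetDimension.
Variables (F : fieldType) (S : set F) (HS : subfield_set S).
Implicit Types (U V W : set F).

Lemma subfield0 : S 0.
Proof. by case: HS => S1 SB _; rewrite -(subrr 1); apply: SB. Qed.

Lemma subfield1 : S 1. Proof. by case: HS. Qed.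

Lemma subfieldB x y : S x -> S y -> S (x - y). Proof. by case: HS => _ + _; apply. Qed.

Lemma subfieldN x : S x -> S (- x).
Proof. by move=> Sx; rewrite -sub0r; apply/subfieldB/Sx/subfield0. Qed.

Lemma subfieldD x y : S x -> S y -> S (x + y).
Proof. by move=> Sx Sy; rewrite -(opprK y); apply/subfieldB/subfieldN. Qed.

Lemma subfieldV x : S x -> S x^-1.
Proof. by case: HS => S1 _ SD Sx; rewrite -(mul1r x^-1); apply: SD. Qed.

Lemma subfieldM x y : S x -> S y -> S (x * y).
Proof. by case: (HS) => _ _ SD Sx Sy; rewrite -(invrK y); apply/SD/subfieldV. Qed.

Lemma subfieldX x n : S x -> S (x ^+ n).
Proof.
by move=> Sx; elim: n => [|n IH]; rewrite ?expr0 ?exprS; [exact: subfield1|exact: subfieldM].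
Qed.

Lemma subspace_sum V I (r : seq I) (P : pred I) (c u : I -> F) : subspace S V ->
  (forall i, P i -> S (c i)) -> (forall i, P i -> V (u i)) -> V (\sum_(i <- r | P i) c i * u i).
Proof.
by case=> V0 VD Sc Vu; elim/big_rec: _ => // i x Pi Vx; apply: VD; [apply: Sc|apply: Vu|].
Qed.

Lemma subspaceD V x y : subspace S V -> V x -> V y -> V (x + y).
Proof. by case=> _ VD Vx Vy; rewrite -(mul1r x); apply: VD => //; exact: subfield1. Qed.

Lemma subspaceZ V c x : subspace S V -> S c -> V x -> V (c * x).
Proof. by case=> V0 VD Sc Vx; rewrite -(addr0 (c * x)); apply: VD. Qed.

Lemma subspaceN V x : subspace S V -> V x -> V (- x).
Proof.
by move=> HV Vx; rewrite -mulN1r; apply: subspaceZ => //; exact/subfieldN/subfield1.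
Qed.

Lemma subspaceB V x y : subspace S V -> V x -> V y -> V (x - y).
Proof. by move=> HV Vx Vy; apply: subspaceD => //; apply: subspaceN. Qed.

Lemma subspace_ssum V I (r : seq I) (P : pred I) (u : I -> F) : subspace S V ->
  (forall i, P i -> V (u i)) -> V (\sum_(i <- r | P i) u i).
Proof.
move=> HV Vu; rewrite (eq_bigr (fun i => 1 * u i)) => [|i _]; last by rewrite mul1r.
by apply: subspace_sum => // *; exact: subfield1.
Qed.

Lemma subspace_set0 : subspace S [set 0].
Proof. by split=> //= c u w _ -> ->; rewrite mulr0 addr0. Qed.

(** The coordinates of the [u i] modulo W form an m x n matrix over the subfield. If n < m it has a
    nonzero left kernel vector, and the corresponding combination of the [u i] lies in W. *)
Lemma steinitz W n m (b : 'I_n -> F) (u : 'I_m -> F) : subspace S W ->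
  (forall i, exists c : 'I_n -> F, (forall k, S (c k)) /\ W (u i - \sum_k c k * b k)) ->
  free_family S setT W u -> (m <= n)%N.
Proof.
move=> HW /choice [C HC] [_ free_u]; rewrite leqNgt; apply/negP => lt_nm.
have CS i k : C i k \in sfpred S by apply/asboolP; case: (HC i).
pose M : 'M[sftype HS]_(m, n) := \matrix_(i, k) Sub (C i k) (CS i k).
have : kermx M != 0.
  by rewrite -mxrank_eq0 mxrank_ker -lt0n subn_gt0 (leq_ltn_trans (rank_leq_col M)).
move=> /rowV0Pn [v /sub_kermxP vM v0]; case/negP: v0; apply/eqP/rowP => i.
rewrite mxE; apply: val_inj; rewrite /= (free_u (fun i => val (v 0 i))) //.
  by move=> k; exact/asboolP/(valP (v 0 k)).
have Sv k : S (val (v 0 k)) by exact/asboolP/(valP (v 0 k)).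
have -> : \sum_k val (v 0 k) * u k =
    \sum_k val (v 0 k) * (u k - \sum_l C k l * b l).
  rewrite (eq_bigr (fun k => val (v 0 k) * (u k - \sum_l C k l * b l) +
     \sum_l val (v 0 k) * C k l * b l)) => [|k _]; last first.
    by rewrite mulrBr [X in _ - X]mulr_sumr; under eq_bigr do rewrite mulrA; rewrite subrK.
  rewrite big_split /= exchange_big /= [X in _ + X]big1 ?addr0 // => l _.
  rewrite -mulr_suml; have /rowP/(_ l) := vM; rewrite !mxE => /(congr1 (sfval HS)).
  rewrite rmorph_sum rmorph0 => vl.
  rewrite (eq_bigr (fun k => sfval HS (v 0 k * M k l))) ?vl ?mul0r // => k _.
  by rewrite rmorphM mxE.
by apply: subspace_sum => // k _; case: (HC k).
Qed.

Lemma hd_indep_le V W n m : subspace S W -> has_dim S V W n -> indep S V W m -> (m <= n)%N.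
Proof.
move=> HW [b [_ _ span]] [u [Vu free]]; apply: (steinitz HW (b := b) (u := u)) => //.
by move=> i; apply: span.
Qed.

Lemma hd_indep V W n : has_dim S V W n -> indep S V W n.
Proof. by case=> b [Vb fb _]; exists b. Qed.

Lemma hd_uniq V W n m : subspace S W -> has_dim S V W n -> has_dim S V W m -> n = m.
Proof.
move=> HW hn hm; apply/eqP; rewrite eqn_leq (hd_indep_le HW hm (hd_indep hn)).
exact: hd_indep_le HW hn (hd_indep hm).
Qed.

Lemma dimqE V W n : subspace S W -> has_dim S V W n -> dimq S V W = n.
Proof.
move=> HW hn; apply: xget_subset1 => // m m'.
exact: hd_uniq.
Qed.

Lemma indep0 V W : indep S V W 0.
Proof. by exists (fun=> 0); split=> [[]|c _ _ []]. Qed.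

(** An independent family of maximal size spans: adjoining y to it creates a relation, in which the
    coefficient of y cannot vanish. *)
Lemma hd_exists V W N : subspace S W -> (forall m, indep S V W m -> (m <= N)%N) ->
  exists2 n, (n <= N)%N & has_dim S V W n.
Proof.
move=> HW bnd; pose P m := `[< indep S V W m >].
have Pex : exists m, P m by exists 0%N; apply/asboolP/indep0.
have Pub m : P m -> (m <= N)%N by move=> /asboolP; apply: bnd.
case: (ex_maxnP Pex Pub) => n /asboolP [b [Vb fb]] nmax.
exists n; first by apply/Pub/asboolP; exists b.
exists b; split=> // y Vy.
pose b' (i : 'I_n.+1) := if unlift ord0 i is Some j then b j else y.
have : ~ free_family S V W b'.
  move=> H; have : (n.+1 <= n)%N by apply: nmax; apply/asboolP; exists b'.
  by rewrite ltnn.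
have Vb' i : V (b' i) by rewrite /b'; case: unliftP.
move/not_andP; case=> // /existsNP [c /not_implyP [Sc /not_implyP [Wc]]] /existsNP [i0 ci0].
rewrite big_ord_recl /b' unlift_none in Wc.
have Wc' : W (c ord0 * y + \sum_(i < n) c (lift ord0 i) * b i).
  by move: Wc; under eq_bigr do rewrite liftK.
have c0 : c ord0 != 0.
  apply/eqP => c0; apply: ci0; case: (unliftP ord0 i0) => [j ->|-> //].
  move: Wc'; rewrite c0 mul0r add0r => Wc'.
  by apply: (fb (fun j => c (lift ord0 j))).
exists (fun i => - (c ord0)^-1 * c (lift ord0 i)); split=> [i|].
  by apply: subfieldM => //; apply/subfieldN/subfieldV.
have -> : y - \sum_(i < n) - (c ord0)^-1 * c (lift ord0 i) * b i =
   (c ord0)^-1 * (c ord0 * y + \sum_(i < n) c (lift ord0 i) * b i).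
  rewrite mulrDr mulKf // mulr_sumr -sumrN; congr (_ + _).
  by apply: eq_bigr => i _; rewrite !mulNr opprK mulrA.
by apply: subspaceZ => //; apply: subfieldV.
Qed.

Lemma indep_cat V U W n m : subspace S U -> U `<=` V -> W `<=` U ->
  indep S V U n -> indep S U W m -> indep S V W (n + m).
Proof.
move=> HU UV WU [b [Vb fb]] [u [Uu fu]].
exists (fun i => match split i with inl j => b j | inr j => u j end); split.
  by move=> i; case: split => j //; apply: UV.
move=> c Sc; rewrite big_split_ord /=.
rewrite (eq_bigr (fun i => c (lshift m i) * b i)) => [|i _]; last first.
  by rewrite (unsplitK (inl i : 'I_n + 'I_m)).
rewrite [X in _ + X](eq_bigr (fun i => c (rshift n i) * u i)) => [|i _]; last first.
  by rewrite (unsplitK (inr i : 'I_n + 'I_m)).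
set X := \sum_i _; set Y := \sum_i _ => WXY.
have UY : U Y by apply: subspace_sum.
have UX : U X by rewrite -(addrK Y X); apply: subspaceB => //; apply: WU.
have cl := fb _ (fun i => Sc (lshift m i)) UX.
have X0 : X = 0 by rewrite /X big1 // => i _; rewrite cl mul0r.
rewrite X0 add0r in WXY; have cr := fu _ (fun i => Sc (rshift n i)) WXY.
by move=> i; rewrite -(splitK i); case: (split i) => j /=; [exact: cl|exact: cr].
Qed.

Lemma hd_cat V U W n m : subspace S U -> subspace S W -> U `<=` V -> W `<=` U ->
  has_dim S V U n -> has_dim S U W m -> has_dim S V W (n + m).
Proof.
move=> HU HW UV WU [b [Vb fb sb]] [u [Uu fu su]].
exists (fun i => match split i with inl j => b j | inr j => u j end).
have bE (c : 'I_(n + m) -> F) : \sum_i c i * (match split i with inl j => b j | inr j => u j end) =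
   \sum_i c (lshift m i) * b i + \sum_i c (rshift n i) * u i.
  rewrite big_split_ord /=; congr (_ + _); apply: eq_bigr => i _.
    by rewrite (unsplitK (inl i : 'I_n + 'I_m)).
  by rewrite (unsplitK (inr i : 'I_n + 'I_m)).
split.
- by move=> i; case: split => j //; apply: UV.
- move=> c Sc; rewrite bE.
  set X := \sum_i _; set Y := \sum_i _ => WXY.
  have UY : U Y by apply: subspace_sum.
  have UX : U X by rewrite -(addrK Y X); apply: subspaceB => //; apply: WU.
  have cl := fb _ (fun i => Sc (lshift m i)) UX.
  have X0 : X = 0 by rewrite /X big1 // => i _; rewrite cl mul0r.
  rewrite X0 add0r in WXY; have cr := fu _ (fun i => Sc (rshift n i)) WXY.
  by move=> i; rewrite -(splitK i); case: (split i) => j /=; [exact: cl|exact: cr].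
- move=> y /sb [c [Sc /su [c' [Sc' Wy]]]].
  exists (fun i => match split i with inl j => c j | inr j => c' j end); split.
    by move=> i; case: split.
  rewrite bE opprD addrA.
  under eq_bigr do rewrite (unsplitK (inl _ : 'I_n + 'I_m)).
  by under [X in _ - X]eq_bigr do rewrite (unsplitK (inr _ : 'I_n + 'I_m)).
Qed.

Lemma indepS V V' W n : V `<=` V' -> indep S V W n -> indep S V' W n.
Proof. by move=> VV' [b [Vb fb]]; exists b; split=> // i; apply: VV'. Qed.

Lemma hd_sub V V' W n : subspace S W -> V `<=` V' -> has_dim S V' W n ->
  exists2 m, (m <= n)%N & has_dim S V W m.
Proof.
move=> HW VV' hn; apply: hd_exists => // m /(indepS VV').
exact: hd_indep_le hn.
Qed.

End SetDimension.

(** * Places *)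

Section Places.
Variables (k0 F : fieldType) (j : {rmorphism k0 -> F}).
Implicit Types (v w : place j) (x y z : F).

Lemma constants_subfield : subfield_set (constants j).
Proof.
split; first exact: algebraic1.
  by move=> x y; apply: algebraic_sub.
by move=> x y; apply: algebraic_div.
Qed.

(* Junk value: vz v 0 = 0. *)
Definition vz v x : int := fine (v x).
(** The fractional ideals of v. As sets they contain 0, so estimates of sums need no case
    distinction. *)
Definition vge v (n : int) : set F := [set x | (n%:E <= v x)%E].

Lemma ordE v x : x != 0 -> v x = (vz v x)%:E.
Proof.
move=> x0; rewrite /vz; have := ord_range v; case E: (v x) => [r| |] //.
  by case: (ord_eqy v x) => /(_ E) x0'; rewrite x0' eqxx in x0.
move=> /seteqP [/(_ (v x)) + _]; case => //.
Qed.

Lemma place_ord0 v : v 0 = +oo%E. Proof. by case: (ord_eqy v 0) => _; apply. Qed.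

Lemma vgeE v n x : x != 0 -> vge v n x = (n <= vz v x) :> Prop.
Proof. by move=> x0; rewrite /vge /= ordE // lee_fin. Qed.

Lemma vge0 v n : vge v n 0. Proof. by rewrite /vge /= place_ord0 leey. Qed.

Lemma vzM v x y : x != 0 -> y != 0 -> vz v (x * y) = vz v x + vz v y.
Proof. by move=> x0 y0; rewrite {1}/vz ordM !ordE. Qed.

Lemma vz1 v : vz v 1 = 0.
Proof.
have := vzM v (oner_neq0 F) (oner_neq0 F); rewrite mulr1 => /eqP.
by rewrite -subr_eq0 opprD addNKr oppr_eq0 => /eqP.
Qed.

Lemma vzV v x : vz v x^-1 = - vz v x.
Proof.
have [->|x0] := eqVneq x 0; first by rewrite invr0 /vz place_ord0.
apply/eqP; rewrite -subr_eq0 opprK addrC -vzM ?invr_eq0 //.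
by rewrite divff // -/(vz v 1) vz1.
Qed.

Lemma vzX v x n : vz v (x ^+ n) = vz v x *+ n.
Proof.
have [->|x0] := eqVneq x 0.
  by case: n => [|n]; rewrite ?expr0 ?vz1 // expr0n /vz place_ord0 mul0rn.
elim: n => [|n IH]; first by rewrite vz1.
by rewrite exprS vzM ?expf_neq0 // IH mulrS.
Qed.

Lemma vz_const v x : constants j x -> vz v x = 0.
Proof.
move=> Cx; have [->|x0] := eqVneq x 0; first by rewrite /vz place_ord0.
by rewrite /vz ord_const.
Qed.

Lemma vge_const v x : constants j x -> vge v 0 x.
Proof.
move=> Cx; have [->|x0] := eqVneq x 0; first exact: vge0.
by rewrite vgeE // vz_const.
Qed.

Lemma vgeD v n x y : vge v n x -> vge v n y -> vge v n (x + y).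
Proof.
move=> vx vy; rewrite /vge /= (le_trans _ (ordD v x y)) // le_min.
by rewrite vx vy.
Qed.

Lemma vgeM v n m x y : vge v n x -> vge v m y -> vge v (n + m) (x * y).
Proof.
have [->|x0] := eqVneq x 0; first by rewrite mul0r => _ _; apply: vge0.
have [->|y0] := eqVneq y 0; first by rewrite mulr0 => _ _; apply: vge0.
by rewrite !vgeE ?mulf_neq0 // vzM //; apply: lerD.
Qed.

Lemma vge_subspace v n : subspace (constants j) (vge v n).
Proof.
split=> [|c u w Cc Vu Vw]; first exact: vge0.
by apply: vgeD => //; rewrite -[n]add0r; apply: vgeM => //; apply: vge_const.
Qed.

Lemma vgeN v n x : vge v n x -> vge v n (- x).
Proof. exact: (subspaceN constants_subfield (vge_subspace v n)). Qed.

Lemma vgeB v n x y : vge v n x -> vge v n y -> vge v n (x - y).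
Proof. by move=> vx vy; apply/vgeD/vgeN. Qed.

Lemma vgeS v n m x : m <= n -> vge v n x -> vge v m x.
Proof. by move=> mn; apply: le_trans; rewrite lee_fin. Qed.

Lemma vgeX v n x m : vge v n x -> vge v (n *+ m) (x ^+ m).
Proof.
move=> vx; elim: m => [|m IH]; last by rewrite exprS mulrS; apply: vgeM.
by rewrite vgeE ?oner_neq0 // vz1.
Qed.

Lemma vge_sum v n I (r : seq I) (P : pred I) (u : I -> F) :
  (forall i, P i -> vge v n (u i)) -> vge v n (\sum_(i <- r | P i) u i).
Proof. exact: (subspace_ssum constants_subfield _ (vge_subspace v n)). Qed.

Lemma vge_vz v x : vge v (vz v x) x.
Proof. by have [->|x0] := eqVneq x 0; [exact: vge0|rewrite vgeE]. Qed.

Lemma vz_surj v n : exists2 x, x != 0 & vz v x = n.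
Proof.
have := ord_range v; move=> /seteqP [_ /(_ n%:E)] []// x _ xn; exists x.
  by apply/eqP => x0; move: xn; rewrite x0 place_ord0.
by rewrite /vz xn.
Qed.

Lemma maxidealE v : maxideal v = vge v 1.
Proof.
apply/seteqP; split=> x; have [->|x0] := eqVneq x 0.
- by move=> _; apply: vge0.
- by rewrite vgeE // /maxideal /= ordE // lte_fin.
- by move=> _; rewrite /maxideal /= place_ord0.
- by rewrite vgeE // /maxideal /= ordE // lte_fin.
Qed.

Lemma vzN v x : vz v (- x) = vz v x.
Proof.
have [->|x0] := eqVneq x 0; first by rewrite oppr0.
apply/eqP; rewrite eq_le; apply/andP; split.
  by rewrite -vgeE // -(opprK x); apply: vgeN; rewrite opprK; apply: vge_vz.
by rewrite -vgeE ?oppr_eq0 //; apply/vgeN/vge_vz.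
Qed.

Lemma vzD_lt v x y : x != 0 -> vge v (vz v x + 1) y -> x + y != 0 /\ vz v (x + y) = vz v x.
Proof.
move=> x0 vy; have xy0 : x + y != 0.
  apply/eqP => xy; have yE : y = - x by apply/eqP; rewrite -addr_eq0 addrC xy.
  by move: vy; rewrite yE vgeE ?oppr_eq0 // vzN; lia.
split=> //; apply/eqP; rewrite eq_le; apply/andP; split.
  rewrite leNgt; apply/negP => lt; have : vge v (vz v x + 1) x.
    have : vge v (vz v x + 1) (x + y) by rewrite vgeE //; lia.
    by move=> /vgeB /(_ vy); rewrite addrK.
  by rewrite vgeE //; lia.
by rewrite -vgeE //; apply: vgeD; [exact: vge_vz|apply: vgeS vy; lia].
Qed.

Lemma place_eq v w : (forall x, v x = w x) -> v = w.
Proof.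
case: v w => v v1 v2 v3 v4 v5 [w w1 w2 w3 w4 w5] /= /funext E.
by case: w / E w1 w2 w3 w4 w5 => *; congr Place; apply: Prop_irrelevance.
Qed.

(** An inclusion of valuation rings makes w trivial on the units of v, hence w a multiple of v, and
    normalization of both forces the factor to be 1. *)
Lemma place_neq v w : v <> w -> exists x, [/\ x != 0, 0 <= vz v x & vz w x < 0].
Proof.
move=> vw; apply: contrapT => /forallNP H; apply: vw; apply: place_eq => x.
have le y : y != 0 -> 0 <= vz v y -> 0 <= vz w y.
  by move=> y0 vy; rewrite leNgt; apply/negP => wy; apply: (H y).
have eq0 y : y != 0 -> vz v y = 0 -> vz w y = 0.
  move=> y0 vy; apply/eqP; rewrite eq_le le ?vy // andbT -oppr_ge0 -vzV.
  by apply: le; rewrite ?invr_eq0 // vzV vy.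
have [p p0 vp] := vz_surj v 1.
have pw y : y != 0 -> vz w y = vz v y * vz w p.
  move=> y0; have := eq0 (y / p ^ vz v y).
  have pX n : vz v (p ^ n) = n /\ vz w (p ^ n) = n * vz w p.
    by case: n => n; rewrite ?NegzE -?exprnP -?exprnN ?vzV !vzX ?vp; split; lia.
  have p0' : (p ^ vz v y)^-1 != 0 by rewrite invr_eq0 expfz_neq0.
  rewrite mulf_neq0 // => /(_ isT).
  rewrite !vzM // !vzV; case: (pX (vz v y)) => -> ->; lia.
have wp : vz w p = 1.
  have [q q0] := vz_surj w 1; rewrite pw // => /eqP.
  have : 0 <= vz w p by apply: le; rewrite ?vp.
  move: (vz v q) (vz w p) => a b b0 /eqP ab.
  by case: (lerP a 0) => a0; nia.
have [->|x0] := eqVneq x 0; first by rewrite !place_ord0.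
by rewrite !ordE // pw // wp mulr1.
Qed.

End Places.

(** * Weak approximation at finitely many places *)

Section Approximation.
Variables (k0 F : fieldType) (j : {rmorphism k0 -> F}).
Implicit Types (v w : place j) (x y z : F) (s : seq (place j)).

Lemma vge_mul2l v n x y : x != 0 -> vge v (vz v x + n) (x * y) -> vge v n y.
Proof.
move=> x0; have [->|y0] := eqVneq y 0; first by move=> _; apply: vge0.
by rewrite !vgeE ?mulf_neq0 // vzM // lerD2l.
Qed.

Lemma vge_mull v n x y : vge v n y -> vge v (vz v x + n) (x * y).
Proof. by move=> vy; apply/vgeM/vy/vge_vz. Qed.

Lemma vz_lt0D v x y : x != 0 -> y != 0 -> vz v x != vz v y -> vz v x < 0 -> vz v (x + y) < 0.
Proof.
move=> x0 y0 ne xlt; have [lt|lt|eq] := ltgtP (vz v x) (vz v y); last by rewrite eq eqxx in ne.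
  have vy : vge v (vz v x + 1) y by apply: vgeS (vge_vz v y); rewrite lezD1.
  by have [_ ->] := vzD_lt x0 vy.
have vx : vge v (vz v y + 1) x by apply: vgeS (vge_vz v x); rewrite lezD1.
by have [_] := vzD_lt y0 vx; rewrite addrC => ->; apply: lt_trans xlt.
Qed.

Lemma separating_elt v s : v \notin s ->
  exists z, [/\ z != 0, 0 < vz v z & forall w, w \in s -> vz w z < 0].
Proof.
elim: s => [_|w s IH].
  by have [z z0 vz1] := vz_surj v 1; exists z; rewrite vz1.
rewrite inE negb_or => /andP[vw /IH [z [z0 vz0 sz]]].
have [u [u0 vu wu]] : exists u, [/\ u != 0, 0 < vz v u & vz w u < 0].
  have [a [a0 va wa]] := place_neq (elimN eqP vw).
  have [b [b0 wb vb]] := place_neq (fun e => elimN eqP vw (esym e)).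
  exists (a / b); rewrite mulf_neq0 ?invr_eq0 // !vzM ?invr_eq0 // !vzV; split=> //; lia.
have [wz|wz] := ltP (vz w z) 0.
  by exists z; split=> // w'; rewrite inE => /orP[/eqP ->|/sz].
(* [N] exceeds every |w'(z)| for w' in s, so z and u^N cannot have the same negative valuation there
   and no cancellation occurs. At w the pole of u^N dominates, since z has no pole there. *)
pose N := (\sum_(w' <- s) `|vz w' z|%N).+1.
have uN : u ^+ N != 0 by rewrite expf_neq0.
have wE : vz w (z + u ^+ N) = vz w u *+ N /\ z + u ^+ N != 0.
  rewrite addrC -vzX; have [] := @vzD_lt _ _ _ w (u ^+ N) z uN => [|-> ->//].
  by apply: vgeS (vge_vz w z); rewrite vzX /N mulrS; nia.
exists (z + u ^+ N); case: wE => wE z'0; split=> //.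
  have : vge v 1 (z + u ^+ N).
    apply: vgeD; first by rewrite vgeE.
    by rewrite vgeE // vzX; nia.
  by rewrite vgeE.
move=> w'; rewrite inE => /orP[/eqP ->|sw']; first by rewrite wE; nia.
apply: vz_lt0D => //; last exact: sz.
have := sz _ sw'; rewrite vzX; apply: contraTneq => E; rewrite -leNgt.
have : (`|vz w' z| < N)%N by rewrite /N ltnS (big_rem w') //= leq_addr.
rewrite -mulr_natr in E; move: {+}N (vz w' z) (vz w' u) E => n a b ab lt.
have [a0|//] := ltP a 0; have [b0|b0] := ltP b 0; nia.
Qed.

(** If z has a zero at v and poles on s, then 1 / (1 + z^m) tends to 1 at v and to 0 on s as m
    grows. *)
Lemma weak_approx v s (M : nat) : v \notin s ->
  exists e, vge v M (e - 1) /\ forall w, w \in s -> vge w M e.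
Proof.
move=> /separating_elt [z [z0 vz0 sz]]; pose m := M.+1.
have zm : z ^+ m != 0 by rewrite expf_neq0.
have [d0 vd] : 1 + z ^+ m != 0 /\ vz v (1 + z ^+ m) = 0.
  rewrite -(vz1 v); apply: vzD_lt; rewrite ?oner_neq0 // vz1 vgeE // vzX /m; nia.
exists (1 + z ^+ m)^-1; split.
  have -> : (1 + z ^+ m)^-1 - 1 = (1 + z ^+ m)^-1 * (- (z ^+ m)).
    by apply: (mulfI d0); rewrite mulrBr mulfV // mulVKf //; ring.
  have := @vge_mull v (M : int) (1 + z ^+ m)^-1 (- z ^+ m).
  rewrite vzV vd oppr0 add0r; apply.
  by apply: vgeN; rewrite vgeE // vzX /m; nia.
move=> w sw; rewrite vgeE ?invr_eq0 // vzV addrC.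
have w1 : vge w (vz w (z ^+ m) + 1) 1.
  by rewrite vgeE ?oner_neq0 // vz1 vzX /m; have := sz _ sw; nia.
have [_ ->] := vzD_lt zm w1; rewrite vzX /m; have := sz _ sw; nia.
Qed.

Definition vall s (D : place j -> int) : set F := [set z | forall v, v \in s -> vge v (D v) z].

Lemma vall_subspace s D : subspace (constants j) (vall s D).
Proof.
split=> [v _|c u w Cc Vu Vw v sv]; first exact: vge0.
by case: (vge_subspace v (D v)) => _; apply=> //; [apply: Vu|apply: Vw].
Qed.

(** Residue classes at v are moved to level [D v] by an element p of that valuation, then multiplied
    by e, which is a unit at v and so small at the rest of s that the conditions there hold
    automatically. *)
Lemma indep_vall_step s (D D' : place j -> int) v d : uniq s -> v \in s ->
  D' v = D v + 1 -> (forall w, w != v -> D' w = D w) ->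
  indep (constants j) (vge v 0) (vge v 1) d -> indep (constants j) (vall s D) (vall s D') d.
Proof.
move=> us sv D'v D'w [b [Vb fb]].
have [p p0 vp] := vz_surj v (D v).
pose M := (\sum_(w <- s) \sum_i `|D w - vz w (p * b i)|)%N.
have [e [ev ew]] : exists e, vge v M.+1 (e - 1) /\ forall w, w \in rem v s -> vge w M.+1 e.
  by apply: weak_approx; rewrite mem_rem_uniqF.
have [e0 vze] : e != 0 /\ vz v e = 0.
  rewrite -(vz1 v) -(subrK 1 e) addrC; apply: vzD_lt; rewrite ?oner_neq0 // vz1.
  by apply: vgeS ev; lia.
exists (fun i => e * (p * b i)); split=> [i w sw|c Cc Wc i].
  have [->|wv] := eqVneq w v.
    rewrite -[D v]add0r -{1}vze; apply: vge_mull; rewrite -vp -[vz v p]addr0; apply: vge_mull.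
    exact: Vb.
  have [->|bi0] := eqVneq (b i) 0; first by rewrite !mulr0; apply: vge0.
  apply: (@vgeS _ _ _ w (M.+1%:Z + vz w (p * b i))); last first.
    by apply: vgeM; [apply: ew; rewrite mem_rem_uniq // inE wv|exact: vge_vz].
  have : (`|D w - vz w (p * b i)| <= M)%N.
    rewrite /M (big_rem w) //= (bigD1 i) //= -addnA; apply: leq_addr.
  lia.
apply: (fb c Cc); have := Wc v sv; rewrite D'v.
have -> : \sum_i c i * (e * (p * b i)) = e * (p * \sum_i c i * b i).
  by rewrite !mulr_sumr; apply: eq_bigr => l _; ring.
rewrite -[D v + 1]add0r -{1}vze => /(vge_mul2l e0); rewrite -vp.
exact: vge_mul2l.
Qed.

Lemma indep_vall s (D : place j -> nat) (d : place j -> nat) : uniq s ->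
  (forall v, v \in s -> indep (constants j) (vge v 0) (vge v 1) (d v)) ->
  indep (constants j) (vall s (fun=> 0)) (vall s (fun v => (D v)%:Z))
    (\sum_(v <- s) D v * d v)%N.
Proof.
move=> us Hd; move: {2}(\sum_(v <- s) D v)%N (erefl (\sum_(v <- s) D v)%N) => N.
elim: N D => [|N IH] D DN.
  rewrite big_seq big1 => [|v sv]; first exact: indep0.
  by move/eqP: DN; rewrite sum_nat_seq_eq0 => /allP/(_ v sv)/eqP ->.
have /hasP [v sv Dv] : has (fun v => D v != 0)%N s.
  by apply/negPn; rewrite -all_predC; apply/negP => /allP H; move: DN;
     rewrite big_seq big1 // => v /H /=; case: (D v).
pose D1 w := if w == v then (D v).-1 else D w.
have D1E (f : place j -> nat) : (\sum_(w <- s) D w * f w = \sum_(w <- s) D1 w * f w + f v)%N.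
  rewrite !(big_rem v sv) /= {1}/D1 eqxx addnAC -mulSnr prednK ?lt0n //.
  congr (_ + _)%N.
  apply: eq_big_seq => w; rewrite mem_rem_uniq // inE /D1 => /andP[/negPf -> _] //.
rewrite D1E; apply: indep_cat (IH D1 _) _; try exact: constants_subfield.
- exact: vall_subspace.
- by move=> z H w sw; apply: vgeS (H w sw).
- by move=> z H w sw; apply: vgeS (H w sw); rewrite /D1; case: eqP => [->|_]; lia.
- have := D1E (fun=> 1%N); under eq_bigr do rewrite muln1.
  by under [in X in _ = X]eq_bigr do rewrite muln1; rewrite DN; lia.
- apply: (indep_vall_step (v := v)) => //; last exact: Hd.
    by rewrite /D1 eqxx; lia.
  by move=> w /negPf wv; rewrite /D1 wv.
Qed.

End Approximation.

(** * Linear independence over the rational functions of one element *)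

Section FreeOverPolynomials.
Variables (E F : fieldType) (iota : {rmorphism E -> F}).
Implicit Types (x y z : F) (p q : {poly E}).

Definition peval x p : F := (map_poly iota p).[x].

Lemma pevalD x p q : peval x (p + q) = peval x p + peval x q.
Proof. by rewrite /peval rmorphD hornerD. Qed.
Lemma pevalM x p q : peval x (p * q) = peval x p * peval x q.
Proof. by rewrite /peval rmorphM hornerM. Qed.
Lemma pevalC x c : peval x c%:P = iota c.
Proof. by rewrite /peval map_polyC hornerC. Qed.
Lemma pevalX x : peval x 'X = x.
Proof. by rewrite /peval map_polyX hornerX. Qed.
Lemma peval0 x : peval x 0 = 0.
Proof. by rewrite /peval rmorph0 horner0. Qed.
Lemma peval1 x : peval x 1 = 1.
Proof. by rewrite /peval rmorph1 hornerC. Qed.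
Lemma pevalXn x n : peval x 'X^n = x ^+ n.
Proof. by rewrite /peval map_polyXn hornerXn. Qed.
Lemma pevalN x p : peval x (- p) = - peval x p.
Proof. by rewrite /peval rmorphN hornerN. Qed.

Lemma peval_shift x p : peval x p = iota p`_0 + x * peval x (drop_poly 1 p).
Proof.
rewrite -[in LHS](poly_take_drop 1 p) pevalD pevalM pevalXn expr1 mulrC; congr (_ + _).
rewrite -(pevalC x); congr peval; apply/polyP => i.
by rewrite coef_take_poly coefC; case: i.
Qed.

(* Linear independence over E(x), with denominators cleared. *)
Definition xfree x n (u : 'I_n -> F) : Prop :=
  forall p : 'I_n -> {poly E}, \sum_i peval x (p i) * u i = 0 -> forall i, p i = 0.

(** A relation whose constant terms all vanish can be divided by x; repeating this exhausts the
    degrees. *)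
Lemma xfree_reduce x n (u : 'I_n -> F) : x != 0 ->
  (forall p : 'I_n -> {poly E}, \sum_i peval x (p i) * u i = 0 -> forall i, (p i)`_0 = 0) ->
  xfree x u.
Proof.
move=> x0 H p; pose N := (\max_i size (p i))%N.
have : forall i, (size (p i) <= N)%N by move=> i; exact: leq_bigmax.
move: N => N; elim: N p => [|N IH] p sp eqp.
  by move=> i; apply/eqP; rewrite -size_poly_leq0.
have p0 := H p eqp.
have pE i : p i = drop_poly 1 (p i) * 'X.
  apply/polyP => k; rewrite coefMX; case: k => [|k]; first by rewrite p0.
  by rewrite coef_drop_poly addn1.
have q0 : forall i, drop_poly 1 (p i) = 0.
  apply: IH => [i|]; first by rewrite size_drop_poly; have := sp i; lia.
  apply: (mulfI x0); rewrite mulr0 -[RHS]eqp mulr_sumr; apply: eq_bigr => i _.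
  by rewrite [in RHS]pE pevalM pevalX; ring.
by move=> i; rewrite pE q0 mul0r.
Qed.

(** V is an E[x]-module with xV inside W. The constant terms of a relation give a combination of the
    [u i] lying in xV, so independence modulo W kills them. *)
Lemma xfree_indep (V W : set F) x n (u : 'I_n -> F) : x != 0 ->
  (forall c a b, V a -> V b -> V (iota c * a + b)) -> V 0 ->
  (forall z, V z -> V (x * z)) -> (forall z, V z -> W (- (x * z))) ->
  free_family (range iota) V W u -> xfree x u.
Proof.
move=> x0 VD V0 Vx VW [Vu fu]; apply: xfree_reduce => // p eqp i.
apply: (fmorph_inj iota); rewrite rmorph0.
apply: (fu (fun i => iota (p i)`_0)) => [l|]; first by exists (p l)`_0.
have Vp q z : V z -> V (peval x q * z).
  move=> Vz; elim/poly_ind: q => [|q c IH]; first by rewrite peval0 mul0r.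
  rewrite pevalD pevalM pevalX pevalC mulrDl addrC; apply: VD => //.
  by rewrite (mulrC (peval x q)) -mulrA; apply: Vx.
have -> : \sum_l iota (p l)`_0 * u l = - (x * \sum_l peval x (drop_poly 1 (p l)) * u l).
  apply/eqP; rewrite -addr_eq0 mulr_sumr -big_split /= -[X in _ == X]eqp; apply/eqP.
  by apply: eq_bigr => l _; rewrite [in RHS]peval_shift; ring.
apply: VW; elim/big_rec: _ => // l z _ Vz.
by have := VD 1 _ _ (Vp (drop_poly 1 (p l)) _ (Vu l)) Vz; rewrite rmorph1 mul1r.
Qed.

End FreeOverPolynomials.

(** * Extension of subrings to valuation rings *)

Definition subring_set (F : fieldType) (O : set F) : Prop :=
  [/\ O 1, forall x y, O x -> O y -> O (x - y) & forall x y, O x -> O y -> O (x * y)].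

Section SubringSet.
Variables (F : fieldType) (O : set F) (HO : subring_set O).

Lemma subring1 : O 1. Proof. by case: HO. Qed.
Lemma subringB x y : O x -> O y -> O (x - y). Proof. by case: HO => _ + _; apply. Qed.
Lemma subringM x y : O x -> O y -> O (x * y). Proof. by case: HO => _ _; apply. Qed.
Lemma subring0 : O 0. Proof. by rewrite -(subrr 1); apply: subringB; exact: subring1. Qed.
Lemma subringN x : O x -> O (- x).
Proof. by move=> Ox; rewrite -sub0r; apply: subringB => //; exact: subring0. Qed.
Lemma subringD x y : O x -> O y -> O (x + y).
Proof. by move=> Ox Oy; rewrite -(opprK y); apply/subringB/subringN. Qed.
Lemma subringX x n : O x -> O (x ^+ n).
Proof.
by move=> Ox; elim: n => [|n IH]; rewrite ?expr0 ?exprS; [exact: subring1|exact: subringM].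
Qed.
Lemma subring_sum I (r : seq I) (P : pred I) (u : I -> F) :
  (forall i, P i -> O (u i)) -> O (\sum_(i <- r | P i) u i).
Proof.
by move=> Ou; elim/big_ind: _ => //; [exact: subring0|exact: subringD].
Qed.

Definition adjoin z : set F := [set x | exists2 p : {poly F}, (forall i, O p`_i) & x = p.[z]].

Lemma adjoin_subring z : subring_set (adjoin z).
Proof.
split.
- by exists 1; [move=> i; rewrite coef1; case: eqP => _; [exact: subring1|exact: subring0]|
    rewrite hornerC].
- move=> _ _ [p Op ->] [q Oq ->]; exists (p - q); last by rewrite hornerD hornerN.
  by move=> i; rewrite coefB; apply: subringB.
- move=> _ _ [p Op ->] [q Oq ->]; exists (p * q); last by rewrite hornerM.
  by move=> i; rewrite coefM; apply: subring_sum => l _; apply: subringM.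
Qed.

Lemma adjoin_sub z : O `<=` adjoin z.
Proof.
move=> x Ox; exists x%:P; last by rewrite hornerC.
by move=> i; rewrite coefC; case: eqP => // _; exact: subring0.
Qed.

Lemma adjoin_gen z : adjoin z z.
Proof.
exists 'X; last by rewrite hornerX.
by move=> i; rewrite coefX; case: eqP => _; [exact: subring1|exact: subring0].
Qed.

(* Chevalley's exchange: a relation of degree [n] for [z] is shortened by one  *)
(* of degree at most [n] for [z^-1].                                           *)
Definition unit_relation (pi z : F) (n : nat) : Prop :=
  exists Q : {poly F}, [/\ (size Q <= n.+1)%N, forall i, O (Q`_i / pi) & Q.[z] = 1].

Lemma unit_relation_step pi z n m : pi != 0 -> z != 0 -> O pi -> (m <= n.+1)%N ->
  unit_relation pi z n.+1 -> unit_relation pi z^-1 m -> unit_relation pi z n.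
Proof.
move=> pi0 z0 Opi mn [Q [sQ OQ Qz]] [Q' [sQ' OQ' Qz']].
have OQ1 i : O Q`_i by rewrite -(divfK pi0 Q`_i); apply: subringM.
have OQ1' i : O Q'`_i by rewrite -(divfK pi0 Q'`_i); apply: subringM.
(* Multiplying Q'(1/z) = 1 by z^(n+1) gives S(z) = (1 - Q'_0) z^(n+1). Hence 1 - Q'_0 times the
   relation Q has its leading term replaced by Q_(n+1) S(z), of lower degree; adding Q'_0 restores
   the value 1. *)
pose S := \poly_(k < n.+1) Q'`_(n.+1 - k).
exists ((1 - Q'`_0) *: take_poly n.+1 Q + (Q'`_0)%:P + Q`_n.+1 *: S); split.
- rewrite (leq_trans (size_polyD _ _)) // geq_max (leq_trans (size_scale_leq _ _)) ?size_poly //.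
  rewrite andbT (leq_trans (size_polyD _ _)) // geq_max (leq_trans (size_scale_leq _ _)).
    by rewrite (leq_trans (size_polyC_leq1 _)).
  exact: size_take_poly.
- move=> i; rewrite !coefD !coefZ coefC coef_take_poly coef_poly mulrDl mulrDl.
  apply: subringD; first apply: subringD.
  + rewrite -mulrA; apply: subringM; first by apply: subringB => //; exact: subring1.
    by case: ifP => _ //; rewrite mul0r; exact: subring0.
  + by case: eqP => // _; rewrite mul0r; exact: subring0.
  + rewrite -mulrA; apply: subringM => //.
    by case: ifP => _ //; rewrite mul0r; exact: subring0.
- have QE : Q.[z] = (take_poly n.+1 Q).[z] + Q`_n.+1 * z ^+ n.+1.
    rewrite (horner_coef_wide _ sQ) big_ord_recr /=; congr (_ + _).
    rewrite (horner_coef_wide _ (size_take_poly _ _)); apply: eq_bigr => i _.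
    by rewrite coef_take_poly ltn_ord.
  have SE : S.[z] = (1 - Q'`_0) * z ^+ n.+1.
    have sQ'' : (size Q' <= n.+2)%N by rewrite (leq_trans sQ').
    have -> : 1 - Q'`_0 = \sum_(i < n.+1) Q'`_i.+1 * z^-1 ^+ i.+1.
      rewrite -Qz' (horner_coef_wide _ sQ'') big_ord_recl expr0 mulr1 addrAC subrr add0r.
      by apply: eq_bigr.
    rewrite /S horner_poly mulr_suml (reindex_inj rev_ord_inj) /=.
    apply: eq_bigr => i _; rewrite subSS.
    have -> : (n.+1 - (n - i) = i.+1)%N by have := ltn_ord i; lia.
    rewrite -mulrA exprVn; congr (_ * _).
    have -> : z ^+ n.+1 = z ^+ i.+1 * z ^+ (n - i).
      by rewrite -exprD; congr (_ ^+ _); have := ltn_ord i; lia.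
    by rewrite mulKf // expf_neq0.
  rewrite !hornerE SE; move: Qz; rewrite QE => /(canRL (addrK _)) ->.
  by ring.
Qed.

Lemma unit_relation_contra pi z n m : pi != 0 -> z != 0 -> O pi -> ~ O pi^-1 ->
  unit_relation pi z n -> unit_relation pi z^-1 m -> False.
Proof.
move=> pi0 + Opi Npi.
have base y : unit_relation pi y 0 -> False.
  move=> [Q [sQ OQ]]; rewrite (size1_polyC sQ) hornerC => Q0; apply: Npi.
  by have := OQ 0%N; rewrite Q0 mul1r.
move: {2}(n + m)%N (leqnn (n + m)) => N; elim: N z n m => [|N IH] z n m.
  by rewrite leqn0 addn_eq0 => /andP[/eqP -> _] _ /base.
move=> le z0 rn rm.
case: n le rn => [|n] le rn; first exact: base rn.
case: m le rm => [|m] le rm; first exact: base rm.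
have [nm|/ltnW nm] := leqP m.+1 n.+1.
  apply: (IH z n m.+1) => //.
  exact: unit_relation_step nm rn rm.
apply: (IH z n.+1 m) => //; first by rewrite addnS in le.
by apply: (unit_relation_step pi0 _ Opi nm rm); rewrite ?invr_eq0 // invrK.
Qed.

End SubringSet.

(** Take O maximal among the subrings that contain R0 but not 1/pi. If neither z nor 1/z were in O,
    then 1/pi would lie in both O[z] and O[1/z]; this gives unit relations for z and 1/z, which
    shorten each other down to degree 0. *)
Lemma maximal_subring (F : fieldType) (R0 : set F) (pi : F) :
  pi != 0 -> subring_set R0 -> R0 pi -> ~ R0 pi^-1 ->
  exists O : set F, [/\ subring_set O, R0 `<=` O, ~ O pi^-1 & forall z, O z \/ O z^-1].
Proof.
move=> pi0 HR0 Rpi NRpi.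
(* The union with [R0] makes the empty chain admissible: its union is empty and the ring attached to
   it is [R0]. *)
pose P (X : set F) := subring_set (R0 `|` X) /\ ~ (R0 `|` X) pi^-1.
have [C CP Ctot|A [[HA NA] Amax]] := @Zorn_bigcup F P.
  have PC x y : (R0 `|` \bigcup_(X in C) X) x -> (R0 `|` \bigcup_(X in C) X) y ->
      (R0 x /\ R0 y) \/ exists X, [/\ C X, (R0 `|` X) x & (R0 `|` X) y].
    move=> [Rx|[X CX Xx]] [Ry|[Y CY Yy]]; first by left.
    - by right; exists Y; split=> //; [left|right].
    - by right; exists X; split=> //; [right|left].
    - right; have [XY|YX] := Ctot _ _ CX CY.
        by exists Y; split=> //; right=> //; apply: XY.
      by exists X; split=> //; right=> //; apply: YX.
  have sub X x : C X -> (R0 `|` X) x -> (R0 `|` \bigcup_(X in C) X) x.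
    by move=> CX [Rx|Xx]; [left|right; exists X].
  split.
    split; first by left; exact: subring1.
      move=> x y Px Py; have [[Rx Ry]|[X [CX Xx Xy]]] := PC x y Px Py.
        by left; apply: subringB.
      by apply: (sub X) => //; case: (CP _ CX) => H _; apply: subringB.
    move=> x y Px Py; have [[Rx Ry]|[X [CX Xx Xy]]] := PC x y Px Py.
      by left; apply: subringM.
    by apply: (sub X) => //; case: (CP _ CX) => H _; apply: subringM.
  by move=> [//|[X CX Xpi]]; case: (CP _ CX) => _; apply; right.
pose O := R0 `|` A; exists O; split=> // [x Rx|z]; first by left.
have big y : ~ O y -> adjoin O y pi^-1.
  move=> NOy; apply: contrapT => Nadj.
  have sub : O `<=` adjoin O y by apply: adjoin_sub.
  have E : R0 `|` adjoin O y = adjoin O y.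
    by apply/seteqP; split=> x; [move=> [Rx|//]; apply: sub; left|right].
  apply: (Amax (adjoin O y)).
    split=> [x Ax|H]; first by apply: sub; right.
    by apply: NOy; right; apply: H; exact: adjoin_gen.
  by rewrite /P E; split=> //; exact: adjoin_subring.
apply: contrapT => /not_orP [NOz NOz'].
have z0 : z != 0 by apply/eqP => z0; apply: NOz; rewrite z0; exact: subring0.
have rel y : ~ O y -> exists n, unit_relation O pi y n.
  move=> /big [p Op Ep]; exists (size p), (pi *: p); split.
  - by rewrite (leq_trans (size_scale_leq _ _)).
  - by move=> i; rewrite coefZ mulrC mulKf.
  - by rewrite hornerZ -Ep mulfV.
have [n rn] := rel _ NOz; have [m rm] := rel _ NOz'.
by apply: (unit_relation_contra HA pi0 z0 _ NA rn rm); left.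
Qed.

(** * Existence of places *)

Section ValuationRing.
Variables (k0 E F : fieldType) (j : {rmorphism k0 -> F}) (iota : {rmorphism E -> F}).
Hypothesis constE : constants j = range iota.
(** For transcendental x this bounds the degree of F over E(x). For x in the range of [iota] only
    the empty family is free, so such x need not be excluded. *)
Hypothesis Hfin : forall x, exists N, forall n (u : 'I_n -> F), xfree iota x u -> (n <= N)%N.
Variables (O : set F) (pi : F).
Hypotheses (HO : subring_set O) (constO : constants j `<=` O) (pi0 : pi != 0).
Hypotheses (Opi : O pi) (NOpi : ~ O pi^-1) (Oval : forall z, O z \/ O z^-1).

(** The maximal ideal of O. Zero is listed apart because [0^-1 = 0] lies in O. *)
Let M : set F := [set z | O z /\ (z = 0 \/ ~ O z^-1)].

Let unitO (z : F) : Prop := O z /\ O z^-1.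

Let M_or_unit z : O z -> ~ M z -> unitO z.
Proof.
move=> Oz NM; split=> //; apply: contrapT => NOz; apply: NM; split=> //; by right.
Qed.

Let MO z : M z -> O z. Proof. by case. Qed.

Let M_unit z : M z -> unitO z -> z = 0.
Proof. by case=> _ [//|H] []. Qed.

Let MZ c a : O c -> M a -> M (c * a).
Proof.
move=> Oc [Oa Ma]; split; first exact: subringM.
case: Ma => [->|NOa]; first by left; rewrite mulr0.
have [->|c0] := eqVneq c 0; first by left; rewrite mul0r.
right=> H; apply: NOa; have -> : a^-1 = (c * a)^-1 * c by rewrite invfM mulrAC mulVf ?mul1r.
exact: subringM.
Qed.

Let MD a b : M a -> M b -> M (a + b).
Proof.
have wlog_case x y : x != 0 -> M x -> M y -> O (y / x) -> M (x + y).
  move=> x0 Mx My Oyx; have -> : x + y = (1 + y / x) * x by rewrite mulrDl mul1r divfK.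
  by apply: MZ => //; apply: subringD => //; exact: subring1.
have [->|a0] := eqVneq a 0; first by rewrite add0r.
have [->|b0] := eqVneq b 0; first by rewrite addr0.
move=> Ma Mb; case: (Oval (b / a)) => H; first exact: wlog_case.
by rewrite addrC; apply: wlog_case; rewrite // -invf_div.
Qed.

Let M_sum I (r : seq I) (P : pred I) (u : I -> F) :
  (forall i, P i -> M (u i)) -> M (\sum_(i <- r | P i) u i).
Proof.
by move=> Mu; elim/big_ind: _ => //; split; [exact: subring0|left].
Qed.

Let Opeval p x : O x -> O (peval iota x p).
Proof.
move=> Ox; elim/poly_ind: p => [|p c IH]; first by rewrite peval0; exact: subring0.
rewrite pevalD pevalM pevalX pevalC; apply: subringD => //; first exact: subringM.
by apply: constO; rewrite constE; exists c.
Qed.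

Let iota_unit c : c != 0 -> unitO (iota c).
Proof.
by move=> c0; split; apply: constO; rewrite constE; [exists c|exists c^-1; rewrite ?fmorphV].
Qed.

(** In a relation over E[u_0], take the last l with nonzero constant term and divide by u_l. Terms
    before l lie in M by strict divisibility, terms after l because they contain the factor u_0; the
    nonzero constant of index l would then lie in M as well. *)
Let chain_xfree n (u : nat -> F) : u 0%N != 0 -> (forall i, (i < n.+1)%N -> M (u i)) ->
  (forall i l, (i < l < n.+1)%N -> u l != 0 /\ M (u i / u l)) ->
  xfree iota (u 0%N) (fun i : 'I_n.+1 => u i).
Proof.
move=> u00 Mu Mdiv; apply: xfree_reduce => // p eqp.
apply: contrapT => /existsNP [i0 /eqP Hi0].
have [l Hl lmax] := @arg_maxnP _ i0 (fun i => (p i)`_0 != 0) (fun i => nat_of_ord i) Hi0.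
have ul0 : u l != 0 by case E1: (val l) => [|k] //; have [] := Mdiv 0%N l; rewrite -?E1 ?ltn_ord ?E1.
have Ou0 : O (u 0%N) by apply/MO/Mu.
have u0l : O (u 0%N / u l).
  case E1: (nat_of_ord l) => [|k]; first by rewrite divff //; exact: subring1.
  by rewrite -E1; apply: MO; case: (Mdiv 0%N l) => //; rewrite ltn_ord E1.
suff : M (iota (p l)`_0).
  by move=> /M_unit/(_ (iota_unit Hl))/eqP; rewrite fmorph_eq0; apply/negP.
have -> : iota (p l)`_0 = - \sum_i ((if i == l then u 0%N * peval iota (u 0%N) (drop_poly 1 (p l))
    else peval iota (u 0%N) (p i) * (u i / u l))).
  apply: (mulIf ul0); rewrite mulNr mulr_suml; apply/eqP; rewrite -addr_eq0; apply/eqP.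
  rewrite -[RHS]eqp (bigD1 l) // [in RHS](bigD1 l) //= eqxx addrA; congr (_ + _).
    by rewrite [in RHS]peval_shift; ring.
  by apply: eq_bigr => i /negPf ->; rewrite -mulrA divfK.
rewrite -mulN1r; apply: MZ; first by apply: subringN => //; exact: subring1.
apply: M_sum => i _; case: eqP => [_|/eqP il].
  by rewrite mulrC; apply: MZ; [exact: Opeval|exact: Mu].
have [lt|le] := ltnP i l.
  by apply: MZ; [exact: Opeval|case: (Mdiv i l) => //; rewrite lt ltn_ord].
have li : (l < i)%N by rewrite ltn_neqAle eq_sym il.
have pi0' : (p i)`_0 = 0.
  by apply/eqP; apply: contraT => /lmax /=; rewrite leqNgt li.
rewrite peval_shift pi0' rmorph0 add0r.
have -> : u 0%N * peval iota (u 0%N) (drop_poly 1 (p i)) * (u i / u l) =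
  (u 0%N / u l) * peval iota (u 0%N) (drop_poly 1 (p i)) * u i by ring.
by apply: MZ; [apply: subringM => //; exact: Opeval|exact: Mu].
Qed.

(** Otherwise each nonzero element of M has a strict divisor in M, and iteration from [pi] produces
    strict chains of any length, hence too many elements independent over E(pi). *)
Let uniformizer : exists w, [/\ w != 0, M w & forall z, M z -> O (z / w)].
Proof.
apply: contrapT => /forallNP H.
have {}H w : exists w', w != 0 -> M w -> [/\ w' != 0, M w' & M (w / w')].
  have [->|w0] := eqVneq w 0; first by exists 0.
  have [Mw|NMw] := pselect (M w); last by exists 0.
  have := H w; move=> /not_and3P [//|//|] /existsNP [z /not_implyP [Mz NO]].
  exists z => _ _.
  have z0 : z != 0 by apply/eqP => z0; apply: NO; rewrite z0 mul0r; exact: subring0.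
  split=> //; case: (Oval (z / w)) => //; rewrite invf_div => Owz; split=> //.
  by right; rewrite invf_div.
have /choice [f Hf] := H.
have Mpi : M pi by split=> //; right.
pose u i := iter i f pi.
have Hu i : u i != 0 /\ M (u i).
  by elim: i => [|i [u0 Mu]]; [split|rewrite /u iterS; case: (Hf (u i) u0 Mu)].
have Mu i l : (i < l)%N -> M (u i / u l).
  elim: l => // l IH; rewrite ltnS leq_eqVlt => /orP[/eqP ->|/IH Mil].
    by case: (Hu l) => u0 M0; case: (Hf (u l) u0 M0).
  have -> : u i / u l.+1 = (u l / u l.+1) * (u i / u l).
    by rewrite [RHS]mulrC mulrA divfK //; case: (Hu l).
  apply: MZ => //; case: (Hu l) => u0 M0; apply: MO; by case: (Hf (u l) u0 M0).
have [N HN] := Hfin pi.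
suff /HN : xfree iota pi (fun i : 'I_N.+1 => u i) by rewrite ltnn.
apply: (@chain_xfree N u) => // [i _|i l /andP[il _]]; first by case: (Hu i).
by split; [case: (Hu l)|exact: Mu].
Qed.

Lemma place_of_valuation_ring : exists v : place j, forall z, vge v 0 z <-> O z.
Proof.
have [w [w0 Mw wdiv]] := uniformizer.
have NOw : ~ O w^-1 by case: Mw => _ [w00|//]; rewrite w00 eqxx in w0.
have Ow : O w by apply: MO.
have wX0 n : w ^ n != 0 by rewrite expfz_neq0.
have bound z : z != 0 -> O z -> exists n : nat, ~ O (z / w ^+ n).
  move=> z0 Oz; apply: contrapT => /forallNP H.
  have {}H n : O (z / w ^+ n) by apply: contrapT; apply: H.
  have Mz : M z.
    split=> //; right=> Oz'; apply: NOw; have := subringM HO Oz' (H 1%N).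
    by rewrite mulKf.
  have [N HN] := Hfin z.
  (* The chain z, w^N, ..., w: if all powers of w divide z, each term is strictly divisible by the
     next, and N + 1 elements become independent over E(z). *)
  pose u i := if i is 0%N then z else w ^+ (N.+1 - i).
  suff /HN : xfree iota z (fun i : 'I_N.+1 => u i) by rewrite ltnn.
  apply: (@chain_xfree N u) => // [[|i] iN //|i l /andP[il lN]].
    have -> : u i.+1 = w ^+ (N - i.+1) * w.
      by rewrite /u -exprSr; congr (_ ^+ _); lia.
    by apply: MZ => //; exact: subringX.
  case: l il lN => // l il lN; split; first by rewrite /u expf_neq0.
  case: i il => [|i] il.
    have -> : u 0%N / u l.+1 = (z / w ^+ (N.+2 - l.+1)) * w.
      rewrite /u; have -> : (N.+2 - l.+1 = (N.+1 - l.+1).+1)%N by lia.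
      by rewrite exprS invfM -!mulrA (mulrC w^-1) mulfK.
    by apply: MZ.
  have -> : u i.+1 / u l.+1 = w ^+ (l - i.+1) * w.
    rewrite -exprSr /u; have -> : (N.+1 - i.+1 = (l - i.+1).+1 + (N.+1 - l.+1))%N by lia.
    by rewrite exprD mulfK // expf_neq0.
  by apply: MZ => //; exact: subringX.
have unitM a b : unitO a -> unitO b -> unitO (a * b).
  by move=> [Oa Oa'] [Ob Ob']; split; rewrite ?invfM; apply: subringM.
have unitV a : unitO a -> unitO a^-1 by move=> [Oa Oa']; split; rewrite ?invrK.
have pos z : z != 0 -> O z -> exists n : nat, unitO (z / w ^+ n).
  move=> z0 Oz; have [n Hn] := bound z z0 Oz.
  elim: n Hn => [|n IH] Hn; first by case: Hn; rewrite expr0 invr1 mulr1.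
  have [Ozn|/IH //] := pselect (O (z / w ^+ n)).
  exists n; apply: M_or_unit => // /wdiv; apply: contra_not Hn.
  by rewrite exprSr invfM mulrA.
have ex z : z != 0 -> exists n : int, unitO (z / w ^ n).
  move=> z0; case: (Oval z) => Oz.
    by have [n Hn] := pos z z0 Oz; exists n.
  have [|n Hn] := pos z^-1 _ Oz; first by rewrite invr_eq0.
  by exists (- n%:Z); have := unitV _ Hn; rewrite invf_div invrK invr_expz opprK mulrC.
have unitw (n : int) : unitO (w ^ n) -> n = 0.
  have wn (m : nat) : O (w ^+ m.+1)^-1 -> False.
    move=> H; apply: NOw; have := subringM HO (subringX HO m Ow) H.
    by rewrite exprSr invfM mulVKf // expf_neq0.
  by case: n => [[//|m]|m] [H1 H2]; exfalso; apply: (wn m) => //.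
have uniq z n m : unitO (z / w ^ n) -> z != 0 -> unitO (z / w ^ m) -> n = m.
  move=> Hn z0 Hm; have := unitM _ _ (unitV _ Hn) Hm.
  rewrite invf_div mulrA divfK // invr_expz -expfzDr // => /unitw/eqP.
  by rewrite subr_eq0 => /eqP.
pose oz z : int := xget 0 [set n | unitO (z / w ^ n)].
have ozP z : z != 0 -> unitO (z / w ^ oz z).
  by move=> z0; rewrite /oz; case: xgetP => [n _ //|H]; have [n /H] := ex z z0.
have ozE z n : z != 0 -> unitO (z / w ^ n) -> oz z = n.
  by move=> z0 Hn; apply: uniq (ozP _ z0) z0 Hn.
have Oge z n : z != 0 -> O (z / w ^ n) <-> n <= oz z.
  move=> z0; have zE : z / w ^ n = (z / w ^ oz z) * w ^ (oz z - n).
    by rewrite expfzDr // mulrA divfK // invr_expz.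
  split=> [Ozn|le]; last first.
    rewrite zE; apply: subringM => //; first by case: (ozP z z0).
    have -> : oz z - n = `|oz z - n|%N by rewrite gez0_abs // subr_ge0.
    exact: subringX.
  rewrite leNgt; apply/negP => lt.
  have H : O (w ^ (oz z - n)).
    have -> : w ^ (oz z - n) = (z / w ^ oz z)^-1 * (z / w ^ n).
      by rewrite zE mulKf // mulf_neq0 // invr_eq0.
    by apply: subringM => //; case: (ozP z z0).
  have /unitw/eqP : unitO (w ^ (oz z - n)).
    split=> //; rewrite invr_expz.
    have -> : - (oz z - n) = `|n - oz z|%N by rewrite gez0_abs; lia.
    exact: subringX.
  by lia.
pose o z : \bar int := if z == 0 then +oo%E else (oz z)%:E.
have o_eqy z : o z = +oo%E <-> z = 0.
  by rewrite /o; case: eqP => // z0; split.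
have oM x y : o (x * y) = (o x + o y)%E.
  rewrite /o mulf_eq0; have [_|x0] := eqVneq x 0; first by case: eqP.
  have [_|y0] := eqVneq y 0 => //=.
  congr (_%:E); apply: ozE; first by rewrite mulf_neq0.
  by rewrite expfzDr // invfM mulrACA; apply: unitM; apply: ozP.
have oD x y : (Order.min (o x) (o y) <= o (x + y)%R)%E.
  rewrite /o; have [->|x0] := eqVneq x 0; first by rewrite add0r ge_min lexx orbT.
  have [->|y0] := eqVneq y 0; first by rewrite addr0 (negPf x0) ge_min lexx.
  have [_|xy0] := eqVneq (x + y) 0; first by rewrite leey.
  rewrite -EFin_min lee_fin; apply/Oge => //; rewrite mulrDl; apply: subringD => //.
    by apply/Oge => //; rewrite ge_min lexx.
  by apply/Oge => //; rewrite ge_min lexx orbT.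
have oc x : constants j x -> x != 0 -> o x = 0%E.
  move=> Cx x0; rewrite /o (negPf x0); congr (_%:E); apply: ozE => //; rewrite expr0z divr1.
  by move: Cx x0; rewrite constE => -[c _ <-]; rewrite fmorph_eq0; apply: iota_unit.
have or : range o = [set e | e <> -oo%E].
  apply/seteqP; split=> [_ [x _ <-]|[n| |] //= _]; first by rewrite /o; case: eqP.
    exists (w ^ n) => //; rewrite /o (negPf (wX0 n)); congr (_%:E); apply: ozE => //.
    by rewrite divff //; split; rewrite ?invr1; exact: subring1.
  by exists 0; rewrite // /o eqxx.
exists (Place o_eqy oM oD oc or) => z; rewrite /vge /= /o.
have [->|z0] := eqVneq z 0; first by split=> // _; exact: subring0.
by rewrite lee_fin; have := Oge z 0 z0; rewrite expr0z divr1 => ->.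
Qed.

End ValuationRing.

Lemma place_exists (k0 E F : fieldType) (j : {rmorphism k0 -> F}) (iota : {rmorphism E -> F})
    (R0 : set F) (pi : F) :
  constants j = range iota ->
  (forall x, exists N, forall n (u : 'I_n -> F), xfree iota x u -> (n <= N)%N) ->
  subring_set R0 -> constants j `<=` R0 -> pi != 0 -> R0 pi -> ~ R0 pi^-1 ->
  exists v : place j, R0 `<=` vge v 0 /\ vge v 1 pi.
Proof.
move=> constE Hfin HR0 constR pi0 Rpi NRpi.
have [O [HO RO NOpi Oval]] := maximal_subring pi0 HR0 Rpi NRpi.
have [v Hv] := place_of_valuation_ring constE Hfin HO
  (fun x Cx => RO x (constR x Cx)) pi0 (RO _ Rpi) NOpi Oval.
exists v; split=> [z /RO Oz|]; first exact/Hv.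
have /Hv : O pi by apply: RO.
rewrite !vgeE // => vpi; have : ~ vge v 0 pi^-1 by move=> /Hv.
by rewrite vgeE ?invr_eq0 // vzV; lia.
Qed.

(** * Divisors and Riemann's inequality *)

Lemma finite_set_bounded (T : choiceType) (A : set T) N :
  (forall s : seq T, uniq s -> (forall x, x \in s -> A x) -> (size s <= N)%N) -> finite_set A.
Proof.
move=> H; pose P m := `[< exists s : seq T, [/\ uniq s, forall x, x \in s -> A x & size s = m] >].
have P0 : exists m, P m by exists 0%N; apply/asboolP; exists [::].
have Pub m : P m -> (m <= N)%N by move=> /asboolP [s [us sA <-]]; apply: H.
case: (ex_maxnP P0 Pub) => m /asboolP [s [us sA sm]] max.
apply: (sub_finite_set _ (finite_seq s)) => x Ax /=.
apply: contraT => xs; have : (m.+1 <= m)%N; last by rewrite ltnn.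
apply: max; apply/asboolP; exists (x :: s); split; rewrite /= ?xs ?us ?sm //.
by move=> y; rewrite inE => /orP[/eqP ->|/sA].
Qed.

Section Scaling.
Variables (F : fieldType) (S : set F) (HS : subfield_set S).

Lemma has_dim_scale (V W V' W' : set F) z n : z != 0 ->
  (forall u, V u <-> V' (z * u)) -> (forall u, W u <-> W' (z * u)) ->
  has_dim S V W n -> has_dim S V' W' n.
Proof.
move=> z0 VV' WW' [b [Vb fb sb]]; exists (fun i => z * b i).
have E (c : 'I_n -> F) : \sum_i c i * (z * b i) = z * \sum_i c i * b i.
  by rewrite mulr_sumr; apply: eq_bigr => i _; rewrite mulrCA.
split=> [i|c Sc|y V'y]; first exact/VV'.
  by rewrite E => /WW'; apply: fb.
have /VV'/sb [c [Sc Wc]] : V' (z * (y / z)) by rewrite mulrC divfK.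
exists c; split=> //; rewrite E.
by move: Wc => /WW'; rewrite mulrBr [z * (y / z)]mulrC divfK.
Qed.

Lemma indep_scale (V W V' W' : set F) z n : subspace S V ->
  (forall u, V u -> V' (z * u)) -> (forall u, V u -> W' (z * u) -> W u) ->
  indep S V W n -> indep S V' W' n.
Proof.
move=> HV VV' WW' [b [Vb fb]]; exists (fun i => z * b i); split=> [i|c Sc]; first exact/VV'.
have -> : \sum_i c i * (z * b i) = z * \sum_i c i * b i.
  by rewrite mulr_sumr; apply: eq_bigr => i _; rewrite mulrCA.
by move=> /WW' H; apply: fb => //; apply/H/(subspace_sum _ HV).
Qed.

Lemma indep_fin (T : finType) (V W : set F) (b : T -> F) :
  (forall t, V (b t)) ->
  (forall c : T -> F, (forall t, S (c t)) -> W (\sum_t c t * b t) -> forall t, c t = 0) ->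
  indep S V W #|T|.
Proof.
move=> Vb fb; exists (fun i => b (enum_val i)); split=> // c Sc Wc i.
rewrite -(enum_valK i); apply: (fb (fun t => c (enum_rank t))) => //.
rewrite (reindex (@enum_val T T)) /=; last by apply: onW_bij; exact: enum_val_bij.
by under eq_bigr do rewrite enum_valK.
Qed.

End Scaling.

Section Divisors.
Variables (k0 F : fieldType) (j : {rmorphism k0 -> F}).
Implicit Types (D : place j -> int) (v : place j) (z : F).

Lemma RRspaceE D z : RRspace D z <-> forall v, vge v (- D v) z.
Proof.
have [->|z0] := eqVneq z 0.
  by split=> _ v; [exact: vge0|rewrite place_ord0].
have H v : (0 <= v z + (D v)%:E)%E <-> vge v (- D v) z.
  by rewrite vgeE // ordE // lee_fin; split; lia.
by split=> H' v; apply/H/H'.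
Qed.

Lemma RRspace_subspace D : subspace (constants j) (RRspace D).
Proof.
split=> [|c u w Cc /RRspaceE Vu /RRspaceE Vw]; apply/RRspaceE => v; first exact: vge0.
by case: (vge_subspace v (- D v)) => _; apply.
Qed.

Lemma RRspace_le D D' : (forall v, D v <= D' v) -> RRspace D `<=` RRspace D'.
Proof.
by move=> le z /RRspaceE H; apply/RRspaceE => v; apply: vgeS (H v); rewrite lerN2.
Qed.

Lemma divdeg_seq D (s : seq (place j)) : uniq s -> (forall v, v \notin s -> D v = 0) ->
  divdeg D = \sum_(v <- s) D v * (pdeg v)%:Z.
Proof.
move=> us Ds; rewrite /divdeg (fsbigE s) //=; first by under eq_bigl do rewrite in_setT.
by move=> v _ /Ds ->; rewrite mul0r.
Qed.

Lemma divisor_seq D : is_divisor D -> exists2 s : seq (place j), uniq s & forall v, v \notin s -> D v = 0.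
Proof.
move=> /finite_seqP [s0 sE]; exists (undup s0); first exact: undup_uniq.
move=> v; rewrite mem_undup => vs; apply/eqP; apply: contraT => Dv.
have : [set` s0] v by rewrite -sE.
by rewrite /= (negPf vs).
Qed.

Lemma seq_divisor D (s : seq (place j)) : (forall v, v \notin s -> D v = 0) -> is_divisor D.
Proof.
move=> Ds; apply: (sub_finite_set _ (finite_seq s)) => v /= Dv.
by apply: contraT => /Ds/eqP; rewrite (negPf Dv).
Qed.

Lemma divisor_seq2 D D' : is_divisor D -> is_divisor D' ->
  exists2 s : seq (place j), uniq s & forall v, v \notin s -> D v = 0 /\ D' v = 0.
Proof.
move=> /divisor_seq [s us Ds] /divisor_seq [s' us' Ds'].
exists (undup (s ++ s')); first exact: undup_uniq.
move=> v; rewrite mem_undup mem_cat negb_or => /andP[/Ds -> /Ds' ->]; by [].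
Qed.

Lemma divisorD D D' : is_divisor D -> is_divisor D' -> is_divisor (fun v => D v + D' v).
Proof.
move=> HD HD'; have [s _ sE] := divisor_seq2 HD HD'.
by apply: (seq_divisor (s := s)) => v /sE [-> ->].
Qed.

Lemma divdegD D D' : is_divisor D -> is_divisor D' ->
  divdeg (fun v => D v + D' v) = divdeg D + divdeg D'.
Proof.
move=> HD HD'; have [s us sE] := divisor_seq2 HD HD'.
rewrite !(divdeg_seq us) => [|v /sE []//|v /sE []//|v /sE [-> ->]//].
by rewrite -big_split /=; apply: eq_bigr => v _; rewrite mulrDl.
Qed.

Lemma divisorZ D n : is_divisor D -> is_divisor (fun v => n * D v).
Proof.
move=> /divisor_seq [s _ sE]; apply: (seq_divisor (s := s)) => v /sE ->.
by rewrite mulr0.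
Qed.

Lemma divdegZ D n : is_divisor D -> divdeg (fun v => n * D v) = n * divdeg D.
Proof.
move=> /divisor_seq [s us sE]; rewrite !(divdeg_seq us) // => [|v /sE ->]; last by rewrite mulr0.
by rewrite mulr_sumr; apply: eq_bigr => v _; rewrite mulrA.
Qed.

End Divisors.

(** * The degree over E(x) *)

Section Transcendence.
Variables (k0 E F : fieldType) (j : {rmorphism k0 -> F}) (iota : {rmorphism E -> F}).
Hypothesis constE : constants j = range iota.

Lemma algebraic_constants x p : p != 0 -> peval iota x p = 0 -> constants j x.
Proof.
move=> p0 px; rewrite /constants /=; apply/integral_algebraic.
apply: (@integral_root _ _ _ (map_poly iota p)); rewrite ?map_poly_eq0 //.
  by rewrite rootE -/(peval iota x p) px.
move=> c /(nthP 0) [i _ <-]; rewrite coef_map; apply/integral_algebraic.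
have : range iota (iota p`_i) by exists p`_i.
by rewrite -constE.
Qed.

Lemma peval_eq0 x p : ~ constants j x -> peval iota x p = 0 -> p = 0.
Proof.
move=> Nx px; apply/eqP; apply: contraT => p0; case: Nx.
exact: algebraic_constants p0 px.
Qed.

Lemma xfree_inv x n (u : 'I_n -> F) : x != 0 -> xfree iota x^-1 u -> xfree iota x u.
Proof.
move=> x0 fu p eqp i; pose N := (\max_i size (p i))%N.
have sN l : (size (p l) <= N)%N by exact: leq_bigmax.
pose q l := \poly_(k < N.+1) (p l)`_(N - k).
have qE l : peval iota x^-1 (q l) = x ^- N * peval iota x (p l).
  have sN1 : (size (map_poly iota (p l)) <= N.+1)%N by rewrite size_map_poly (leq_trans (sN l)).
  have sN2 : (size (map_poly iota (q l)) <= N.+1)%N by rewrite size_map_poly size_poly.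
  rewrite /peval (horner_coef_wide _ sN1) (horner_coef_wide _ sN2) mulr_sumr.
  rewrite (reindex_inj rev_ord_inj) /=; apply: eq_bigr => k _.
  rewrite !coef_map coef_poly subSS ltnS leq_subr mulrCA; congr (_ * _).
    by rewrite subKn // -ltnS.
  have -> : x ^+ N = x ^+ (N - k) * x ^+ k.
    by rewrite -exprD subnK // -ltnS.
  by rewrite invfM mulrVK ?unitfE ?expf_neq0 // exprVn.
have : q i = 0.
  apply: fu; under eq_bigr do rewrite qE -mulrA.
  by rewrite -mulr_sumr eqp mulr0.
move=> /polyP q0; apply/polyP => k; rewrite coef0.
have [kN|kN] := ltnP k N.+1; last by rewrite nth_default // (leq_trans (sN i)) // ltnW.
by have := q0 (N - k)%N; rewrite coef_poly coef0 ltnS leq_subr subKn.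
Qed.

(** For transcendental x this says N = [F : E(x)]. *)
Definition xdeg x N : Prop :=
  (exists u : 'I_N -> F, xfree iota x u) /\
  forall n (u : 'I_n -> F), xfree iota x u -> (n <= N)%N.

Lemma xdeg_exists x N : (forall n (u : 'I_n -> F), xfree iota x u -> (n <= N)%N) ->
  exists2 r, (r <= N)%N & xdeg x r.
Proof.
move=> HN; pose P m := `[< exists u : 'I_m -> F, xfree iota x u >].
have P0 : exists m, P m by exists 0%N; apply/asboolP; exists (fun=> 0) => p _ [].
have Pub m : P m -> (m <= N)%N by move=> /asboolP [u]; apply: HN.
case: (ex_maxnP P0 Pub) => m /asboolP Hm max; exists m.
  by case: Hm => u; apply: HN.
by split=> // n u Hu; apply: max; apply/asboolP; exists u.
Qed.

Lemma xdeg_inv x r : x != 0 -> xdeg x r -> xdeg x^-1 r.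
Proof.
move=> x0 [[u fu] H]; split; first by exists u; apply: xfree_inv; rewrite ?invr_eq0 ?invrK.
by move=> n w /(xfree_inv x0)/H.
Qed.

End Transcendence.

Section Riemann.
Variables (k0 E F : fieldType) (j : {rmorphism k0 -> F}) (iota : {rmorphism E -> F}).
Hypothesis constE : constants j = range iota.
Hypothesis Hfin : forall x, exists N, forall n (u : 'I_n -> F), xfree iota x u -> (n <= N)%N.
Implicit Types (D : place j -> int) (v : place j) (x z : F).
Local Notation C := (constants j).
Let HC : subfield_set C := constants_subfield j.

Lemma constants_iota c : C (iota c).
Proof. by rewrite constE; exists c. Qed.

(** One half of the equality between [F : E(x)] and the degree of the zeros of x, by weak
    approximation on the ring of elements integral on [s]. The numbers [d v] are free parameters
    because finiteness of the residue degrees is itself deduced from this bound. *)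
Lemma degree_inequality x s (d : place j -> nat) : x != 0 -> uniq s ->
  (forall v, v \in s -> 0 <= vz v x) ->
  (forall v, v \in s -> indep C (vge v 0) (vge v 1) (d v)) ->
  exists u : 'I_(\sum_(v <- s) `|vz v x| * d v) -> F, xfree iota x u.
Proof.
move=> x0 us sx sd; have [u fu] := indep_vall (fun v => `|vz v x|%N) us sd.
exists u; apply: (@xfree_indep _ _ iota (vall s (fun=> 0)) (vall s (fun v => `|vz v x|%N : int))) => //.
- by move=> c a b; case: (vall_subspace s (fun=> 0)) => _; apply; apply: constants_iota.
- by case: (vall_subspace s (fun=> 0)).
- move=> z Vz v sv; rewrite -[0]addr0; apply: vgeM; last exact: Vz.
  by apply: vgeS (vge_vz v x); exact: sx.
- move=> z Vz v sv; apply: vgeN; rewrite gez0_abs ?sx // -[vz v x]addr0.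
  by apply: vge_mull; exact: Vz.
- by rewrite -constE.
Qed.

Lemma pdegP v : has_dim C (vge v 0) (vge v 1) (pdeg v) /\ (0 < pdeg v)%N.
Proof.
have [p p0 vp] := vz_surj v 1; have [N HN] := Hfin p.
have [n _ hn] : exists2 n, (n <= N)%N & has_dim C (vge v 0) (vge v 1) n.
  apply: (hd_exists HC); first exact: vge_subspace.
  move=> m Hm; have [||||] := @degree_inequality p [:: v] (fun=> m) => //.
  - by move=> w; rewrite inE => /eqP ->; rewrite vp.
  - by move=> w; rewrite inE => /eqP ->.
  by rewrite big_seq1 vp mul1n => u /HN.
have -> : pdeg v = n by rewrite /pdeg maxidealE; apply: (dimqE HC) hn; exact: vge_subspace.
split=> //; apply: (hd_indep_le HC (vge_subspace v 1) hn).
exists (fun=> 1); split=> [_|c Cc]; first by rewrite vgeE ?oner_neq0 // vz1.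
rewrite big_ord1 mulr1 => H i; rewrite (ord1 i); apply/eqP; apply: contraT => c0.
by move: H; rewrite vgeE // vz_const.
Qed.

Definition poles x : place j -> int := fun v => if vz v x < 0 then - vz v x else 0.

Lemma poles_ge0 x v : 0 <= poles x v.
Proof. by rewrite /poles; case: ifP => //; lia. Qed.

Lemma poles_bound x s N : x != 0 -> uniq s ->
  (forall n (u : 'I_n -> F), xfree iota x u -> (n <= N)%N) ->
  \sum_(v <- s) poles x v * (pdeg v)%:Z <= N%:Z.
Proof.
move=> x0 us HN; rewrite (bigID (fun v => vz v x < 0)) /= [X in _ + X]big1 ?addr0; last first.
  by move=> v /negPf; rewrite /poles => ->; rewrite mul0r.
rewrite -big_filter; set s' := [seq v <- s | vz v x < 0].
have [||||u /xfree_inv] := @degree_inequality x^-1 s' (@pdeg _ _ j).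
- by rewrite invr_eq0.
- exact: filter_uniq.
- by move=> v; rewrite mem_filter vzV => /andP[]; lia.
- by move=> v _; case: (pdegP v) => /hd_indep.
move=> /(_ x0)/HN; rewrite -lez_nat; apply: le_trans.
rewrite raddf_sum big_seq [leRHS]big_seq; apply: ler_sum => v; rewrite mem_filter => /andP[vx _].
by rewrite /poles vx vzV /= PoszM abszN ltz0_abs.
Qed.

Lemma poles_divisor x : is_divisor (poles x).
Proof.
have [->|x0] := eqVneq x 0.
  have -> : poles 0 = fun=> 0 by apply/funext => v; rewrite /poles /vz place_ord0.
  exact: (seq_divisor (s := [::])).
have [N HN] := Hfin x; apply: (@finite_set_bounded _ _ N) => s us Hs.
have := poles_bound x0 us HN; rewrite -lez_nat; apply: le_trans.
rewrite -sum1_size raddf_sum big_seq [leRHS]big_seq; apply: ler_sum => v /Hs /=.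
have [_ pv] := pdegP v; have := poles_ge0 x v; move: (poles x v) => a; nia.
Qed.

Lemma poles_deg_le x r : x != 0 -> xdeg iota x r -> divdeg (poles x) <= r%:Z.
Proof.
move=> x0 [_ Hr]; have [s us sE] := divisor_seq (poles_divisor x).
by rewrite (divdeg_seq us) //; apply: poles_bound.
Qed.

(** If x is not constant, it does not lie in E[1/x], since otherwise 1/x would satisfy an algebraic
    equation. So 1/x is not invertible in E[1/x], and some place above this ring has 1/x in its
    maximal ideal. *)
Lemma no_poles x : (forall v, vge v 0 x) -> C x.
Proof.
move=> Hx; apply: contrapT => Nx.
have x0 : x != 0 by apply/eqP => x0; apply: Nx; rewrite x0; exact: (subfield0 HC).
pose R0 := [set z | exists p, z = peval iota x^-1 p].
have [|||||v [_]] := @place_exists _ _ _ j iota R0 x^-1 constE Hfin.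
- split; first by exists 1; rewrite peval1.
    by move=> _ _ [p ->] [q ->]; exists (p - q); rewrite pevalD pevalN.
  by move=> _ _ [p ->] [q ->]; exists (p * q); rewrite pevalM.
- by move=> z; rewrite constE => -[c _ <-]; exists c%:P; rewrite pevalC.
- by rewrite invr_eq0.
- by exists 'X; rewrite pevalX.
- rewrite invrK => -[p xp]; apply: Nx.
  have Cx' : C x^-1.
    apply: (@algebraic_constants _ _ _ j iota constE _ (1 - 'X * p)).
      by apply/eqP => /(congr1 (fun q : {poly E} => q`_0)); rewrite coefB coef1 coefXM coef0 subr0 => /eqP;
        rewrite oner_eq0.
    by rewrite pevalD pevalN pevalM peval1 pevalX -xp mulVf // subrr.
  by rewrite -(invrK x); exact: (subfieldV HC).
rewrite vgeE ?invr_eq0 // vzV; have := Hx v; rewrite vgeE //; lia.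
Qed.

Lemma RRspace0 : RRspace (fun _ : place j => 0 : int) = C.
Proof.
apply/seteqP; split=> [z /RRspaceE H|z Cz]; last by apply/RRspaceE => v; exact: vge_const.
by apply: no_poles => v; have := H v; rewrite oppr0.
Qed.

Lemma has_dim_constants : has_dim C C [set 0] 1.
Proof.
exists (fun=> 1); split=> [_|c Cc|y Cy]; first exact: (subfield1 HC).
  by rewrite big_ord1 mulr1 /= => H i; rewrite (ord1 i).
by exists (fun=> y); rewrite big_ord1 mulr1 subrr.
Qed.

(** Multiplication by an element of valuation [D v + 1] at v embeds the quotient into the residue
    field at v. *)
Lemma RR_step D D' v : D' v = D v + 1 -> (forall w, w != v -> D' w = D w) ->
  exists2 n, (n <= pdeg v)%N & has_dim C (RRspace D') (RRspace D) n.
Proof.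
move=> D'v D'w; apply: (hd_exists HC (RRspace_subspace D)) => m Hm.
have [p p0 vp] := vz_surj v (D v + 1); have [hv _] := pdegP v.
apply: (hd_indep_le HC (vge_subspace v 1) hv).
apply: (indep_scale (z := p) (V := RRspace D') (W := RRspace D)) Hm => [|u|u].
- exact: RRspace_subspace.
- by move=> /RRspaceE/(_ v); rewrite D'v => /(vge_mull p); rewrite vp subrr.
move=> /RRspaceE H Hv; apply/RRspaceE => w.
have [->|wv] := eqVneq w v; last by rewrite -D'w.
by apply: (vge_mul2l p0); rewrite vp addrAC subrr add0r.
Qed.

Lemma RR_mono D D' : is_divisor D -> is_divisor D' -> (forall v, D v <= D' v) ->
  exists2 n, n%:Z <= divdeg D' - divdeg D & has_dim C (RRspace D') (RRspace D) n.
Proof.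
move=> HD HD' le; have [s us sE] := divisor_seq2 HD HD'.
move: {2}(\sum_(v <- s) `|D' v - D v|)%N (erefl (\sum_(v <- s) `|D' v - D v|)%N) => N.
elim: N D' HD' le sE => [|N IH] D' HD' le sE sumE.
  have -> : D' = D.
    apply/funext => v; have [sv|sv] := boolP (v \in s); last by case: (sE v sv) => -> ->.
    by move/eqP: sumE; rewrite sum_nat_seq_eq0 => /allP/(_ v sv)/eqP; lia.
  exists 0%N; first by rewrite subrr.
  by exists (fun=> 0); split=> [[]|c _ _ []|y Dy] //; exists (fun=> 0); split=> [[]//|];
     rewrite big_ord0 subr0.
have /hasP [v sv Dv] : has (fun v => D' v != D v) s.
  apply/negPn; rewrite -all_predC; apply/negP => /allP H; move: sumE.
  by rewrite big_seq big1 // => v /H /= /negPn/eqP ->; rewrite subrr.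
pose D1 w := if w == v then D' v - 1 else D' w.
have D1w w : w != v -> D' w = D1 w by rewrite /D1 => /negPf ->.
have D1v : D' v = D1 v + 1 by rewrite /D1 eqxx subrK.
have D1E w : D1 w = D' w + (if w == v then -1 else 0).
  by rewrite /D1; case: eqP => [->|_] //; rewrite addr0.
have sE1 w : w \notin s -> D w = 0 /\ D1 w = 0.
  move=> sw; case: (sE w sw) => -> H; split=> //; rewrite -D1w //.
  by apply: contraNneq sw => ->.
have HD1 : is_divisor D1 by apply: (seq_divisor (s := s)) => w /sE1 [].
have le1 w : D w <= D1 w.
  by rewrite /D1; case: eqP => [->|_] //; have := le v; move/eqP: Dv; lia.
have [|n1 ln1 hn1] := IH D1 HD1 le1 sE1.
  have EX : (\sum_(w <- rem v s) `|D1 w - D w| = \sum_(w <- rem v s) `|D' w - D w|)%N.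
    by apply: eq_big_seq => w; rewrite mem_rem_uniq // inE => /andP[wv _]; rewrite -D1w.
  move: sumE; rewrite !(big_rem v sv) /= EX D1v; have := le1 v.
  by move: (\sum_(w <- rem v s) _)%N (D1 v) (D v) => X a b; lia.
have [n2 ln2 hn2] := RR_step D1v D1w.
exists (n2 + n1)%N; last first.
  apply: (hd_cat HC) hn2 hn1; try exact: RRspace_subspace; try exact: RRspace_le.
  by apply: RRspace_le => w; rewrite D1E; case: eqP; lia.
have degE : divdeg D' = divdeg D1 + (pdeg v)%:Z.
  rewrite !(divdeg_seq us) => [|w /sE1 []//|w /sE []//].
  rewrite !(big_rem v sv) /= D1v mulrDl mul1r addrAC; congr (_ + _ + _).
  by apply: eq_big_seq => w; rewrite mem_rem_uniq // inE => /andP[wv _]; rewrite -D1w.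
by rewrite degE PoszD; move: ln1 ln2; lia.
Qed.

Lemma RRdimP D : is_divisor D -> has_dim C (RRspace D) [set 0] (RRdim D).
Proof.
move=> HD; pose D1 v : int := if 0 <= D v then D v else 0.
have HD1 : is_divisor D1.
  have [s _ sE] := divisor_seq HD; apply: (seq_divisor (s := s)) => v /sE.
  by rewrite /D1 => ->.
have D0 : is_divisor (fun _ : place j => 0 : int) by apply: (seq_divisor (s := [::])).
have [|n _ hn] := RR_mono D0 HD1; first by move=> v; rewrite /D1; case: ifP.
have hn1 : has_dim C (RRspace D1) [set 0] (n + 1).
  apply: (hd_cat HC) hn _; rewrite ?RRspace0; try exact: subspace_set0.
  - by split; [exact: (subfield0 HC)|move=> c u w Cc Cu Cw; apply/(subfieldD HC)/Cw/(subfieldM HC)].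
  - by rewrite -RRspace0; apply: RRspace_le => v; rewrite /D1; case: ifP.
  - by move=> _ ->; exact: (subfield0 HC).
  - exact: has_dim_constants.
have [|m _ hm] := @hd_sub _ _ HC (RRspace D) (RRspace D1) [set 0] _ (subspace_set0 C) _ hn1.
  by apply: RRspace_le => v; rewrite /D1; case: ifP => //; lia.
by rewrite /RRdim (dimqE HC _ hm) //; exact: subspace_set0.
Qed.

Lemma RRdim_mono D D' : is_divisor D -> is_divisor D' -> (forall v, D v <= D' v) ->
  (RRdim D')%:Z - (RRdim D)%:Z <= divdeg D' - divdeg D.
Proof.
move=> HD HD' le; have [n ln hn] := RR_mono HD HD' le.
have D0 : [set 0] `<=` RRspace D by move=> _ ->; case: (RRspace_subspace D).
have H := hd_cat HC (RRspace_subspace D) (subspace_set0 C) (RRspace_le le) D0 hn (RRdimP HD).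
have -> : RRdim D' = (n + RRdim D)%N by exact: (hd_uniq HC (subspace_set0 C) (RRdimP HD')).
by rewrite PoszD addrK.
Qed.

Lemma RRdim0 : RRdim (fun _ : place j => 0 : int) = 1%N.
Proof.
by rewrite /RRdim RRspace0; apply: (dimqE HC (subspace_set0 C)); exact: has_dim_constants.
Qed.

Lemma RRdim_le D : is_divisor D -> (forall v, 0 <= D v) -> (RRdim D)%:Z <= divdeg D + 1.
Proof.
move=> HD D0; have H0 : is_divisor (fun _ : place j => 0 : int) by apply: (seq_divisor (s := [::])).
have := RRdim_mono H0 HD D0; rewrite RRdim0.
rewrite (divdeg_seq (D := fun=> 0) (s := [::])) // big_nil; lia.
Qed.

End Riemann.

(** * Degrees of principal divisors and existence of the genus *)

Section RiemannInequality.
Variables (k0 E F : fieldType) (j : {rmorphism k0 -> F}) (iota : {rmorphism E -> F}).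
Hypothesis constE : constants j = range iota.
Hypothesis Hfin : forall x, exists N, forall n (u : 'I_n -> F), xfree iota x u -> (n <= N)%N.
Implicit Types (D : place j -> int) (v : place j) (x z : F).
Local Notation C := (constants j).
Local Notation ev := (peval iota).
Let HC : subfield_set C := constants_subfield j.

Lemma nonconst_neq0 x : ~ C x -> x != 0.
Proof. by move=> Nx; apply/eqP => x0; apply: Nx; rewrite x0; exact: (subfield0 HC). Qed.

Lemma vge_peval v x (p : {poly E}) : vge v 0 x -> vge v 0 (ev x p).
Proof.
move=> vx; elim/poly_ind: p => [|p c IH]; first by rewrite peval0; exact: vge0.
rewrite pevalD pevalM pevalX pevalC; apply: vgeD; first by rewrite -[0]addr0; apply: vgeM.
by apply: vge_const; exact: constants_iota.
Qed.

(** The space L(n (x)_oo), where (x)_oo is the pole divisor of x. *)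
Definition poleb x (n : nat) : set F := RRspace (fun v : place j => n%:Z * poles x v).

Lemma polebE x n z : poleb x n z <-> forall v, vge v (- (n%:Z * poles x v)) z.
Proof. exact: RRspaceE. Qed.

Lemma poleb_subspace x n : subspace C (poleb x n).
Proof. exact: RRspace_subspace. Qed.

Lemma poleb_le x n m : (n <= m)%N -> poleb x n `<=` poleb x m.
Proof.
move=> nm; apply: RRspace_le => v; apply: ler_wpM2r; first exact: poles_ge0.
by rewrite lez_nat.
Qed.

Lemma polebM x n m y z : poleb x n y -> poleb x m z -> poleb x (n + m) (y * z).
Proof.
move=> /polebE Hy /polebE Hz; apply/polebE => v.
by rewrite PoszD mulrDl opprD; apply: vgeM.
Qed.

Lemma poleb_const x c : C c -> poleb x 0 c.
Proof. by move=> Cc; apply/polebE => v; rewrite mul0r oppr0; exact: vge_const. Qed.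

Lemma poleb_gen x : poleb x 1 x.
Proof.
apply/polebE => v; rewrite mul1r /poles; case: ifP => [_|/negbT].
  by rewrite opprK; exact: vge_vz.
by rewrite -leNgt oppr0 => vx; apply: vgeS (vge_vz v x).
Qed.

Lemma polebX x n y m : poleb x n y -> poleb x (m * n) (y ^+ m).
Proof.
move=> Hy; elim: m => [|m IH]; first by apply: poleb_const; exact: (subfield1 HC).
by rewrite exprS mulSn; apply: polebM.
Qed.

Lemma poleb_peval x (p : {poly E}) n : (size p <= n.+1)%N -> poleb x n (ev x p).
Proof.
move=> sp; rewrite /peval (horner_coef_wide (n := n.+1)) ?size_map_poly //.
apply: (subspace_ssum HC _ (poleb_subspace x n)) => i _.
rewrite coef_map; have := polebX i (poleb_gen x); rewrite muln1 => H.
have := polebM (poleb_const x (constants_iota constE p`_i)) H; apply: poleb_le.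
by rewrite add0n -ltnS.
Qed.

(** Times the leading coefficient of an equation for z over E[x], z becomes integral over E[x], so
    it is integral wherever x is. *)
Lemma clear_poles x z : ~ C x -> exists2 p : {poly E}, p != 0 & exists n, poleb x n (ev x p * z).
Proof.
move=> Nx; have x0 := nonconst_neq0 Nx; have [N HN] := Hfin x.
have : ~ xfree iota x (fun i : 'I_N.+1 => z ^+ i) by move/HN; rewrite ltnn.
move=> /existsNP [p /not_implyP [eqp /existsNP [i0 /eqP pi0]]].
have [m pm0 pmax] := @arg_maxnP _ i0 (fun i => p i != 0) (fun i => nat_of_ord i) pi0.
have {}pmax (i : 'I_N.+1) : (m < i)%N -> p i = 0.
  by move=> mi; apply/eqP; apply: contraT => /pmax /=; rewrite leqNgt mi.
pose a := ev x (p m); pose w := a * z.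
have wE : w ^+ m * a + \sum_(i < N.+1 | (i < m)%N) ev x (p i) * a ^+ (m - i) * w ^+ i = 0.
  rewrite -[RHS](mulr0 (a ^+ m)) -[X in _ = _ * X]eqp mulr_sumr [RHS](bigD1 m) //=.
  rewrite [X in _ = _ + X](bigID (fun i : 'I_N.+1 => (i < m)%N)) /=.
  rewrite [X in _ = _ + (_ + X)]big1 => [|i /andP[im]]; last first.
    rewrite -leqNgt => mi; rewrite pmax ?peval0 ?mul0r ?mulr0 // ltn_neqAle mi andbT eq_sym.
    by [].
  rewrite addr0; congr (_ + _); first by rewrite /w exprMn -/a; ring.
  apply: eq_big => [i|i im]; first by case: eqP => [->|_] //=; rewrite ltnn.
  by rewrite /w exprMn -[in RHS](subnK (ltnW im)) exprD; ring.
have m0 : (0 < m)%N.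
  rewrite lt0n; apply: contraTneq pm0 => m0; apply/negPn/eqP; apply: (peval_eq0 constE Nx).
  by move: wE; rewrite m0 expr0 mul1r big_pred0 ?addr0.
have a0 : a != 0 by apply: contra pm0 => /eqP/(peval_eq0 constE Nx) ->.
have wint v : vge v 0 x -> vge v 0 w.
  move=> vx; have [->|w0] := eqVneq w 0; first exact: vge0.
  rewrite vgeE // leNgt; apply/negP => wlt.
  have : vge v (vz v w *+ m.-1 + vz v a) (w ^+ m * a).
    have -> : w ^+ m * a = - (a * \sum_(i < N.+1 | (i < m)%N) ev x (p i) * a ^+ (m - i).-1 * w ^+ i).
      apply/eqP; rewrite -addr_eq0 mulr_sumr -[X in _ == X]wE; apply/eqP; congr (_ + _).
      apply: eq_bigr => i im; have -> : a ^+ (m - i) = a * a ^+ (m - i).-1.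
        by rewrite -exprS prednK // subn_gt0.
      by ring.
    apply: vgeN; rewrite addrC; apply: vge_mull; apply: vge_sum => i im.
    rewrite -[_ *+ _]add0r; apply: vgeM.
      rewrite -[0]addr0; apply: vgeM; first exact: vge_peval.
      by have := vgeX (m - i).-1 (vge_peval (p m) vx); rewrite mul0rn.
    apply: vgeS (vgeX i (vge_vz v w)); rewrite -![vz v w *+ _]mulr_natr.
    by rewrite ler_nM2l // ler_nat -ltnS prednK.
  rewrite vgeE ?mulf_neq0 ?expf_neq0 // vzM ?expf_neq0 // vzX lerD2r.
  by rewrite -[X in _ <= _ *+ X](prednK m0) mulrS lerDr leNgt wlt.
exists (p m) => //.
have [s us sE] := divisor_seq (poles_divisor constE Hfin x).
exists (\sum_(v <- s) `|vz v w|)%N; apply/polebE => v.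
have [vx|vx] := ltP (vz v x) 0; last first.
  by rewrite /poles ltNge vx mulr0 oppr0; apply: wint; rewrite vgeE.
apply: vgeS (vge_vz v w).
have sv : v \in s.
  by apply: contraT => /sE; rewrite /poles vx => /eqP; rewrite oppr_eq0 => /eqP E1; rewrite E1 ltxx in vx.
rewrite (big_rem v sv) /= /poles vx.
move: (\sum_(v' <- rem v s) _)%N (vz v w) (vz v x) vx => X b c c0; nia.
Qed.

(** Clear the poles of a family independent over E(x) and multiply it by the powers x^k with k at
    most n - n0: the products remain in L(n (x)_oo) and are independent over the constants. *)
Lemma xdeg_RRdim x r : ~ C x -> xdeg iota x r ->
  exists n0, forall n, (n0 <= n)%N ->
    (r * (n - n0).+1 <= RRdim (fun v : place j => (n%:Z * poles x v)%R))%N.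
Proof.
move=> Nx [[u fu] _].
have /choice [p Hp] : forall i, exists p, p != 0 /\ exists n, poleb x n (ev x p * u i).
  by move=> i; have [p] := clear_poles (u i) Nx; exists p.
have /choice [m Hm] : forall i, exists n, poleb x n (ev x (p i) * u i).
  by move=> i; case: (Hp i).
exists (\sum_i m i)%N => n n0.
have HD : is_divisor (fun v : place j => n%:Z * poles x v).
  by apply: divisorZ; exact: poles_divisor constE Hfin x.
apply: (hd_indep_le HC (subspace_set0 C) (RRdimP constE Hfin HD)).
have -> : (r * (n - \sum_i m i).+1 = #|{: 'I_r * 'I_(n - \sum_i m i).+1}|)%N.
  by rewrite card_prod !card_ord.
apply: (@indep_fin _ C _ (poleb x n) [set 0] (fun t : 'I_r * 'I_(n - \sum_i m i).+1 => x ^+ t.2 * (ev x (p t.1) * u t.1))).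
  move=> [i k] /=; have Hmi : (m i <= \sum_i m i)%N by rewrite (bigD1 i) //= leq_addr.
  have := polebX k (poleb_gen x); rewrite muln1 => /polebM /(_ (Hm i)).
  by apply: poleb_le; have := ltn_ord k; lia.
move=> c; rewrite constE => Sc sum0.
have /choice [e He] : forall t, exists e, iota e = c t by move=> t; have [e _ <-] := Sc t; exists e.
pose q i := \poly_(k < (n - \sum_i m i).+1) (if insub k is Some l then e (i, l) else 0).
have qE i : ev x (q i) = \sum_k c (i, k) * x ^+ k.
  rewrite /peval (horner_coef_wide (n := (n - \sum_i m i).+1)) ?size_map_poly ?size_poly //.
  apply: eq_bigr => k _; rewrite coef_map coef_poly ltn_ord.
  by rewrite (valK k) -He.
have : forall i, q i * p i = 0.
  apply: fu; rewrite -[RHS]sum0.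
  transitivity (\sum_i \sum_k c (i, k) * (x ^+ k * (ev x (p i) * u i))).
    apply: eq_bigr => i _; rewrite pevalM qE -mulrA mulr_suml.
    by apply: eq_bigr => k _; rewrite -mulrA.
  by rewrite pair_bigA; apply: eq_bigr => -[].
move=> q0 [i k]; have := q0 i; case: (Hp i) => pi0 _ /eqP; rewrite mulf_eq0 (negPf pi0) orbF.
move=> /eqP/polyP/(_ k); rewrite coef_poly ltn_ord coef0 (valK k) -He => ->.
by rewrite rmorph0.
Qed.

(** The dimension of L(n (x)_oo) is at least rn - O(1) and at most n deg (x)_oo + 1; a large n
    forces the missing inequality. *)
Lemma poles_degE x r : ~ C x -> xdeg iota x r -> divdeg (poles x : place j -> int) = r%:Z.
Proof.
move=> Nx Hr; apply/eqP; rewrite eq_le (poles_deg_le constE Hfin) ?nonconst_neq0 //=.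
have [n0 Hn0] := xdeg_RRdim Nx Hr.
have HD n : is_divisor (fun v : place j => n%:Z * poles x v).
  by apply: divisorZ; exact: poles_divisor constE Hfin x.
have ub n : (RRdim (fun v : place j => n%:Z * poles x v))%:Z <=
    n%:Z * divdeg (poles x : place j -> int) + 1.
  rewrite -divdegZ; last exact: poles_divisor constE Hfin x.
  apply: (RRdim_le constE Hfin (HD n)) => v.
  by rewrite mulr_ge0 // poles_ge0.
rewrite leNgt; apply/negP => lt.
pose n := (n0 + r * n0 + 2)%N.
have := Hn0 n; have := ub n; move: (RRdim _) (divdeg _) lt => a b lt.
rewrite /n; move=> h1 /(_ ltac:(lia)); have -> : (n0 + r * n0 + 2 - n0 = r * n0 + 2)%N by lia.
nia.
Qed.

Lemma vz_poles v z : vz v z = poles z^-1 v - poles z v.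
Proof.
rewrite /poles vzV; case: ifP => [h|/negbT h]; first by rewrite ifF ?opprK ?subr0 //; lia.
by rewrite sub0r; case: ifP => [h'|/negbT h']; lia.
Qed.

Lemma principal_divisor z : is_divisor (fun v : place j => vz v z).
Proof.
have -> : (fun v : place j => vz v z) = (fun v => poles z^-1 v + (-1) * poles z v).
  by apply/funext => v; rewrite vz_poles mulN1r.
by apply: divisorD; [|apply: divisorZ]; apply: poles_divisor constE Hfin _.
Qed.

(** The zeros of z are the poles of 1/z, and the degrees of F over E(z) and E(1/z) agree. *)
Lemma principal_deg z : divdeg (fun v : place j => vz v z) = 0.
Proof.
have [Cz|Nz] := pselect (C z).
  have -> : (fun v : place j => vz v z) = (fun=> 0) by apply/funext => v; rewrite vz_const.
  by rewrite (divdeg_seq (s := [::])) // big_nil.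
have -> : (fun v : place j => vz v z) = (fun v => poles z^-1 v + (-1) * poles z v).
  by apply/funext => v; rewrite vz_poles mulN1r.
have Hd y : is_divisor (poles y : place j -> int) by apply: poles_divisor constE Hfin _.
rewrite divdegD ?divdegZ //; last exact: divisorZ.
have [N HN] := Hfin z; have [r _ Hr] := xdeg_exists HN.
rewrite (poles_degE Nz Hr) (poles_degE _ (xdeg_inv (nonconst_neq0 Nz) Hr)); first by lia.
by move=> /(subfieldV HC); rewrite invrK.
Qed.

Lemma RRspace_zeros D z v : is_divisor D -> z != 0 -> RRspace D z ->
  (vz v z + D v) * (pdeg v)%:Z <= divdeg D.
Proof.
move=> HD z0 /RRspaceE Hz.
have Hpd := principal_divisor z; rewrite -[leRHS]add0r -(principal_deg z) -divdegD //.
have [s us sE] := divisor_seq2 Hpd HD.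
have ge0 w : 0 <= vz w z + D w by have := Hz w; rewrite vgeE //; lia.
rewrite (divdeg_seq us) => [|w /sE [-> ->]//].
have sum_ge0 (s' : seq (place j)) : 0 <= \sum_(w <- s') (vz w z + D w) * (pdeg w)%:Z.
  by apply: sumr_ge0 => w _; apply: mulr_ge0.
have [sv|/sE [-> ->]] := boolP (v \in s); last by rewrite mul0r.
by rewrite (big_rem v sv) /= lerDl.
Qed.

Lemma RRdim_mul D z : z != 0 -> is_divisor D ->
  RRdim (fun v => D v - vz v z) = RRdim D.
Proof.
move=> z0 HD; rewrite {1}/RRdim; apply: (dimqE HC (subspace_set0 C)).
apply: (has_dim_scale z0 _ _ (RRdimP constE Hfin HD)) => u.
  have Ev v : vge v (- D v) u <-> vge v (- (D v - vz v z)) (z * u).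
    rewrite opprB [vz v z - D v]/(_ + _); split; first exact: vge_mull.
    exact: vge_mul2l.
  by rewrite !RRspaceE; split=> H v; apply/Ev/H.
split=> [->|/eqP]; first by rewrite /= mulr0.
by rewrite mulf_eq0 (negPf z0) => /eqP.
Qed.

Lemma residue_algebraic v x : vge v 0 x -> exists2 p : {poly E}, p != 0 & vge v 1 (ev x p).
Proof.
move=> vx; have [hv _] := pdegP constE Hfin v.
have : ~ indep C (vge v 0) (vge v 1) (pdeg v).+1.
  by move=> /(hd_indep_le HC (vge_subspace v 1) hv); rewrite ltnn.
move=> H; apply: contrapT => Hp; apply: H; exists (fun i => x ^+ i); split=> [i|c].
  by have := vgeX i vx; rewrite mul0rn.
rewrite constE => Sc Hs.
have /choice [e He] : forall t, exists e, iota e = c t by move=> t; have [e _ <-] := Sc t; exists e.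
pose p := \poly_(k < (pdeg v).+1) (if insub k is Some l then e l else 0).
have pE : ev x p = \sum_k c k * x ^+ k.
  rewrite /peval (horner_coef_wide (n := (pdeg v).+1)) ?size_map_poly ?size_poly //.
  by apply: eq_bigr => k _; rewrite coef_map coef_poly ltn_ord (valK k) -He.
have p0 : p = 0.
  by apply/eqP; apply: contrapT => /negP p0; apply: Hp; exists p => //; rewrite pE.
move=> i; have /polyP/(_ i) := p0; rewrite coef_poly ltn_ord coef0 (valK i) -He => ->.
by rewrite rmorph0.
Qed.

(** deg D - l(D) is monotone in D and invariant under addition of principal divisors. A product of
    polynomials in x vanishing at the places of D moves D below some n (x)_oo, for which
    [xdeg_RRdim] bounds the difference independently of n. *)
Lemma riemann_bound x : ~ C x -> exists B : int, forall D, is_divisor D ->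
  divdeg D - (RRdim D)%:Z <= B.
Proof.
move=> Nx; have [N HN] := Hfin x; have [r _ Hr] := xdeg_exists HN.
have [n0 Hn0] := xdeg_RRdim Nx Hr.
exists (r%:Z * n0%:Z) => D HD.
have [s us sE] := divisor_seq HD.
have /choice [p Hp] : forall v, exists p : {poly E}, p != 0 /\ (vge v 0 x -> vge v 1 (ev x p)).
  move=> v; have [vx|Nvx] := pselect (vge v 0 x); last by exists 1; rewrite oner_neq0.
  by have [p p0 vp] := residue_algebraic vx; exists p.
pose q := \prod_(v <- s) p v ^+ `|D v|%N; pose z := ev x q.
have q0 : q != 0 by rewrite prodf_seq_neq0; apply/allP => v _; rewrite expf_neq0 //; case: (Hp v).
have z0 : z != 0 by apply: contra q0 => /eqP/(peval_eq0 constE Nx) ->.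
have zfin v : vge v 0 x -> D v <= vz v z.
  move=> vx; have zpos : vge v 0 z by apply: vge_peval.
  have [sv|/sE ->] := boolP (v \in s); last by rewrite -vgeE.
  rewrite -vgeE // /z /q (big_rem v sv) /= pevalM -[X in vge _ X _]addr0; apply: vgeM; last exact: vge_peval.
  have Hpw := vgeX `|D v|%N ((Hp v).2 vx).
  have -> : ev x (p v ^+ `|D v|%N) = ev x (p v) ^+ `|D v|%N by rewrite /peval rmorphXn horner_exp.
  by apply: vgeS Hpw; rewrite pmulrn intz; lia.
have HD' : is_divisor (fun v => D v - vz v z).
  have -> : (fun v => D v - vz v z) = (fun v => D v + (-1) * vz v z).
    by apply/funext => v; rewrite mulN1r.
  by apply: divisorD => //; apply: divisorZ; exact: principal_divisor.
have degD' : divdeg (fun v => D v - vz v z) = divdeg D.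
  have -> : (fun v => D v - vz v z) = (fun v => D v + (-1) * vz v z).
    by apply/funext => v; rewrite mulN1r.
  rewrite divdegD ?divdegZ ?principal_deg ?mulr0 ?addr0 //; first exact: principal_divisor.
  by apply: divisorZ; exact: principal_divisor.
have [t ut tE] := divisor_seq2 HD' (poles_divisor constE Hfin x).
pose n := (n0 + \sum_(v <- t) `|D v - vz v z|)%N.
have le v : D v - vz v z <= n%:Z * poles x v.
  have [vx|vx] := leP 0 (vz v x).
    have := zfin v; have := poles_ge0 x v; rewrite vgeE ?nonconst_neq0 // => h /(_ vx); nia.
  have tv : v \in t.
    by apply: contraT => /tE [_]; rewrite /poles vx; lia.
  rewrite /n (big_rem v tv) /= /poles vx.
  by move: (\sum_(w <- rem v t) _)%N (D v - vz v z) (vz v x) vx => X a b b0; nia.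
have HnT : is_divisor (fun v : place j => n%:Z * poles x v).
  by apply: divisorZ; exact: poles_divisor constE Hfin x.
have := RRdim_mono constE Hfin HD' HnT le; rewrite (RRdim_mul z0 HD) degD'.
rewrite divdegZ ?(poles_degE Nx Hr); last exact: poles_divisor constE Hfin x.
have := Hn0 n (leq_addr _ _); move: (RRdim _) (RRdim _) (divdeg D) => a b d.
have : (n0 <= n)%N by exact: leq_addr.
move: {+}n => n1; nia.
Qed.

Lemma genus_exists : (exists x, ~ C x) -> is_genus j (genus j).
Proof.
move=> [x Nx]; have [B HB] := riemann_bound Nx; rewrite /genus.
suff [g Hg] : exists g, is_genus j g by exact: xgetI Hg.
pose P m := `[< exists D, is_divisor D /\ B - (divdeg D - (RRdim D)%:Z) = m%:Z >].
pose D0 (_ : place j) : int := 0.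
have H0 : is_divisor D0 by apply: (seq_divisor (s := [::])).
have Pex : exists m, P m.
  exists (absz (B - (divdeg D0 - (RRdim D0)%:Z))%R).
  by apply/asboolP; exists D0; split=> //; rewrite gez0_abs // subr_ge0; apply: HB.
case: (ex_minnP Pex) => m /asboolP [D [HD Dm]] min.
exists (divdeg D - (RRdim D)%:Z + 1); split; first by exists D.
move=> D' HD'; have le' := HB D' HD'.
have : (m <= absz (B - (divdeg D' - (RRdim D')%:Z))%R)%N.
  by apply: min; apply/asboolP; exists D'; split=> //; rewrite gez0_abs // subr_ge0.
rewrite -lez_nat gez0_abs ?subr_ge0 // -Dm.
move: (divdeg D) (divdeg D') (RRdim D) (RRdim D') => a b c d; lia.
Qed.

Lemma genus_ge0 g : is_genus j g -> 0 <= g.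
Proof.
have H0 : is_divisor (fun _ : place j => 0 : int) by apply: (seq_divisor (s := [::])).
move=> [_ /(_ _ H0)]; rewrite (RRdim0 constE Hfin) (divdeg_seq (s := [::])) // big_nil.
by rewrite sub0r addNr.
Qed.

End RiemannInequality.

HB.instance Definition _ (E F : fieldType) (iota : {rmorphism E -> F}) (x : F) :=
  GRing.RMorphism.copy (peval iota x) (horner_eval x \o map_poly iota).

(** * Stepanov's method *)

Section FrobeniusPower.
Variables (E : finFieldType) (F : fieldType) (iota : {rmorphism E -> F}).

Lemma card_pchar_nat : ([pchar F]).-nat #|E|.
Proof.
have [p p_pr pE] := finPcharP E.
have [n En] : exists n, #|E| = (p ^ n)%N.
  have := abelem_pgroup (fin_ring_pchar_abelem pE); rewrite /pgroup cardsT => /p_natP [n ->].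
  by exists n.
rewrite En pnatX pnatE // (fmorph_pchar iota) pE //.
Qed.

(** The embedding is an argument because additivity depends on it: it makes #|E| a power of the
    characteristic of F. *)
Definition frob of {rmorphism E -> F} := fun x : F => x ^+ #|E|.

Lemma frob_nmod : nmod_morphism (frob iota).
Proof.
split; first by rewrite /frob expr0n; case: #|E| (finNzRing_gt1 E).
by move=> x y; rewrite /frob exprDn_pchar // card_pchar_nat.
Qed.

Lemma frob_monoid : monoid_morphism (frob iota).
Proof. by split=> [|x y]; rewrite /frob ?expr1n ?exprMn. Qed.

HB.instance Definition _ := GRing.isNmodMorphism.Build F F (frob iota) frob_nmod.
HB.instance Definition _ := GRing.isMonoidMorphism.Build F F (frob iota) frob_monoid.

Lemma frob_iota c : frob iota (iota c) = iota c.
Proof. by rewrite /frob -rmorphXn expf_card. Qed.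

End FrobeniusPower.

(** * Irreducibility of the equation over F(T) *)

Section FactorsOverConstants.
Variables (E : finFieldType) (F : fieldType) (iota : {rmorphism E -> F}).
Hypothesis Ealg : forall x p, p != 0 -> peval iota x p = 0 -> exists c, x = iota c.

Local Notation s1 := (map_poly (frob iota)).
Local Notation s2 := (map_poly (map_poly (frob iota))).

(** A fixed point of a power of Frobenius is algebraic over E, and E is algebraically closed in F by
    [Ealg]. *)
Lemma frob_fixed x n : iter n.+1 (frob iota) x = x -> exists c, x = iota c.
Proof.
have iterE m : iter m (frob iota) x = x ^+ (#|E| ^ m).
  elim: m => [|m IH]; first by rewrite expn0.
  by rewrite iterS IH /frob -exprM -expnSr.
move=> fx; apply: (Ealg (p := 'X^(#|E| ^ n.+1) - 'X)).
  rewrite -size_poly_eq0 size_polyDl size_polyXn // size_polyN size_polyX ltnS.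
  by rewrite -[X in (X < _)%N](expn0 #|E|) ltn_exp2l ?finNzRing_gt1.
by rewrite pevalD pevalN pevalXn pevalX -iterE fx subrr.
Qed.

Lemma s1_fixed (u : {poly F}) n : iter n.+1 s1 u = u -> exists u', u = map_poly iota u'.
Proof.
move=> su; have iterE m i : (iter m s1 u)`_i = iter m (frob iota) u`_i.
  by elim: m => //= m IH; rewrite coef_map IH.
have /choice [e He] : forall i, exists c, u`_i = iota c.
  by move=> i; apply: (@frob_fixed _ n); rewrite -iterE su.
exists (\poly_(i < size u) e i); apply/polyP => i; rewrite coef_map coef_poly.
case: ltnP => [_|le]; first exact: He.
by rewrite nth_default //; apply: esym; exact: rmorph0.
Qed.

Variable f : {poly {poly E}}.
Let fT := map_poly (map_poly iota) f.

Lemma s2_fixed : s2 fT = fT.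
Proof.
rewrite /fT -map_poly_comp; apply: eq_map_poly => a /=.
by rewrite -map_poly_comp; apply: eq_map_poly => c; exact: frob_iota.
Qed.

Lemma s1_neq0 (a : {poly F}) : (s1 a == 0) = (a == 0).
Proof. exact: map_poly_eq0. Qed.

Lemma size_s2 (g : {poly {poly F}}) : size (s2 g) = size g.
Proof.
have [->|g0] := eqVneq g 0; first by rewrite rmorph0.
by apply: size_map_poly_id0; rewrite s1_neq0 lead_coef_eq0.
Qed.

Lemma dvdp_s2 (g h : {poly {poly F}}) : g %| h -> s2 g %| s2 h.
Proof.
move=> /Pdiv.Idomain.dvdpP [[c q] /= c0 /(congr1 s2)]; rewrite rmorphM /= map_polyZ => E1.
by apply/Pdiv.Idomain.dvdpP; exists (s1 c, s2 q); rewrite /= ?s1_neq0.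
Qed.

Lemma size_iter_s2 i (g : {poly {poly F}}) : size (iter i s2 g) = size g.
Proof. by elim: i => //= i IH; rewrite size_s2. Qed.

Lemma dvdp_iter_s2 i (g : {poly {poly F}}) : g %| fT -> iter i s2 g %| fT.
Proof.
by move=> gf; elim: i => //= i IH; rewrite -s2_fixed; apply: dvdp_s2.
Qed.

Lemma coef_iter_s2 i (g : {poly {poly F}}) k : (iter i s2 g)`_k = iter i s1 g`_k.
Proof. by elim: i => //= i IH; rewrite coef_map IH. Qed.

Lemma iter_s1M i : {morph iter i s1 : a b / a * b}.
Proof. by elim: i => // i IH a b; rewrite !iterS IH rmorphM. Qed.

Lemma iter_s1_eq0 i (a : {poly F}) : (iter i s1 a == 0) = (a == 0).
Proof. by elim: i => // i IH; rewrite iterS s1_neq0 IH. Qed.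

Lemma iter_s1_inj i : injective (iter i s1).
Proof. by elim: i => // i IH a b; rewrite !iterS => /map_poly_inj/IH. Qed.

Lemma monic_iter_s1 i (a : {poly F}) : a \is monic -> iter i s1 a \is monic.
Proof. by elim: i => // i IH am; rewrite iterS monic_map // IH. Qed.

Lemma size_iter_s1 i (a : {poly F}) : size (iter i s1 a) = size a.
Proof. by elim: i => // i IH; rewrite iterS size_map_poly IH. Qed.

(* The hypothesis says that u / v is fixed by a power of Frobenius. *)
Lemma fraction_fixed (u v : {poly F}) n : v != 0 ->
  u * iter n.+1 s1 v = iter n.+1 s1 u * v ->
  exists u' v', v' != 0 /\ u * map_poly iota v' = v * map_poly iota u'.
Proof.
move=> v0 uv; have [u0|u0] := eqVneq u 0.
  by exists 0, 1; rewrite oner_neq0 u0 rmorph0 mul0r mulr0.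
pose d := gcdp u v; have d0 : d != 0 by rewrite gcdp_eq0 (negPf u0).
pose c := lead_coef (v %/ d).
have vd0 : v %/ d != 0 by rewrite dvdp_div_eq0 ?dvdp_gcdr.
have c0 : c != 0 by rewrite lead_coef_eq0.
pose u1 := c^-1 *: (u %/ d); pose v1 := c^-1 *: (v %/ d).
have uE : u = c *: d * u1.
  by rewrite /u1 -scalerAl -scalerAr scalerA mulfV // scale1r mulrC divpK ?dvdp_gcdl.
have vE : v = c *: d * v1.
  by rewrite /v1 -scalerAl -scalerAr scalerA mulfV // scale1r mulrC divpK ?dvdp_gcdr.
have cd0 : c *: d != 0 by rewrite scaler_eq0 negb_or c0.
have v1m : v1 \is monic by rewrite monicE lead_coefZ mulVf.
have cop : coprimep v1 u1.
  rewrite coprimepZl ?invr_eq0 // coprimepZr ?invr_eq0 // coprimep_sym.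
  by rewrite coprimep_div_gcd // u0.
have E1 : u1 * iter n.+1 s1 v1 = iter n.+1 s1 u1 * v1.
  apply: (mulfI cd0); apply: (mulfI (_ : iter n.+1 s1 (c *: d) != 0)); first by rewrite iter_s1_eq0.
  have := uv; rewrite uE vE !iter_s1M => E2.
  transitivity (c *: d * u1 * (iter n.+1 s1 (c *: d) * iter n.+1 s1 v1)); first by ring.
  by rewrite E2; ring.
have sv1 : iter n.+1 s1 v1 = v1.
  apply/esym/eqP; rewrite -eqp_monic ?monic_iter_s1 // -dvdp_size_eqp ?size_iter_s1 //.
  by rewrite -(Gauss_dvdpr _ cop) E1 dvdp_mull.
have su1 : iter n.+1 s1 u1 = u1.
  by move: E1; rewrite sv1 => /(mulIf (monic_neq0 v1m)).
have [v' vE'] := s1_fixed sv1; have [u' uE'] := s1_fixed su1.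
exists u', v'; split; last by rewrite -vE' -uE' uE vE; ring.
by apply: contraNneq (monic_neq0 v1m) => v'0; rewrite vE' v'0 rmorph0.
Qed.

Variables (t y : F) (r : nat).
Hypotheses (fmonic : f \is monic) (sf : size f = r.+1).
Hypothesis fty : (map_poly (peval iota t) f).[y] = 0.
Hypothesis fmin : forall g : {poly {poly E}}, (size g <= r)%N ->
  (map_poly (peval iota t) g).[y] = 0 -> g = 0.

Lemma size_fT : size fT = r.+1.
Proof. by rewrite /fT size_map_poly_id0 ?sf // (monicP fmonic) rmorph1 oner_neq0. Qed.

Lemma fT_neq0 : fT != 0.
Proof. by rewrite -size_poly_eq0 size_fT. Qed.

(** Pseudo-division over E[T] turns such a factor into an identity c f = q g. Its value at (t, y)
    kills q or g, both of degree less than r in Y, against [fmin]. *)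
Lemma no_factor_over_constants (g : {poly {poly E}}) : (1 < size g <= r)%N ->
  ~~ (map_poly (map_poly iota) g %| fT).
Proof.
move=> /andP[g1 gr]; apply/negP => gf.
have g0 : g != 0 by rewrite -size_poly_eq0; case: size g1.
have inj : injective (map_poly iota : {poly E} -> {poly F}) by apply: map_poly_inj.
pose k := Pdiv.IdomainDefs.scalp f g; pose q := f %/ g; pose m := f %% g.
have divE := Pdiv.Idomain.divp_eq f g.
have mg : (size m < size g)%N by rewrite Pdiv.Idomain.ltn_modp.
have m0 : m = 0.
  apply/eqP; apply: contraLR gf => m0; apply/negP => gf.
  have : map_poly (map_poly iota) g %| map_poly (map_poly iota) m.
    have -> : m = lead_coef g ^+ Pdiv.IdomainDefs.scalp f g *: f - q * g.
      by rewrite divE addrC addKr.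
    rewrite rmorphB /= rmorphM /= map_polyZ dvdp_sub ?dvdp_mull //.
    by rewrite -mul_polyC dvdp_mull.
  have mm0 : map_poly (map_poly iota) m != 0.
    by rewrite -size_poly_eq0 size_map_inj_poly ?rmorph0 // size_poly_eq0.
  by move=> /(dvdp_leq mm0); rewrite !size_map_inj_poly ?rmorph0 // leqNgt mg.
move: divE; rewrite -/m m0 addr0 -/q; set c := lead_coef g ^+ _ => cE.
have c0 : c != 0 by rewrite expf_neq0 // lead_coef_eq0.
have qg0 : q * g != 0.
  by rewrite -cE -size_poly_eq0 size_scale ?sf.
have q0 : q != 0 by apply: contraNneq qg0 => ->; rewrite mul0r.
have sq : (size q <= r)%N.
  by have := size_mul q0 g0; rewrite -cE size_scale // sf; move: g1; move: (size q) (size g) => a b; lia.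
have /eqP := congr1 (fun h => (map_poly (peval iota t) h).[y]) cE.
rewrite map_polyZ hornerZ fty mulr0 rmorphM hornerM eq_sym mulf_eq0 => /orP[]/eqP.
  by move=> /(fmin sq) E0; rewrite E0 eqxx in q0.
by move=> /(fmin gr) E0; rewrite E0 eqxx in g0.
Qed.

(** Conjugates of a factor of least degree are associate or coprime. If no two were associate, the
    product of r + 1 of them would divide fT, which has degree r. *)
Lemma conj_factors (g : {poly {poly F}}) : (1 < size g)%N -> g %| fT ->
  (forall h : {poly {poly F}}, (1 < size h)%N -> h %| fT -> (size g <= size h)%N) ->
  exists i k : nat, (i < k)%N /\ iter i s2 g %= iter k s2 g.
Proof.
move=> g1 gf gmin; apply: contrapT => H.
have ne i k : (i < k)%N -> ~~ (iter i s2 g %= iter k s2 g).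
  by move=> ik; apply/negP => E1; apply: H; exists i, k.
have cop i k : (i < k)%N -> coprimep (iter i s2 g) (iter k s2 g).
  move=> ik; rewrite coprimep_def; apply: contraT => d1.
  set d := gcdp _ _ in d1; have df : d %| fT by exact: dvdp_trans (dvdp_gcdl _ _) (dvdp_iter_s2 i gf).
  have d0 : d != 0 by rewrite gcdp_eq0 negb_and -size_poly_eq0 size_iter_s2; case: size g1.
  have sd : (size g <= size d)%N.
    by apply: gmin => //; move: d1 d0; rewrite -size_poly_eq0; case: size => [|[]].
  have dE l : d %| iter l s2 g -> d %= iter l s2 g.
    move=> dl; rewrite -dvdp_size_eqp // eqn_leq size_iter_s2 sd andbT -(size_iter_s2 l g).
    by apply: dvdp_leq => //; rewrite -size_poly_eq0 size_iter_s2; case: size g1.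
  have := ne i k ik; rewrite -(eqp_ltrans (dE i (dvdp_gcdl _ _))).
  by rewrite (dE k (dvdp_gcdr _ _)).
have prodP n : (\prod_(i < n) iter i s2 g %| fT) /\
    (forall k, (n <= k)%N -> coprimep (\prod_(i < n) iter i s2 g) (iter k s2 g)) /\
    (n < size (\prod_(i < n) iter i s2 g)%R)%N.
  elim: n => [|n [IH1 [IH2 IH3]]].
    by rewrite big_ord0 size_poly1; split; [exact: dvd1p|split=> // k _; exact: coprime1p].
  rewrite big_ord_recr /=; split; last split.
  - by rewrite Gauss_dvdp ?IH1 ?dvdp_iter_s2 //; apply: IH2.
  - by move=> k nk; rewrite coprimepMl IH2 ?cop // ltnW.
  - have A0 : \prod_(i < n) iter i s2 g != 0 by rewrite -size_poly_eq0; case: size IH3.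
    have B0 : iter n s2 g != 0 by rewrite -size_poly_eq0 size_iter_s2; case: size g1.
    rewrite size_mul // size_iter_s2; move: IH3 g1; move: (size g) (size _) => a b; lia.
have [/dvdp_leq + [_]] := prodP r.+1; rewrite size_fT => /(_ fT_neq0) + lt.
by rewrite leqNgt lt.
Qed.

(* Frobenius acting on coefficients permutes the factors of f over F(T) and
   some power of it fixes one of them, which therefore has coefficients over
   E(T), the constant field being algebraically closed in F. *)
Lemma coprime_fT (p : {poly {poly F}}) : p != 0 -> (size p <= r)%N -> (size (gcdp p fT) <= 1)%N.
Proof.
move=> p0 pr; rewrite leqNgt; apply/negP => g1.
pose P n := `[< exists g : {poly {poly F}}, [/\ (1 < size g)%N, g %| fT & size g = n] >].
have Pex : exists n, P n.
  by exists (size (gcdp p fT)); apply/asboolP; exists (gcdp p fT); split=> //; exact: dvdp_gcdr.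
case: (ex_minnP Pex) => n /asboolP [g [sg gf gn]] nmin.
have gmin (h : {poly {poly F}}) : (1 < size h)%N -> h %| fT -> (size g <= size h)%N.
  by move=> h1 hf; rewrite gn; apply: nmin; apply/asboolP; exists h.
have gr : (size g <= r)%N.
  apply: leq_trans (gmin _ g1 (dvdp_gcdr _ _)) _.
  by apply: leq_trans pr; apply: leq_gcdpl.
have [i [k [ik /eqpP [[c1 c2] /= /andP[c10 c20] cE]]]] := conj_factors sg gf gmin.
have g0 : g != 0 by rewrite -size_poly_eq0; case: size sg.
pose v := lead_coef g; have v0 : v != 0 by rewrite lead_coef_eq0.
(* Eliminating c1 and c2 shows that the ratio of each coefficient to the leading one has the same
   image under both iterates. As the i-th iterate is injective, this ratio is fixed by the (k -
   i)-th. *)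
have coefE a : iter i s1 g`_a * iter k s1 v = iter k s1 g`_a * iter i s1 v.
  have cEa b : c1 * iter i s1 g`_b = c2 * iter k s1 g`_b.
    by rewrite -!coef_iter_s2 -!coefZ cE.
  apply: (mulfI c10); apply: (mulfI c20).
  transitivity ((c1 * iter i s1 g`_a) * (c2 * iter k s1 v)); first by ring.
  by rewrite cEa -(cEa (size g).-1); ring.
have fracE a : exists uv, uv.2 != 0 /\ g`_a * map_poly iota uv.2 = v * map_poly iota uv.1.
  have [|u' [v' [v'0 E1]]] := @fraction_fixed g`_a v (k - i).-1 v0; last by exists (u', v').
  apply: (@iter_s1_inj i); rewrite !iter_s1M -!iterD prednK ?subn_gt0 //.
  by rewrite addnC subnK ?coefE // ltnW.
have /choice [e He] := fracE.
pose V := \prod_(a < size g) (e a).2.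
pose W (a : nat) := \prod_(b < size g | b != a :> nat) (e b).2.
have V0 : V != 0 by apply/prodf_neq0 => a _; case: (He a).
have VE a : (a < size g)%N -> V = (e a).2 * W a.
  by move=> ag; rewrite /V (bigD1 (Ordinal ag)).
pose g' := \poly_(a < size g) ((e a).1 * W a).
have gE : map_poly iota V *: g = v *: map_poly (map_poly iota) g'.
  apply/polyP => a; rewrite !coefZ coef_map coef_poly.
  case: ltnP => ag; last first.
    rewrite nth_default // mulr0; apply/esym; transitivity (v * 0); last exact: mulr0.
    by congr (_ * _); exact: rmorph0.
  have mM (q1 q2 : {poly E}) : map_poly iota (q1 * q2) = map_poly iota q1 * map_poly iota q2.
    exact: rmorphM.
  rewrite (VE a ag) !mM.
  transitivity (g`_a * map_poly iota (e a).2 * map_poly iota (W a)); first by ring.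
  by rewrite (He a).2; ring.
have mV0 : map_poly iota V != 0 by rewrite map_poly_eq0.
have sg' : size g' = size g.
  have inj : injective (map_poly iota : {poly E} -> {poly F}) by apply: map_poly_inj.
  by rewrite -(size_map_inj_poly inj) ?rmorph0 // -(size_scale _ v0) -gE size_scale.
have := @no_factor_over_constants g'; rewrite sg' sg gr => /(_ isT)/negP; apply.
apply: dvdp_trans gf; apply/Pdiv.Idomain.dvdpP.
by exists (map_poly iota V, v%:P); rewrite //= mul_polyC gE.
Qed.

End FactorsOverConstants.

(** * Nonvanishing of the auxiliary function in F *)

Section NonVanishing.
Variables (k0 : fieldType) (E : finFieldType) (F : fieldType).
Variables (j : {rmorphism k0 -> F}) (iota : {rmorphism E -> F}).
Hypothesis constE : constants j = range iota.
Hypothesis Hfin : forall x, exists N, forall n (u : 'I_n -> F), xfree iota x u -> (n <= N)%N.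
Local Notation C := (constants j).
Let HC : subfield_set C := constants_subfield j.

Lemma const_closed x p : p != 0 -> peval iota x p = 0 -> exists c, x = iota c.
Proof.
move=> p0 px; have := algebraic_constants constE p0 px; rewrite constE => -[c _ <-].
by exists c.
Qed.

Lemma sum_dominated (w : place j) (x : nat -> F) n : x n != 0 ->
  (forall i, (i < n)%N -> vge w (vz w (x n) + 1) (x i)) -> \sum_(i < n.+1) x i != 0.
Proof.
move=> xn H; rewrite big_ord_recr /= addrC.
suff /(vzD_lt xn) [] // : vge w (vz w (x n) + 1) (\sum_(i < n) x i) by [].
by apply: vge_sum => i _; apply: H.
Qed.

Variable t : F.
Hypothesis Nt : ~ C t.

Definition pbounded N (P : {poly F}) : Prop := forall i, poleb j t N P`_i.

Lemma pbounded_le N M P : (N <= M)%N -> pbounded N P -> pbounded M P.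
Proof. by move=> NM H i; apply: poleb_le (H i). Qed.

Lemma pbounded_sum N I (s : seq I) (Q : pred I) (P : I -> {poly F}) :
  (forall i, Q i -> pbounded N (P i)) -> pbounded N (\sum_(i <- s | Q i) P i).
Proof.
move=> H k; rewrite coef_sum; apply: (subspace_ssum HC _ (poleb_subspace j t N)) => i Qi.
exact: H.
Qed.

Lemma pboundedM N M P Q : pbounded N P -> pbounded M Q -> pbounded (N + M) (P * Q).
Proof.
move=> HP HQ k; rewrite coefM; apply: (subspace_ssum HC _ (poleb_subspace j t _)) => i _.
exact: polebM.
Qed.

Lemma pboundedC N c : C c -> pbounded N c%:P.
Proof.
move=> Cc k; rewrite coefC; apply: (poleb_le (leq0n N)); apply: poleb_const.
by case: eqP => // _; exact: (subfield0 HC).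
Qed.

Lemma pbounded_prod N n (P : 'I_n -> {poly F}) : (forall i, pbounded N (P i)) ->
  pbounded (n * N) (\prod_i P i).
Proof.
elim: n P => [|n IH] P H; first by rewrite big_ord0; apply: pboundedC; exact: (subfield1 HC).
by rewrite big_ord_recl mulSn; apply: pboundedM => //; apply: IH.
Qed.

Lemma pbounded_det N n (M : 'M[{poly F}]_n) : (forall a b, pbounded N (M a b)) ->
  pbounded (n * N) (\det M).
Proof.
move=> H; rewrite /determinant; apply: pbounded_sum => s _; rewrite -[(n * N)%N]add0n.
apply: pboundedM; last exact: pbounded_prod.
rewrite -[-1]/(- 1%:P) -rmorphN -rmorphXn /=; apply: pboundedC.
by apply: (subfieldX HC); apply: (subfieldN HC); exact: (subfield1 HC).
Qed.

(* At a pole w of t the term of R of highest degree dominates: the nonzero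
   coefficients of R have valuations bounded in terms of N, while those of the
   powers of t^B are spaced by at least B. *)
Lemma small_poly_nonroot rt N (R : {poly F}) B : xdeg iota t rt -> pbounded N R -> R != 0 ->
  (N * rt < B)%N -> R.[t ^+ B] != 0.
Proof.
move=> Hrt HR R0 NB.
have [w wt] : exists w : place j, vz w t < 0.
  apply: contrapT => H; apply: Nt; apply: (no_poles constE Hfin) => w.
  rewrite vgeE ?(nonconst_neq0 Nt) // leNgt; apply/negP => lt; apply: H; by exists w.
have t0 := nonconst_neq0 Nt; rewrite horner_coef.
have lR : R`_(size R).-1 != 0 by rewrite -lead_coefE lead_coef_eq0.
rewrite -(prednK (_ : 0 < size R)%N) ?size_poly_gt0 //; set n := (size R).-1.
have HD : is_divisor (fun v : place j => N%:Z * poles t v).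
  by apply: divisorZ; exact: poles_divisor constE Hfin t.
have := RRspace_zeros constE Hfin w HD lR (HR n).
rewrite divdegZ ?(poles_degE constE Hfin Nt Hrt); last exact: poles_divisor constE Hfin t.
rewrite /poles wt; have [_ dw] := pdegP constE Hfin w => zer.
have HRi i : vge w (- (N%:Z * - vz w t)) R`_i.
  by have /polebE/(_ w) := HR i; rewrite /poles wt.
have := HRi n; rewrite vgeE // => low.
apply: (sum_dominated (w := w) (x := fun i => R`_i * (t ^+ B) ^+ i)).
  by rewrite mulf_neq0 // !expf_neq0.
move=> i lt_in /=; rewrite -!exprM.
apply: vgeS (vgeM (HRi i) (vge_vz w (t ^+ (B * i)))).
rewrite vzM ?expf_neq0 // !vzX -![vz w t *+ _]mulr_natr.
move: (vz w t) (vz w R`_n) (pdeg w) wt dw low zer lt_in => a b d a0 d0 low zer lt_in.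
have bd : b + N%:Z * - a <= N%:Z * rt%:Z by nia.
have e1 : (n%:R : int) = i%:R + (n - i)%N%:R by rewrite -natrD subnKC // ltnW.
have : 1 <= ((n - i)%N%:Z) by lia.
rewrite !natz !PoszM; move: e1; rewrite !natz => ->.
move: ((n - i)%N : int) => k k1.
suff : b + N%:Z * - a + 1 <= B%:Z * k * - a by lia.
have : N%:Z * rt%:Z + 1 <= B%:Z by lia.
have kM : 1 <= k * - a by nia.
have : B%:Z <= B%:Z * (k * - a) by rewrite ler_peMr.
by rewrite mulrA; lia.
Qed.

Variables (f : {poly {poly E}}) (y : F) (r : nat).
Hypotheses (fmonic : f \is monic) (sf : size f = r.+1).
Hypothesis fty : (map_poly (peval iota t) f).[y] = 0.
Hypothesis fmin : forall g : {poly {poly E}}, (size g <= r)%N ->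
  (map_poly (peval iota t) g).[y] = 0 -> g = 0.

Lemma horner2_fT x z : (map_poly (map_poly iota) f).[z%:P].[x] = (map_poly (peval iota x) f).[z].
Proof.
rewrite -/(horner_eval x _) -horner_map /= horner_evalE hornerC.
by rewrite -map_poly_comp.
Qed.

Lemma frob_root b : (map_poly (peval iota (t ^+ (#|E| ^ b))) f).[y ^+ (#|E| ^ b)] = 0.
Proof.
elim: b => [|b IH]; first by rewrite !expn0 !expr1.
rewrite !expnSr !exprM; move: IH; set x := t ^+ _; set z := y ^+ _ => IH.
rewrite -/(frob iota x) -/(frob iota z); transitivity (frob iota (map_poly (peval iota x) f).[z]).
  rewrite -horner_map /= -map_poly_comp; congr (_.[_]); apply: eq_map_poly => q /=.
  rewrite /peval -horner_map /= -map_poly_comp; congr (_.[_]); apply: eq_map_poly => c /=.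
  by rewrite frob_iota.
by rewrite IH rmorph0.
Qed.

(* The resultant of p and f over F[T] is nonzero, vanishes at t^B if p(t^B,
   y^B) = 0, and has coefficients with few poles. *)
Lemma nonvanishing (p : {poly {poly F}}) rt N b : xdeg iota t rt -> p != 0 -> (size p <= r)%N ->
  (forall i, pbounded N p`_i) -> (2 * r * N * rt < #|E| ^ b)%N ->
  p.[(y ^+ (#|E| ^ b))%:P].[t ^+ (#|E| ^ b)] != 0.
Proof.
move=> Hrt p0 pr Hp Bbig; set B := (#|E| ^ b)%N.
have r0 : (0 < r)%N by apply: leq_trans pr; rewrite size_poly_gt0.
have sfT : size (map_poly (map_poly iota) f) = r.+1 by apply: size_fT fmonic sf.
suff [R [R0 HR RE]] : exists R : {poly F}, [/\ R != 0, pbounded (2 * r * N) R &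
    p.[(y ^+ B)%:P].[t ^+ B] = 0 -> R.[t ^+ B] = 0].
  by apply/eqP => /RE/eqP; apply/negP; apply: small_poly_nonroot Hrt HR R0 Bbig.
(* [resultant_in_ideal] requires positive degree in Y; when p is constant in Y, its only coefficient
   serves as R. *)
have [p1|p1] := leqP (size p) 1.
  move: (size1_polyC p1) => pE; exists p`_0; split.
  - by apply: contraNneq p0 => E0; rewrite pE E0.
  - by apply: pbounded_le (Hp 0%N); nia.
  - by rewrite {1}pE hornerC.
pose fT := map_poly (map_poly iota) f.
have fT1 : (1 < size fT)%N by rewrite sfT.
have [[u v] _ /= RE] := resultant_in_ideal p1 fT1.
exists (resultant p fT); split.
- by rewrite resultant_eq0 -leqNgt; apply: (coprime_fT const_closed fmonic sf fty fmin).
- apply: (@pbounded_le (((size fT).-1 + (size p).-1) * N)).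
    rewrite sfT /=; apply: leq_mul => //; move: pr p1; move: (size p) => n; lia.
  apply: pbounded_det => a c; rewrite Sylvester_mxE /=.
  have bd0 : pbounded N 0 by rewrite -[0]polyC0; apply: pboundedC; exact: (subfield0 HC).
  case: split => i; rewrite mulrb; case: ifP => // _.
  rewrite coef_map => l; rewrite coef_map; apply: (poleb_le (leq0n N)); apply: poleb_const.
  exact: constants_iota.
- move=> pv; have := congr1 (fun h => h.[(y ^+ B)%:P].[t ^+ B]) RE.
  rewrite hornerC => ->; rewrite !hornerE_comm ?hornerD ?hornerM.
  by rewrite pv horner2_fT frob_root !mulr0 addr0.
Qed.

(** Grouping by powers of t^B and y^B presents the sum as p(t^B, y^B), the coefficients of p being
    small polynomials in t and y. They are of degree less than r in y, so [fmin] prevents p from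
    vanishing identically. *)
Lemma nonvanishing_sum rt eta l m b (c : nat -> nat -> nat -> nat -> E) :
  xdeg iota t rt -> poleb j t eta y -> (2 * r * (l + r * eta) * rt < #|E| ^ b)%N ->
  (exists e i h k, [/\ (e < l)%N, (i < r)%N, (h < m)%N, (k < r)%N & c e i h k != 0]) ->
  \sum_(k < r) \sum_(h < m) \sum_(i < r) \sum_(e < l)
    iota (c e i h k) * t ^+ (e + h * #|E| ^ b) * y ^+ (i + k * #|E| ^ b) != 0.
Proof.
move=> Hrt yeta Bbig [e0 [i0 [h0 [q0 [el il hl ql c0]]]]].
pose s h k := \poly_(i < r) \poly_(e < l) c e i h k.
pose sF h k := (map_poly (peval iota t) (s h k)).[y].
have sFE h k : sF h k = \sum_(i < r) \sum_(e < l) iota (c e i h k) * t ^+ e * y ^+ i.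
  rewrite /sF (horner_coef_wide (n := r)); last first.
    by apply: leq_trans (size_poly _ _) _; rewrite size_poly.
  apply: eq_bigr => i _; rewrite coef_map coef_poly ltn_ord /= /peval.
  rewrite (horner_coef_wide (n := l)) ?size_map_poly ?size_poly // mulr_suml.
  by apply: eq_bigr => e _; rewrite coef_map coef_poly ltn_ord.
pose p := \poly_(k < r) \poly_(h < m) sF h k.
have := @nonvanishing p rt (l + r * eta) b Hrt.
set B := (#|E| ^ b)%N => H.
have -> : \sum_(k < r) \sum_(h < m) \sum_(i < r) \sum_(e < l)
    iota (c e i h k) * t ^+ (e + h * B) * y ^+ (i + k * B) = p.[(y ^+ B)%:P].[t ^+ B].
  rewrite horner_poly horner_sum; apply: eq_bigr => k _.
  rewrite hornerM horner_poly horner_exp hornerC mulr_suml; apply: eq_bigr => h _.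
  rewrite sFE !mulr_suml; apply: eq_bigr => i _; rewrite !mulr_suml; apply: eq_bigr => e _.
  by rewrite !exprD -!exprM [(h * B)%N]mulnC [(k * B)%N]mulnC; ring.
apply: H => //.
- apply: contraNneq c0 => p00; move/polyP/(_ q0): p00; rewrite coef_poly ql coef0.
  move/polyP/(_ h0); rewrite coef_poly hl coef0 => sF0.
  have /polyP/(_ i0) : s h0 q0 = 0 by apply: fmin; rewrite // size_poly.
  by rewrite coef_poly il coef0 => /polyP/(_ e0); rewrite coef_poly el coef0 => ->.
- exact: size_poly.
- move=> k; rewrite coef_poly; case: ifP => _ h; last first.
    by rewrite coef0; case: (poleb_subspace j t (l + r * eta)).
  rewrite coef_poly; case: ifP => _; last by case: (poleb_subspace j t (l + r * eta)).
  rewrite sFE; have HS := poleb_subspace j t (l + r * eta).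
  apply: (subspace_ssum HC _ HS) => i _; apply: (subspace_ssum HC _ HS) => e _.
  rewrite -mulrA; apply: (subspaceZ HS); first exact: constants_iota.
  have := polebM (polebX e (@poleb_gen _ _ j t)) (polebX i yeta); apply: poleb_le.
  have := ltn_ord e; have := ltn_ord i; nia.
Qed.

End NonVanishing.

Section Squarefree.
Variable L : fieldType.
Implicit Types p g : {poly L}.

Lemma separable_dvdp_exp p g n : separable_poly p -> p %| g ^+ n -> p %| g.
Proof.
move=> sp pg; have p0 := separable_poly_neq0 sp.
pose d := gcdp p g; have /divpK pE : d %| p by exact: dvdp_gcdl.
pose p1 := p %/ d.
have cop1 : coprimep p1 d by move: sp; rewrite -pE separable_mul => /and3P[].
have cop : coprimep p1 g.
  have p1p : p1 %| p by rewrite -pE dvdp_mulr.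
  move: cop1; rewrite !coprimep_def !size_poly_eq1 => cop1.
  apply: dvdp_eqp1 cop1; rewrite dvdp_gcd dvdp_gcdl dvdp_gcd dvdp_gcdr andbT.
  exact: dvdp_trans (dvdp_gcdl _ _) p1p.
have : p1 %| 1.
  have p1p : p1 %| p by rewrite -pE dvdp_mulr.
  by rewrite -(Gauss_dvdpr _ (coprimep_expr n cop)) mulr1 (dvdp_trans p1p).
rewrite dvdp1 => /eqP/eqP; rewrite size_poly_eq1 => p11.
by rewrite -pE (eqp_dvdl _ (eqp_mulr _ p11)) mul1r dvdp_gcdr.
Qed.

End Squarefree.

Lemma exp_sum_pchar (R : comNzRingType) n I (s : seq I) (P : pred I) (x : I -> R) :
  ([pchar R]).-nat n -> (\sum_(i <- s | P i) x i) ^+ n = \sum_(i <- s | P i) x i ^+ n.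
Proof.
move=> Hn; apply: (big_morph (fun z => z ^+ n)) => [a b|]; first exact: exprDn_pchar.
by rewrite expr0n; case: n Hn.
Qed.

Section DividedDifference.
Variable R : comNzRingType.

Lemma drop_poly_shift (g : {poly R}) k : drop_poly k g = (g`_k)%:P + 'X * drop_poly k.+1 g.
Proof.
apply/polyP => -[|i]; rewrite coef_drop_poly coefD coefC coefXM ?addr0 //=.
by rewrite add0r coef_drop_poly addnS addSn.
Qed.

(** The sum is the divided difference of g at z and X, expanded in powers of z with the coefficients
    of Horner's scheme; the product telescopes. *)
Lemma divided_difference (g z : {poly R}) n : (size g <= n.+1)%N ->
  (\sum_(k < n) drop_poly k.+1 g * z ^+ k) * (z - 'X) = (g \Po z) - g.
Proof.
move=> sg; have H m : (\sum_(k < m) drop_poly k.+1 g * z ^+ k) * (z - 'X) =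
    drop_poly m g * z ^+ m + \sum_(k < m) g`_k *: z ^+ k - g.
  elim: m => [|m IH]; first by rewrite !big_ord0 mul0r drop_poly0l mulr1 addr0 subrr.
  rewrite !big_ord_recr /= mulrDl IH -mul_polyC (drop_poly_shift g m) exprS; ring.
rewrite H comp_polyE -(big_mkord xpredT (fun k => g`_k *: z ^+ k)).
have -> : drop_poly n g = (g`_n)%:P.
  by rewrite drop_poly_shift drop_poly_eq0 // mulr0 addr0.
rewrite mul_polyC; congr (_ - _).
have -> : g`_n *: z ^+ n + \sum_(0 <= k < n) g`_k *: z ^+ k = \sum_(k < n.+1) g`_k *: z ^+ k.
  by rewrite big_ord_recr /= addrC big_mkord.
rewrite -!(big_mkord xpredT (fun k => g`_k *: z ^+ k)) (big_cat_nat _ (n := size g)) //=.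
rewrite [X in _ + X = _]big_nat [X in _ + X = _]big1 ?addr0 // => k /andP[gk _].
by rewrite nth_default // scale0r.
Qed.

End DividedDifference.

Lemma size_mul_leq_add (E : fieldType) (a b : {poly E}) m n : (size a <= m.+1)%N -> (size b <= n.+1)%N ->
  (size (a * b)%R <= (m + n).+1)%N.
Proof. by move=> sa sb; apply: leq_trans (size_polyMleq _ _) _; lia. Qed.

Section Reduction.
Variables (E : fieldType) (f : {poly {poly E}}) (r H : nat).
Hypotheses (fmonic : f \is monic) (sf : size f = r.+1).
Hypothesis fH : forall i, (size (f`_i)%R <= H.+1)%N.
Local Notation rem p := (Pdiv.Ring.rmodp p f).

(** Since f is monic, each cancellation of a top term in Y raises the degrees of the coefficients by
    at most H. *)
Lemma rem_bound n S (p : {poly {poly E}}) : (size p <= r + n)%N ->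
  (forall i, (size (p`_i)%R <= S.+1)%N) -> forall i, (size ((rem p)`_i)%R <= (S + n * H).+1)%N.
Proof.
elim: n S p => [|n IH] S p sp pS i.
  by rewrite addn0 in sp; rewrite Pdiv.Ring.rmodp_small ?sf // mul0n addn0.
pose q := p`_(r + n)%N *: 'X^n.
have -> : rem p = rem (p - q * f).
  by rewrite Pdiv.RingMonic.rmodpB // Pdiv.RingMonic.rmodp_mull // subr0.
have sub_coef k : (p - q * f)`_k = p`_k - p`_(r + n)%N * (if (k < n)%N then 0 else f`_(k - n)).
  by rewrite coefB /q -scalerAl coefZ coefXnM.
have := IH (S + H)%N (p - q * f); rewrite mulSn addnA; apply.
  apply/leq_sizeP => k; rewrite leq_eqVlt => /orP[/eqP <-|lt]; rewrite sub_coef.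
    rewrite ltnNge leq_addl /= addnK.
    have -> : f`_r = 1 by have := monicP fmonic; rewrite lead_coefE sf.
    by rewrite mulr1 subrr.
  rewrite ifF; last by lia.
  rewrite (nth_default _ (_ : size p <= k)%N); last by lia.
  by rewrite (nth_default _ (_ : size f <= k - n)%N) ?sf ?mulr0 ?subrr //; lia.
move=> k; rewrite sub_coef; apply: leq_trans (size_polyD _ _) _.
rewrite geq_max size_polyN (leq_trans (pS k)) /=; last by rewrite ltnS leq_addr.
apply: size_mul_leq_add => //; case: ifP => _ //; by rewrite size_poly0.
Qed.

End Reduction.

(** * The auxiliary polynomial and its zeros *)

Section Stepanov.
Variables (E L : finFieldType) (phi : {rmorphism E -> L}).
Variables (f : {poly {poly E}}) (r' H a b l m : nat).
Local Notation r := r'.+1.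
Local Notation A := (#|E| ^ a)%N.
Local Notation B := (#|E| ^ b)%N.
Hypotheses (fmonic : f \is monic) (sf : size f = r.+1).
Hypothesis fH : forall i, (size (f`_i)%R <= H.+1)%N.
Hypothesis cardL : #|L| = (#|E| ^ (a + b))%N.
Local Notation rem p := (Pdiv.Ring.rmodp p f).
Implicit Type c : nat -> nat -> nat -> nat -> E.

(** Since x^(A B) = x for x in L, the A-th power of the specialized [stepanov_poly c] turns T^(e + h
    B) into T^(e A + h) and Y^(i + k B) into Y^(i A + k |L|), while the [c e i h k] are unchanged.
    [stepanov_part c k] is the factor that accompanies Y^(k |L|). *)
Definition stepanov_part c (k : nat) : {poly {poly E}} :=
  \sum_(h < m.+1) \sum_(i < r) \sum_(e < l.+1)
     ((c e i h k)%:P * 'X^(e * A + h)) *: 'X^(i * A).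

Definition stepanov_poly c : {poly {poly E}} :=
  \sum_(k < r) \sum_(h < m.+1) \sum_(i < r) \sum_(e < l.+1)
     ((c e i h k)%:P * 'X^(e + h * B)) *: 'X^(i + k * B).

Definition coef_bounded S (p : {poly {poly E}}) := forall i, (size (p`_i)%R <= S.+1)%N.

Lemma coef_bounded_sum S I (s : seq I) (P : pred I) (p : I -> {poly {poly E}}) :
  (forall i, P i -> coef_bounded S (p i)) -> coef_bounded S (\sum_(i <- s | P i) p i).
Proof.
move=> Hp k; rewrite coef_sum; elim/big_rec: _ => [|i x Pi Hx]; first by rewrite size_poly0.
by apply: leq_trans (size_polyD _ _) _; rewrite geq_max Hx Hp.
Qed.

Lemma coef_bounded_term S (c : E) n k : (n <= S)%N -> coef_bounded S ((c%:P * 'X^n) *: 'X^k).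
Proof.
move=> nS i; rewrite coefZ coefXn; case: eqP => _; last by rewrite mulr0 size_poly0.
rewrite mulr1; apply: leq_trans (size_polyMleq _ _) _; rewrite size_polyXn.
by have := size_polyC_leq1 c; lia.
Qed.

Lemma size_term (q : {poly E}) n k : (k <= n)%N -> (size (q *: 'X^k : {poly {poly E}}) <= n.+1)%N.
Proof. by move=> kn; apply: leq_trans (size_scale_leq _ _) _; rewrite size_polyXn ltnS. Qed.

Lemma size_sum_leq (R : nzRingType) n I (s : seq I) (P : pred I) (p : I -> {poly R}) :
  (forall i, P i -> (size (p i) <= n)%N) -> (size (\sum_(i <- s | P i) p i)%R <= n)%N.
Proof.
move=> Hp; elim/big_rec: _ => [|i x Pi Hx]; first by rewrite size_poly0.
by apply: leq_trans (size_polyD _ _) _; rewrite geq_max Hx Hp.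
Qed.

Lemma stepanov_part_bounded c k : coef_bounded (l * A + m) (stepanov_part c k).
Proof.
apply: coef_bounded_sum => h _; apply: coef_bounded_sum => i _; apply: coef_bounded_sum => e _.
apply: coef_bounded_term; have := ltn_ord h; have := ltn_ord e; nia.
Qed.

Lemma size_stepanov_part c k : (size (stepanov_part c k) <= (r' * A).+1)%N.
Proof.
apply: size_sum_leq => h _; apply: size_sum_leq => i _; apply: size_sum_leq => e _.
apply: size_term; have := ltn_ord i; nia.
Qed.

Lemma stepanov_poly_bounded c : coef_bounded (l + m * B) (stepanov_poly c).
Proof.
apply: coef_bounded_sum => k _; apply: coef_bounded_sum => h _.
apply: coef_bounded_sum => i _; apply: coef_bounded_sum => e _.
apply: coef_bounded_term; have := ltn_ord h; have := ltn_ord e; nia.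
Qed.

Lemma size_stepanov_poly c : (size (stepanov_poly c) <= (r' + r' * B).+1)%N.
Proof.
apply: size_sum_leq => k _; apply: size_sum_leq => h _.
apply: size_sum_leq => i _; apply: size_sum_leq => e _.
apply: size_term; have := ltn_ord i; have := ltn_ord k; nia.
Qed.

(* Vanishing of the constraints for k < r' means that the sum of stepanov_part
   c k * Y^k is congruent modulo f to stepanov_part c r' times the divided
   difference (f(Y) - f(X)) / (Y - X). *)
Definition stepanov_constraint c k : {poly {poly E}} :=
  rem (stepanov_part c k - stepanov_part c r' * drop_poly k.+1 f).

Lemma coef_boundedM S T (p q : {poly {poly E}}) :
  coef_bounded S p -> coef_bounded T q -> coef_bounded (S + T) (p * q).
Proof.
move=> Hp Hq i; rewrite coefM; apply: size_sum_leq => k _.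
exact: (size_mul_leq_add (Hp k) (Hq (i - k)%N)).
Qed.

Lemma stepanov_constraint_bounded c k :
  coef_bounded (l * A + m + H + r' * A * H) (stepanov_constraint c k).
Proof.
apply: (rem_bound (r := r)) => //.
  apply: leq_trans (size_polyD _ _) _; rewrite size_polyN geq_max.
  have := size_stepanov_part c k => h1; rewrite (leq_trans h1) /=; last by lia.
  apply: leq_trans (size_polyMleq _ _) _; rewrite size_drop_poly sf.
  by have := size_stepanov_part c r'; move: (size (stepanov_part c r')) (r' * A)%N => s1 n; lia.
move=> i; rewrite coefB; apply: leq_trans (size_polyD _ _) _; rewrite size_polyN geq_max.
have h1 := stepanov_part_bounded c k i; rewrite (leq_trans h1) /=; last by lia.
apply: coef_boundedM; first exact: stepanov_part_bounded.
by move=> n; rewrite coef_drop_poly.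
Qed.

Lemma stepanov_partB c1 c2 k :
  stepanov_part (fun e i h k => c1 e i h k - c2 e i h k) k = stepanov_part c1 k - stepanov_part c2 k.
Proof.
rewrite /stepanov_part -sumrB; apply: eq_bigr => h _; rewrite -sumrB; apply: eq_bigr => i _.
rewrite -sumrB; apply: eq_bigr => e _.
by rewrite rmorphB /= mulrBl scalerBl.
Qed.

(** The constraints are additive in c, with (l + 1) r (m + 1) r unknowns and fewer coordinates. By
    the pigeonhole principle over the finite field two families share their constraints, and their
    difference is the solution. *)
Lemma stepanov_coefficients :
  (r' * (l * A + m + H + r' * A * H).+1 < l.+1 * r * m.+1)%N ->
  exists c, (exists e i h k, [/\ (e < l.+1)%N, (i < r)%N, (h < m.+1)%N, (k < r)%N & c e i h k != 0]) /\
    forall k, (k < r')%N -> stepanov_constraint c k = 0.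
Proof.
set S := (l * A + m + H + r' * A * H)%N => count.
pose src := {ffun 'I_l.+1 * 'I_r * 'I_m.+1 * 'I_r -> E}.
pose tgt := {ffun 'I_r' * 'I_r * 'I_S.+1 -> E}.
pose cn (c : src) e i h k : E := c (inord e, inord i, inord h, inord k).
pose F (c : src) : tgt := [ffun x : 'I_r' * 'I_r * 'I_S.+1 => ((stepanov_constraint (cn c) x.1.1)`_x.1.2)`_x.2].
have : ~~ injectiveb F.
  apply/negP => /injectiveP/leq_card; rewrite !card_ffun !card_prod !card_ord.
  rewrite leq_exp2l ?finNzRing_gt1 //; nia.
move=> /injectivePn [c1 [c2 c12 Fc]].
exists (fun e i h k => cn c1 e i h k - cn c2 e i h k); split.
  have /existsP [[[[e i] h] k] ne] : [exists x, c1 x != c2 x].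
    rewrite -negb_forall; apply/negP => /forallP H12; move/eqP: c12; apply; apply/ffunP => x.
    exact/eqP/H12.
  exists e, i, h, k; split; rewrite ?ltn_ord //.
  by rewrite /cn !inord_val subr_eq0.
move=> k kr.
have -> : stepanov_constraint (fun e i h k0 => cn c1 e i h k0 - cn c2 e i h k0) k =
    stepanov_constraint (cn c1) k - stepanov_constraint (cn c2) k.
  rewrite /stepanov_constraint -Pdiv.RingMonic.rmodpB // !stepanov_partB; congr (Pdiv.Ring.rmodp _ f).
  by ring.
apply/polyP => i; rewrite coefB coef0; have [ir|ri] := ltnP i r; last first.
  have sr c : (size (stepanov_constraint c k) <= r)%N.
    by rewrite -ltnS -sf Pdiv.Ring.ltn_rmodp monic_neq0.
  by rewrite !nth_default ?subrr // (leq_trans (sr _)).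
apply/polyP => n; rewrite coefB coef0; have [nS|Sn] := ltnP n S.+1; last first.
  have sc c : ((stepanov_constraint c k)`_i)`_n = 0.
    by apply: nth_default; apply: leq_trans Sn; exact: stepanov_constraint_bounded.
  by rewrite !sc subrr.
have /ffunP/(_ ((Ordinal kr, Ordinal ir), Ordinal nS)) := Fc.
by rewrite !ffunE /= => ->; rewrite subrr.
Qed.

Variable alpha : L.
Local Notation spec := (map_poly (peval phi alpha)).
Local Notation fa := (spec f).
Hypotheses (fa_sep : separable_poly fa) (fa_noroot : forall x, ~~ root fa x).

Lemma card_polyL n : ([pchar {poly L}]).-nat (#|E| ^ n)%N.
Proof.
rewrite (eq_pnat _ (pchar_poly L)).
elim: n => [|n IH]; first by rewrite expn0.
by rewrite expnS pnatM IH andbT; exact: (card_pchar_nat phi).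
Qed.

Lemma phi_frob n x : phi x ^+ (#|E| ^ n) = phi x.
Proof. by elim: n => [|n IH]; rewrite ?expn0 // expnSr exprM IH -rmorphXn expf_card. Qed.

Lemma fa_frob : fa \Po 'X^#|L| = fa ^+ #|L|.
Proof.
rewrite comp_polyE -[in RHS](coefK fa) poly_def cardL exp_sum_pchar ?card_polyL //.
apply: eq_bigr => i _; rewrite -cardL exprZn expf_card -!exprM.
by rewrite mulnC.
Qed.

Lemma spec_term (q : E) n k : spec ((q%:P * 'X^n) *: 'X^k) = (phi q * alpha ^+ n) *: 'X^k.
Proof. by rewrite map_polyZ map_polyXn /= pevalM pevalC pevalXn. Qed.

Lemma coprime_fa_genPoly : coprimep fa ('X^#|L| - 'X).
Proof.
rewrite finField_genPoly; elim/big_ind: _ => [|p q cp cq|x _].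
- exact: coprimep1.
- by rewrite coprimepMr cp.
- by rewrite coprimep_XsubC.
Qed.

Lemma spec_drop k : spec (drop_poly k f) = drop_poly k fa.
Proof. by apply/polyP => i; rewrite !(coef_map, coef_drop_poly). Qed.

(* Since f(alpha, .) has no root in L, X^#|L| - X is invertible modulo it, so
   by the constraints sum_k stepanov_part c k * X^(k #|L|) vanishes modulo
   f(alpha, .). That sum is the A-th power of the specialized Stepanov
   polynomial, and f(alpha, .) is squarefree. *)
Lemma stepanov_vanishing c : (forall k, (k < r')%N -> stepanov_constraint c k = 0) ->
  forall i, peval phi alpha (rem (stepanov_poly c))`_i = 0.
Proof.
move=> Hc; have sfa : size fa = r.+1.
  by rewrite size_map_poly_id0 // (monicP fmonic) peval1 oner_neq0.
have Q0 : 'X^#|L| - 'X != 0 :> {poly L}.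
  by apply: contraTneq coprime_fa_genPoly => ->; rewrite coprimep0 -size_poly_eq1 sfa.
have dv k : (k < r)%N -> fa %| spec (stepanov_part c k) - spec (stepanov_part c r') * drop_poly k.+1 fa.
  move=> kr; have [kr'|rk] := ltnP k r'; last first.
    have -> : k = r' by lia.
    have -> : drop_poly r'.+1 fa = 1.
      rewrite -spec_drop; have -> : drop_poly r'.+1 f = 1; last by rewrite rmorph1.
      apply/polyP => i; rewrite coef_drop_poly coef1; case: i => [|i] /=.
        by have := monicP fmonic; rewrite lead_coefE sf.
      by rewrite nth_default // sf; lia.
    by rewrite mulr1 subrr dvdp0.
  have := Pdiv.RingMonic.rdivp_eq fmonic (stepanov_part c k - stepanov_part c r' * drop_poly k.+1 f).
  rewrite -/(stepanov_constraint c k) (Hc k kr') addr0 => /(congr1 spec).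
  by rewrite rmorphB !rmorphM /= spec_drop => ->; rewrite dvdp_mull.
pose W := \sum_(k < r) spec (stepanov_part c k) * ('X^#|L|) ^+ k.
have dvW : fa %| W.
  have -> : W = \sum_(k < r) (spec (stepanov_part c k) -
      spec (stepanov_part c r') * drop_poly k.+1 fa) * 'X^#|L| ^+ k +
      spec (stepanov_part c r') * \sum_(k < r) drop_poly k.+1 fa * 'X^#|L| ^+ k.
    by rewrite mulr_sumr -big_split; apply: eq_bigr => k _ /=; ring.
  apply: dvdp_add.
    by elim/big_rec: _ => [|k p _ IH]; [exact: dvdp0|rewrite dvdp_add // dvdp_mulr // dv].
  apply: dvdp_mull; rewrite -(Gauss_dvdpl _ coprime_fa_genPoly) divided_difference ?sfa //.
  by rewrite fa_frob dvdp_sub ?dvdpp // -(prednK (_ : 0 < #|L|)%N) ?exprS ?dvdp_mulr // ltnW ?finNzRing_gt1.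
have WE : W = spec (stepanov_poly c) ^+ A.
  have aQ : alpha ^+ (#|E| ^ (a + b)) = alpha by rewrite -cardL expf_card.
  rewrite /W /stepanov_poly rmorph_sum exp_sum_pchar ?card_polyL //.
  apply: eq_bigr => k _; rewrite !rmorph_sum exp_sum_pchar ?card_polyL // mulr_suml.
  apply: eq_bigr => h _; rewrite !rmorph_sum exp_sum_pchar ?card_polyL // mulr_suml.
  apply: eq_bigr => i _; rewrite !rmorph_sum exp_sum_pchar ?card_polyL // mulr_suml.
  apply: eq_bigr => e _; rewrite /= !spec_term exprZn exprMn phi_frob -scalerAl -!exprM.
  rewrite -exprD cardL; congr ((_ * _) *: 'X^_).
    rewrite mulnDl !exprD; congr (_ * _).
    by rewrite -mulnA -expnD addnC mulnC exprM aQ.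
  by rewrite mulnDl -mulnA -expnD [(b + a)%N]addnC [((_ ^ _) * k)%N]mulnC.
have dvG : fa %| spec (stepanov_poly c) by apply: (separable_dvdp_exp fa_sep (n := A)); rewrite -WE.
have dvR : fa %| spec (rem (stepanov_poly c)).
  have -> : rem (stepanov_poly c) = stepanov_poly c - Pdiv.Ring.rdivp (stepanov_poly c) f * f.
    by rewrite [X in X - _](Pdiv.RingMonic.rdivp_eq fmonic) addrC addKr.
  by rewrite rmorphB rmorphM /= dvdp_sub // dvdp_mull.
have R0 : spec (rem (stepanov_poly c)) = 0.
  apply/eqP; apply: contraT => R0; have := dvdp_leq R0 dvR; rewrite sfa leqNgt ltnS.
  apply: contraNT => _; apply: leq_trans (size_poly _ _) _.
  by rewrite -ltnS -sf Pdiv.Ring.ltn_rmodp monic_neq0.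
by move=> i; move/polyP/(_ i): R0; rewrite coef_map coef0.
Qed.

End Stepanov.

Local Close Scope classical_set_scope.

(** * Generic elements of finite fields *)

Lemma finfield_card_eq0 (E : finFieldType) : #|E|%:R = 0 :> E.
Proof. by apply/eqP; rewrite -FinRing.zmodXgE -cardsT -order_dvdn order_dvdG ?inE. Qed.

Lemma card_fixed_power (L : finFieldType) n : (1 < n)%N ->
  (#|[set a : L | a ^+ n == a]| <= n)%N.
Proof.
move=> n1; pose p : {poly L} := 'X^n - 'X.
have sp : size p = n.+1 by rewrite size_polyDl ?size_polyXn // size_polyN size_polyX.
have p0 : p != 0 by rewrite -size_poly_eq0 sp.
rewrite cardE -ltnS -sp; apply: max_poly_roots; rewrite ?enum_uniq //.
apply/allP => x; rewrite mem_enum inE => /eqP xn.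
by rewrite rootE /p !hornerE xn subrr.
Qed.

(** In the splitting field of X^Q - X, the n-th power of the Galois generator fixes the roots and
    hence everything, so there are at most Q elements; separability provides Q roots. *)
Lemma finite_extension_exists (E : finFieldType) n : (0 < n)%N ->
  exists (L : finFieldType) (phi : {rmorphism E -> L}), #|L| = (#|E| ^ n)%N.
Proof.
move=> n0; set Q := (#|E| ^ n)%N.
have Q1 : (1 < Q)%N by rewrite -[X in (X < _)%N](exp1n n) ltn_exp2r ?finNzRing_gt1.
pose p : {poly E} := 'X^Q - 'X.
have sp : size p = Q.+1 by rewrite size_polyDl ?size_polyXn // size_polyN size_polyX.
have p0 : p != 0 by rewrite -size_poly_eq0 sp.
have [L [rs prs gen]] := FinSplittingFieldFor p0.
pose L' := finvect_type L.
exists L', (in_alg L).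
have [alpha _ Hal] := finField_galois_generator (subvf (1%AS : {subfield L})).
have alphaE x : alpha x = x ^+ #|E| by rewrite Hal ?memvf // /order dimv1 expn1.
have alphan k x : (alpha ^+ k)%g x = x ^+ (#|E| ^ k).
  elim: k x => [|k IH] x; first by rewrite gal_id.
  by rewrite expgSr galM ?memvf // IH alphaE -exprM -expnSr.
have pE : map_poly (in_alg L) p = 'X^Q - 'X by rewrite rmorphB /= map_polyXn map_polyX.
have rootp x : root (map_poly (in_alg L) p) x = (x ^+ Q == x).
  by rewrite pE rootE !hornerE subr_eq0.
have fixL (x : L) : x ^+ Q = x.
  have : x \in (fixedField [set (alpha ^+ n)%g] : {vspace L}).
    suff /subvP H : (<<1 & rs>> <= fixedField [set (alpha ^+ n)%g])%VS by apply: H; rewrite gen memvf.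
    apply/Fadjoin_seqP; split; first exact: sub1v.
    move=> z zrs; apply/fixedFieldP; rewrite ?memvf // => _ /set1P ->.
    rewrite alphan; apply/eqP; rewrite -rootp (eqp_root prs) root_prod_XsubC //.
  by move=> /fixedFieldP -/(_ (memvf x)) /(_ _ (set11 _)); rewrite alphan.
apply/eqP; rewrite eqn_leq; apply/andP; split.
  have E1 : [set a : L' | a ^+ Q == a] = [set: L'].
    by apply/finset.setP => x; rewrite !inE; apply/eqP; exact: fixL.
  by have := card_fixed_power L' Q1; rewrite E1 cardsT.
have urs : uniq rs.
  rewrite -separable_prod_XsubC -(eqp_separable prs) separable_map /p unlock.
  rewrite derivB derivXn derivX -mulr_natr /Q.
  have -> : ((#|E| ^ n)%N%:R : {poly E}) = 0.
    by rewrite -polyC_natr natrX finfield_card_eq0 expr0n -[n]prednK.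
  by rewrite mulr0 sub0r -[X in coprimep _ X]scaleN1r coprimepZr ?oppr_eq0 ?oner_neq0 // coprimep1.
have srs : size rs = Q.
  apply: succn_inj; rewrite -sp -(size_map_poly (in_alg L)) (eqp_size prs).
  by rewrite size_prod_XsubC.
have urs' : @uniq L' rs by exact: urs.
by rewrite -srs -(card_uniqP urs'); apply: (@max_card L').
Qed.

Section GenericElements.
Variables (k0 L : finFieldType) (psi : {rmorphism k0 -> L}) (N : nat).
Local Notation q := #|k0|.
Hypothesis cardL : #|L| = (q ^ N)%N.
Hypothesis N0 : (0 < N)%N.

(* An element of a proper subfield of L is fixed by the power map of exponent
   q^i for a proper divisor i of N, and such an i is at most N / 2. *)
Definition degenerate (a : L) : bool := [exists i : 'I_(N./2), a ^+ (q ^ i.+1) == a].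

Lemma card_degenerate : (#|[set a | degenerate a]| <= 2 * q ^ (N./2))%N.
Proof.
have q1 : (1 < q)%N by exact: finNzRing_gt1.
have sub : ([set a | degenerate a]%SET \subset (\bigcup_(i < N./2) [set a : L | a ^+ (q ^ i.+1) == a])%SET).
  apply/fintype.subsetP => a; rewrite inE => /existsP [i ai]; apply/bigcupP; exists i => //.
  by rewrite inE.
apply: leq_trans (subset_leq_card sub) _.
elim: (N./2) => [|n IH]; first by rewrite big_ord0 cards0.
rewrite big_ord_recr /=; apply: leq_trans (leq_card_setU _ _) _.
have h : (#|[set a : L | a ^+ (q ^ n.+1) == a]| <= q ^ n.+1)%N.
  by apply: card_fixed_power; rewrite -[X in (X < _)%N](exp1n n.+1) ltn_exp2r.
apply: leq_trans (leq_add IH h) _; rewrite expnS; move: q1 (q ^ n)%N; nia.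
Qed.

Lemma psi_frob n c : psi c ^+ (q ^ n) = psi c.
Proof. by elim: n => [|n IH]; rewrite ?expn0 // expnSr exprM IH -rmorphXn expf_card. Qed.

(** The exponents i for which q^i fixes a are closed under gcd, and gcd(i, N) is a proper divisor of
    N, hence at most N / 2. *)
Lemma generic_period (a : L) i : ~~ degenerate a -> (0 < i < N)%N -> a ^+ (q ^ i) != a.
Proof.
move=> na /andP[i0 iN]; apply: contra na => /eqP ai.
have aN : a ^+ (q ^ N) = a by rewrite -cardL expf_card.
have mulP n k : a ^+ (q ^ n) = a -> a ^+ (q ^ (k * n)) = a.
  by move=> an; elim: k => [|k IH]; rewrite ?mul0n ?expn0 // mulSn expnD exprM an.
pose g := gcdn i N.
have ag : a ^+ (q ^ g) = a.
  case: (egcdnP N i0) => km kn E1 _; have := mulP _ km ai.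
  by rewrite E1 expnD exprM mulP // gcdnC.
have g0 : (0 < g)%N by rewrite gcdn_gt0 i0.
have gN : (g <= N./2)%N.
  have /dvdnP [k Nk] : (g %| N)%N by exact: dvdn_gcdr.
  have : (g <= i)%N by apply: dvdn_leq => //; exact: dvdn_gcdl.
  by case: k Nk => [|[|k]] Nk; rewrite -divn2; nia.
apply/existsP; have gl : (g.-1 < N./2)%N by rewrite prednK.
by exists (Ordinal gl); rewrite /= prednK // ag.
Qed.

(** The N conjugates a^(q^n), n < N, are distinct by [generic_period], and all are roots of P. *)
Lemma generic_root_size (a : L) (P : {poly k0}) : ~~ degenerate a -> P != 0 ->
  (map_poly psi P).[a] = 0 -> (N < size P)%N.
Proof.
move=> na P0 Pa; have aN : a ^+ (q ^ N) = a by rewrite -cardL expf_card.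
have conj n : (map_poly psi P).[a ^+ (q ^ n)] = 0.
  have -> : (map_poly psi P).[a ^+ (q ^ n)] = (map_poly psi P).[a] ^+ (q ^ n).
    have chn : ([pchar L]).-nat (q ^ n)%N.
      elim: n => [|n IH]; first by rewrite expn0.
      by rewrite expnS pnatM IH andbT; exact: (card_pchar_nat psi).
    rewrite !horner_coef exp_sum_pchar //; apply: eq_bigr => i _.
    by rewrite coef_map exprMn psi_frob -!exprM mulnC.
  by rewrite Pa expr0n gtn_eqF // expn_gt0 (ltnW (finNzRing_gt1 k0)).
pose s := mkseq (fun n => a ^+ (q ^ n)) N.
have us : uniq s.
  apply/mkseq_uniqP => i l; rewrite !inE => iN lN.
  wlog il : i l iN lN / (i <= l)%N.
    by move=> H; have [il|/ltnW li] := leqP i l => E1; [apply: H|apply/esym/H].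
  move=> E1; apply/eqP; rewrite eqn_leq il leqNgt; apply/negP => lt.
  have /eqP : a ^+ (q ^ (l - i)) = a.
    rewrite -[RHS]aN -[in RHS](subnKC (ltnW iN)) expnD exprM E1 -exprM -expnD.
    have -> : (l + (N - i) = N + (l - i))%N by lia.
    by rewrite expnD exprM aN.
  by apply/negP; apply: generic_period; lia.
rewrite -(size_map_poly psi) -(size_mkseq (fun n => a ^+ (q ^ n)) N).
apply: max_poly_roots us; first by rewrite map_poly_eq0.
by apply/allP => _ /mapP [n _ ->]; rewrite rootE conj.
Qed.

End GenericElements.

Local Open Scope classical_set_scope.

(** * A generator with few poles *)

Section SubfieldPolynomials.
Variables (F : fieldType) (S : set F) (HS : subfield_set S).
Implicit Types (A B P q : {poly F}) (w x y z : F).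

Definition polyin (T : set F) (P : {poly F}) : Prop := forall i, T P`_i.

Lemma polyin_lift P : polyin S P -> exists P' : {poly sftype HS}, P = map_poly (sfval HS) P'.
Proof.
move=> HP; have /choice [e He] : forall i, exists c : sftype HS, sfval HS c = P`_i.
  by move=> i; have := HP i; rewrite -[in X in X -> _](sfval_range HS) => -[c _ <-]; exists c.
exists (\poly_(i < size P) e i); apply/polyP => i; rewrite coef_map coef_poly.
by case: ltnP => [_|le]; [exact/esym/He|rewrite nth_default //; exact/esym/rmorph0].
Qed.

Lemma sfval_in (c : sftype HS) : S (sfval HS c).
Proof. exact/asboolP/(valP c). Qed.

Lemma gcd_in A B : polyin S A -> polyin S B -> polyin S (gcdp A B).
Proof.
move=> /polyin_lift [A' ->] /polyin_lift [B' ->] i.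
by rewrite -gcdp_map coef_map; exact: sfval_in.
Qed.

Lemma div_in A B : polyin S A -> polyin S B -> polyin S (A %/ B).
Proof.
move=> /polyin_lift [A' ->] /polyin_lift [B' ->] i.
by rewrite -map_divp coef_map; exact: sfval_in.
Qed.

Lemma common_root_in A B w : polyin S A -> polyin S B -> gcdp A B %= 'X - w%:P -> S w.
Proof.
move=> HA HB dE; have Hd := gcd_in HA HB; move: (gcdp A B) dE Hd => d dE Hd.
have sd : size d = 2 by rewrite (eqp_size dE) size_XsubC.
have : d.[w] = 0 by apply/rootP; rewrite (eqp_root dE) root_XsubC.
have d1 : d`_1 != 0.
  have : lead_coef d != 0 by rewrite lead_coef_eq0 -size_poly_eq0 sd.
  by rewrite lead_coefE sd.
rewrite horner_coef sd !big_ord_recl big_ord0 /= expr0 mulr1 expr1 addr0 => /eqP.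
rewrite addr_eq0 eq_sym => /eqP E1.
have -> : w = - (d`_0 / d`_1).
  by apply: (mulfI d1); rewrite mulrN mulrCA mulfV // mulr1 -E1 opprK.
by apply: (subfieldN HS); apply: (subfieldM HS) => //; apply: (subfieldV HS).
Qed.

Definition min_poly_of q w : Prop :=
  [/\ polyin S q, q != 0, root q w &
      forall P, polyin S P -> P != 0 -> root P w -> (size q <= size P)%N].

Lemma min_poly_exists P w : polyin S P -> P != 0 -> root P w ->
  exists2 q, min_poly_of q w & (size q <= size P)%N.
Proof.
move=> HP P0 Pw.
pose Q n := `[< exists q, [/\ polyin S q, q != 0, root q w & size q = n] >].
have Qex : exists n, Q n by exists (size P); apply/asboolP; exists P.
case: (ex_minnP Qex) => n /asboolP [q [Hq q0 qw qn]] nmin; exists q.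
  split=> // P' HP' P0' Pw'; rewrite qn; apply: nmin; apply/asboolP; by exists P'.
by rewrite qn; apply: nmin; apply/asboolP; exists P.
Qed.

Lemma min_poly_size q w : min_poly_of q w -> (1 < size q)%N.
Proof. by case=> _ q0 qw _; exact: root_size_gt1 q0 qw. Qed.

Lemma polyin_deriv q : polyin S q -> polyin S q^`().
Proof.
move=> Hq i; rewrite coef_deriv -mulr_natr; apply: (subfieldM HS) => //.
elim: (i.+1) => [|n IH]; first exact: (subfield0 HS).
by rewrite -natr1; apply: (subfieldD HS) => //; exact: (subfield1 HS).
Qed.

Lemma min_poly_separable q w : min_poly_of q w -> separable_poly q \/ q^`() = 0.
Proof.
move=> Hmin; have q1 := min_poly_size Hmin; case: Hmin => Hq q0 qw qmin.
have Hd := gcd_in Hq (polyin_deriv Hq); set d := gcdp q q^`() in Hd.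
have dq : d %| q by exact: dvdp_gcdl.
have d0 : d != 0 by rewrite gcdp_eq0 (negPf q0).
have [d1|d1] := leqP (size d) 1.
  left; rewrite unlock coprimep_def eqn_leq d1 size_poly_gt0.
  exact: d0.
have qE : q = q %/ d * d by rewrite divpK.
have e0 : q %/ d != 0 by apply: contraNneq q0 => e0; rewrite qE e0 mul0r.
have se : (size (q %/ d)%R < size q)%N.
  have := size_mul e0 d0; rewrite divpK // => ->; move: d1.
  have : (0 < size (q %/ d)%R)%N by rewrite size_poly_gt0.
  by move: (size d) (size (q %/ d)%R) => a b; lia.
right; have : root (q %/ d * d) w by rewrite -qE.
rewrite rootM => /orP[ew|dw].
  by have := qmin _ (div_in Hq Hd) e0 ew; rewrite leqNgt se.
have dqE : d %= q by rewrite -dvdp_size_eqp // eqn_leq (dvdp_leq q0 dq) (qmin _ Hd d0 dw).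
apply/eqP; apply: contraT => q'0.
have : q %| q^`() by rewrite -(eqp_dvdl _ dqE); exact: dvdp_gcdr.
by move=> /(dvdp_leq q'0); rewrite leqNgt lt_size_deriv.
Qed.

End SubfieldPolynomials.

Section ResultantSize.
Variable F : fieldType.

Lemma size_resultant (A B : {poly {poly F}}) H :
  (forall i, size (A`_i)%R <= H.+1)%N -> (forall i, size (B`_i)%R <= H.+1)%N ->
  (size (resultant A B) <= (((size B).-1 + (size A).-1) * H).+1)%N.
Proof.
move=> sA sB; rewrite /resultant /determinant.
apply: (leq_trans (size_sum _ _ _)); apply/bigmax_leqP => s _.
rewrite mulr_sign (fun_if (fun P : {poly F} => size P)) size_polyN if_same.
apply: (leq_trans (size_poly_prod_leq _ _)).
rewrite card_ord leq_subLR.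
have : (\sum_(i < (size B).-1 + (size A).-1) size (Sylvester_mx A B i (s i)) <=
        \sum_(i < (size B).-1 + (size A).-1) H.+1)%N.
  apply: leq_sum => i _; rewrite Sylvester_mxE; case: split => k; rewrite mulrb; case: ifP => _;
    by rewrite ?size_poly0 ?sA ?sB.
rewrite sum_nat_const card_ord; set a := addn _ _; set b := bigop.body _ _ _.
by rewrite mulnS; lia.
Qed.

Lemma coef_poly_XmY (P : {poly F}) i : (poly_XmY P)`_i = P`_i *: 'X^i.
Proof.
rewrite /poly_XmY comp_polyE coef_sum size_map_polyC.
rewrite (eq_bigr (fun j : 'I_(size P) => if j == i :> nat then P`_i *: 'X^i else 0)).
  case: (ltnP i (size P)) => iP.
    rewrite (bigD1 (Ordinal iP)) //= eqxx big1 ?addr0 // => j /negPf jn.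
    by rewrite -val_eqE /= in jn; rewrite jn.
  by rewrite nth_default // scale0r big1 // => l _; rewrite if_same.
move=> j _; rewrite coef_map exprMn -rmorphXn /= mulrC coefZ coefCM coefXn eq_sym.
by case: eqP => [->|_]; rewrite ?mulr0 ?mulr1 ?mul_polyC.
Qed.

End ResultantSize.

(** * Separable elements and primitive elements over a subfield *)

Section SeparableElements.
Variables (F : fieldType) (S : set F) (HS : subfield_set S) (p : nat).
Implicit Types (A B P q : {poly F}) (w x y z : F).
Hypothesis pchF : p \in [pchar F].

Lemma deriv0_pth_power q : polyin S q -> q^`() = 0 -> exists g, polyin S g /\ q = g \Po 'X^p.
Proof.
move=> Hq q'0; have p0 : (0 < p)%N by apply: prime_gt0; exact: pcharf_prime pchF.
have qi i : ~~ (p %| i)%N -> q`_i = 0.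
  case: i => [|i]; first by rewrite dvdn0.
  move=> pi; have /polyP/(_ i) := q'0; rewrite coef_deriv coef0 -mulr_natr => /eqP.
  by rewrite mulf_eq0 -(dvdn_pcharf pchF) (negPf pi) orbF => /eqP.
exists (\poly_(i < size q) q`_(i * p)); split.
  by move=> i; rewrite coef_poly; case: ifP => _ //; exact: (subfield0 HS).
apply/polyP => i; rewrite coef_comp_poly_Xn // coef_poly.
case: ifP => [/divnK pi|/negbT/qi //]; rewrite pi; case: ltnP => // le.
by rewrite nth_default // (leq_trans le) // leq_div.
Qed.

(** A minimal polynomial with zero derivative is g(X^p), and g kills w^p with smaller degree, so at
    most n such steps occur. *)
Lemma separable_power n w P : polyin S P -> P != 0 -> root P w -> (size P <= n.+1)%N ->
  exists i, (i <= n)%N /\ exists q, [/\ polyin S q, separable_poly q, root q (w ^+ (p ^ i)) &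
    (size q <= n.+1)%N].
Proof.
elim: n w P => [|n IH] w P HP P0 Pw sP.
  by have := root_size_gt1 P0 Pw; rewrite ltnNge sP.
have [q Hmin sq] := min_poly_exists HP P0 Pw.
have [sep|q'0] := min_poly_separable HS Hmin.
  by exists 0%N; split=> //; exists q; case: Hmin => Hq q0 qw _; rewrite expn0 expr1; split=> //; exact: leq_trans sq sP.
case: (Hmin) => Hq q0 qw _; have [g [Hg qE]] := deriv0_pth_power Hq q'0.
have p1 : (1 < p)%N by apply: prime_gt1; exact: pcharf_prime pchF.
have g0 : g != 0 by apply: contraNneq q0 => g0; rewrite qE g0 comp_poly0.
have gw : root g (w ^+ p) by move: qw; rewrite qE rootE horner_comp hornerXn.
have sg : (size g <= n.+1)%N.
  have := size_comp_poly g 'X^p; rewrite -qE size_polyXn /= => sqE.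
  have := root_size_gt1 g0 gw; move: sP sq sqE p1.
  move: (size g) (size q) (size P) p => a b c e; nia.
have [i [il [q1 [Hq1 sq1 q1w sqn]]]] := IH _ _ Hg g0 gw sg.
exists i.+1; split=> //; exists q1; split=> //; last exact: leq_trans sqn _.
by rewrite expnS exprM.
Qed.

Hypothesis Salg : forall w, exists P, [/\ polyin S P, P != 0 & root P w].

Lemma subfield_subring (T : set F) : subfield_set T -> subring_set T.
Proof.
move=> HT; split; [exact: subfield1|exact: (subfieldB HT)|exact: (subfieldM HT)].
Qed.

Lemma adjoin_subfield z : subfield_set (adjoin S z).
Proof.
have HA := adjoin_subring (subfield_subring HS) z; have [A1 AB AM] := HA.
split=> // x y Ax Ay; apply: (AM) => //.
have [->|y0] := eqVneq y 0; first by rewrite invr0; exact: (subring0 HA).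
have [P0 [HP0 P00 P0y]] := Salg y.
have [q [Hq q0 qy qmin] _] := min_poly_exists HP0 P00 P0y.
have q00 : q`_0 != 0.
  apply/eqP => E0; pose q1 := drop_poly 1 q.
  have qE : q = q1 * 'X by rewrite -[LHS](poly_take_drop 1) expr1; rewrite [take_poly _ _](_ : _ = 0) ?add0r //;
    apply/polyP => -[|i]; rewrite coef_take_poly coef0.
  have q10 : q1 != 0 by apply: contraNneq q0 => q10; rewrite qE q10 mul0r.
  have := qmin q1; rewrite [X in (X <= _)%N](_ : _ = (size q1).+1); last by rewrite qE size_mulX.
  rewrite ltnn; move=> H; suff : false by []; apply: H => //.
    by move=> i; rewrite coef_drop_poly.
  by move: qy; rewrite qE rootM rootX (negPf y0) orbF.
have -> : y^-1 = - (q`_0)^-1 * (drop_poly 1 q).[y].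
  apply: (mulfI y0); rewrite mulfV // mulrCA.
  have := rootP qy; rewrite -[q in X in X -> _](poly_take_drop 1) hornerD hornerM expr1 hornerX.
  have -> : take_poly 1 q = (q`_0)%:P.
    by apply/polyP => -[|i]; rewrite coef_take_poly coefC.
  rewrite hornerC => /(canRL (addKr _)); rewrite addr0 mulrC => ->.
  by rewrite mulNr mulrN opprK mulVf.
apply: (AM).
  by apply: (adjoin_sub (subfield_subring HS)); apply: (subfieldN HS); exact: (subfieldV HS).
rewrite horner_coef; apply: (subring_sum HA) => i _.
apply: (AM); first by apply: (adjoin_sub (subfield_subring HS)); rewrite coef_drop_poly.
by apply: (subringX HA).
Qed.

Lemma polyin_sub T P : S `<=` T -> polyin S P -> polyin T P.
Proof. by move=> ST HP i; apply: ST. Qed.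

Lemma min_poly_dvdp q w P : min_poly_of S q w -> polyin S P -> root P w -> q %| P.
Proof.
move=> [Hq q0 qw qmin] HP Pw; have g0 : gcdp q P != 0 by rewrite gcdp_eq0 (negPf q0).
have gw : root (gcdp q P) w by rewrite root_gcd qw.
rewrite -(eqp_dvdl _ (_ : gcdp q P %= q)) ?dvdp_gcdr //.
by rewrite -dvdp_size_eqp ?dvdp_gcdl // eqn_leq (dvdp_leq q0 (dvdp_gcdl q P)) (qmin _ (gcd_in HS Hq HP)).
Qed.

(* If w = Q(w^p), then q divides Q(X^p) - X, whose derivative is -1. *)
Lemma inseparable_power q w : min_poly_of S q w -> q^`() = 0 -> ~ adjoin S (w ^+ p) w.
Proof.
move=> Hmin q'0 [Q HQ wE]; have q1 := min_poly_size Hmin.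
have p0 : (0 < p)%N by apply: prime_gt0; exact: pcharf_prime pchF.
have HP : polyin S (Q \Po 'X^p - 'X).
  move=> i; rewrite coefB coef_comp_poly_Xn //; apply: (subfieldB HS).
    by case: ifP => _ //; exact: (subfield0 HS).
  by rewrite coefX; case: eqP => _; [exact: (subfield1 HS)|exact: (subfield0 HS)].
have Pw : root (Q \Po 'X^p - 'X) w.
  by rewrite rootE hornerD hornerN horner_comp hornerXn hornerX -wE subrr.
have /Pdiv.Field.dvdpP [h hE] := min_poly_dvdp Hmin HP Pw.
have /(congr1 (size \o polyseq)) /= : -1 = h^`() * q.
  have := congr1 (@deriv F) hE; rewrite derivM q'0 mulr0 addr0 => <-.
  have pX : p \in [pchar {poly F}] by rewrite pchar_poly.
  by rewrite derivB derivX deriv_comp derivXn (mulrn_pchar pX) mulr0 add0r.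
rewrite size_polyN size_poly1; have [->|h0] := eqVneq h^`() 0.
  by rewrite mul0r size_poly0.
have q0 : q != 0 by case: Hmin.
rewrite size_mul // => E1; have : (0 < size h^`()%R)%N by rewrite size_poly_gt0.
by move: E1 q1; move: (size _) (size _) => a b; lia.
Qed.

(** X^p - w^p = (X - w)^p has coefficients in S(w^p), and w is a simple root of q, so the gcd of the
    two is X - w up to a scalar. *)
Lemma sep_in_power q w : polyin S q -> separable_poly q -> root q w -> adjoin S (w ^+ p) w.
Proof.
move=> Hq sq qw; have HT := adjoin_subfield (w ^+ p).
have Sub := adjoin_sub (subfield_subring HS) (w ^+ p).
have p1 : (0 < p)%N by apply: prime_gt0; exact: pcharf_prime pchF.
have pX : p \in [pchar {poly F}] by rewrite pchar_poly.
have /factor_theorem [q0 qE] := qw.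
have q0w : ~~ root q0 w by move: sq; rewrite qE separable_root => /andP[].
apply: (common_root_in HT (A := 'X^p - (w ^+ p)%:P) (B := q)).
- move=> i; rewrite coefB coefXn coefC; apply: (subfieldB HT).
    by case: eqP => _; [exact: (subfield1 HT)|exact: (subfield0 HT)].
  case: eqP => _; last exact: (subfield0 HT).
  exact: (adjoin_gen (subfield_subring HS)).
- exact: polyin_sub Sub Hq.
have -> : 'X^p - (w ^+ p)%:P = ('X - w%:P) ^+ p :> {poly F}.
  by rewrite -[RHS](pFrobenius_autE pX) (pFrobenius_autB_comm pX (mulrC _ _)) !pFrobenius_autE polyC_exp.
rewrite qE -(prednK p1) exprSr.
rewrite (eqp_ltrans (gcdp_mul2r _ _ _)).
rewrite -[X in _ %= X]mul1r eqp_mul2r ?polyXsubC_eq0 //.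
by rewrite -size_poly_eq1 -coprimep_def coprimep_expl // coprimep_sym coprimep_XsubC.
Qed.


(* The classical proof of the primitive element theorem, with the exceptional
   parameters confined to the roots of a resultant of bounded degree. *)
Lemma bounded_PET x y P q n : polyin S P -> P != 0 -> root P x ->
  polyin S q -> separable_poly q -> root q y ->
  (size P <= n.+1)%N -> (size q <= n.+1)%N ->
  exists R : {poly F}, [/\ R != 0, (size R <= (2 * n * n).+1)%N &
    forall c, S c -> ~~ root R c -> adjoin S (c * y - x) x /\ adjoin S (c * y - x) y].
Proof.
move=> HP P0 Px Hq sq qy sP szq; have q_0 := separable_poly_neq0 sq.
have /factor_theorem [q0 qE] := qy.
have q0_0 : q0 != 0 by apply: contraNneq q_0 => q00; rewrite qE q00 mul0r.
(* After translation the roots are x' - x and y' - y for the other conjugates. The bad values of c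
   are the quotients (x' - x) / (y' - y), which [div_annihilant] annihilates. *)
pose p1 := P \Po ('X + x%:P); pose q1 := q0 \Po ('X + y%:P).
have szp1 : size p1 = size P by rewrite size_comp_poly2 // size_XaddC.
have szq1 : size q1 = size q0 by rewrite size_comp_poly2 // size_XaddC.
have szq0 : (size q0 <= n)%N by move: szq; rewrite qE size_Mmonic ?monicXsubC // size_XsubC; move: (size q0) => a; lia.
have p1_0 : p1 != 0 by rewrite -size_poly_eq0 szp1 size_poly_eq0.
have q0y : ~~ root q0 y by move: sq; rewrite qE separable_root => /andP[].
have q1_0 : q1.[0] != 0 by rewrite horner_comp !hornerE.
exists (div_annihilant p1 q1); split; first exact: div_annihilant_neq0.
  apply: leq_trans (size_resultant (H := n) _ _) _ => [i|i|].
  - rewrite coef_poly_XmY; have [iP|iP] := ltnP i (size p1).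
      by apply: leq_trans (size_scale_leq _ _) _; rewrite size_polyXn; rewrite szp1 in iP; exact: leq_trans iP sP.
    by rewrite nth_default // scale0r size_poly0.
  - by rewrite coef_map /=; apply: leq_trans (size_polyC_leq1 _) _.
  - by rewrite size_poly_XmY szp1 size_map_polyC szq1; move: sP szq0; move: (size P) (size q0) => a b; nia.
move=> c Sc Rc; set z := c * y - x.
have HT := adjoin_subfield z.
have Sub := adjoin_sub (subfield_subring HS) z.
suff dE : gcdp (P \Po (c *: 'X - z%:P)) q %= 'X - y%:P.
  have Ty : adjoin S z y.
    apply: (common_root_in HT _ _ dE); last exact: polyin_sub Sub Hq.
    have HL i : adjoin S z (c *: 'X - z%:P)`_i.
      rewrite coefB coefZ coefX coefC; apply: (subfieldB HT).
        case: eqP => _; rewrite ?mulr1 ?mulr0; [exact: Sub|exact: (subfield0 HT)].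
      case: eqP => _; [exact: (adjoin_gen (subfield_subring HS))|exact: (subfield0 HT)].
    move=> i; rewrite coef_comp_poly; apply: (subring_sum (subfield_subring HT)) => l _.
    apply: (subfieldM HT); first by apply: Sub.
    elim: (l : nat) i => [|m IH] i.
      by rewrite expr0 coef1; case: eqP => _; [exact: (subfield1 HT)|exact: (subfield0 HT)].
    rewrite exprS coefM; apply: (subring_sum (subfield_subring HT)) => h _.
    by apply: (subfieldM HT).
  split=> //; rewrite (_ : x = c * y - z); last by rewrite /z; ring.
  apply: (subfieldB HT); last exact: (adjoin_gen (subfield_subring HS)).
  by apply: (subfieldM HT) => //; apply: Sub.
pose p0 := P \Po (c *: 'X - z%:P).
have co : coprimep p0 q0.
  pose at_c := horner_eval c; have at_c0 : at_c 0 = 0 by apply: rmorph0.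
  have /map_polyK polyCK : cancel polyC at_c by move=> w; apply: hornerC.
  have -> : p0 = map_poly at_c (poly_XmY p1) \Po ('X - y%:P).
    rewrite /poly_XmY map_comp_poly polyCK // rmorphM /= map_polyC map_polyX /=.
    rewrite horner_evalE hornerX /p1.
    rewrite -!comp_polyA comp_polyM comp_polyD !comp_polyC !comp_polyX.
    by rewrite mulrC mulrBr mul_polyC addrAC -addrA -opprB -rmorphM -rmorphB.
  have -> : q0 = map_poly at_c (map_poly polyC q1) \Po ('X - y%:P).
    by rewrite polyCK ?comp_polyXaddC_K.
  apply: coprimep_comp_poly.
  have [q1_1|q1_1] := leqP (size q1) 1.
    rewrite polyCK // coprimep_sym (@eqp_coprimepl _ _ q1 1) ?coprime1p //.
    rewrite -size_poly_eq1 eqn_leq q1_1 size_poly_gt0.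
    by apply: contraNneq q1_0 => ->; rewrite horner0.
  have p1_1 : (1 < size p1)%N by rewrite szp1; exact: root_size_gt1 P0 Px.
  rewrite -size_poly_XmY -(size_map_polyC q1) in p1_1 q1_1.
  have [[u v] _ /= uvE] := resultant_in_ideal p1_1 q1_1.
  apply/Bezout_coprimepP; exists (map_poly at_c u, map_poly at_c v).
  by rewrite /= -!rmorphM -rmorphD -uvE /= map_polyC polyC_eqp1.
rewrite qE; rewrite /eqp (eqp_dvdl _ (Gauss_gcdpr _ _)) // dvdp_gcdr dvdp_gcd.
rewrite dvdp_mulIr andbT -root_factor_theorem rootE horner_comp !hornerE.
by rewrite /z opprB addrC subrK -rootE.
Qed.

End SeparableElements.

Section RationalSubfield.
Variables (E F : fieldType) (iota : {rmorphism E -> F}) (t : F).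
Hypothesis Tt : forall p : {poly E}, peval iota t p = 0 -> p = 0.
Local Notation ev := (peval iota t).
Local Notation S := (ratfield iota t).

Lemma peval_neq0 (p : {poly E}) : p != 0 -> ev p != 0.
Proof. by apply: contraNneq => /Tt ->. Qed.

Lemma peval_inj : injective ev.
Proof.
by move=> p q e; apply/eqP; rewrite -subr_eq0; apply/eqP/Tt; rewrite pevalD pevalN e subrr.
Qed.

Lemma ratfield_peval (p : {poly E}) : S (ev p).
Proof.
by exists p, 1; rewrite rmorph1 hornerC oner_neq0 invr1 mulr1.
Qed.

Lemma ratfield_subfield : subfield_set S.
Proof.
split.
- by have := ratfield_peval 1; rewrite peval1.
- move=> _ _ [p [q [q0 ->]]] [p' [q' [q0' ->]]]; exists (p * q' - p' * q), (q * q').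
  rewrite -!/(ev _) in q0 q0' *; rewrite !pevalM pevalD pevalN !pevalM mulf_neq0 //; split=> //.
  by field; rewrite q0 q0'.
- move=> _ _ [p [q [q0 ->]]] [p' [q' [q0' ->]]].
  rewrite -!/(ev _) in q0 q0' *; have [->|p0'] := eqVneq (ev p') 0.
    by rewrite mul0r invr0 mulr0 -(peval0 iota t); exact: ratfield_peval.
  exists (p * q'), (q * p'); rewrite -!/(ev _) !pevalM mulf_neq0 //; split=> //.
  by field; rewrite q0 q0' p0'.
Qed.

Lemma ratfield_denominator n (c : 'I_n -> F) : (forall i, S (c i)) ->
  exists2 q : {poly E}, q != 0 & exists p : 'I_n -> {poly E}, forall i, ev q * c i = ev (p i).
Proof.
elim: n c => [|n IH] c Sc; first by exists 1; [exact: oner_neq0|exists (fun=> 0) => -[]].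
have [q q0 [p pE]] := IH (fun i => c (lift ord0 i)) (fun i => Sc _).
have [p1 [q1 [q1_0 c0E]]] := Sc ord0; rewrite -!/(ev _) in q1_0 c0E.
exists (q1 * q).
  rewrite mulf_neq0 //; by apply: contraNneq q1_0 => ->; rewrite peval0.
exists (fun i => if unlift ord0 i is Some k then q1 * p k else q * p1) => i.
case: unliftP => [k ->|->]; first by rewrite !pevalM -pE mulrA.
by rewrite c0E !pevalM; field.
Qed.

Lemma xfree_ratfield n (u : 'I_n -> F) :
  xfree iota t u <-> free_family S setT [set 0] u.
Proof.
split=> [fu|[_ fu] p eqp i].
  split=> // c Sc eqc i; have [q q0 [p pE]] := ratfield_denominator Sc.
  apply: (mulfI (peval_neq0 q0)); rewrite mulr0 pE fu ?peval0 //.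
  under eq_bigr do rewrite -pE -mulrA.
  by rewrite -mulr_sumr eqc mulr0.
by apply: Tt; apply: (fu (fun i => ev (p i))) => // l; exact: ratfield_peval.
Qed.

Lemma peval_iota_subspace (V : set F) : subspace S V -> subspace (range iota) V.
Proof.
move=> [V0 VD]; split=> // c u w [c' _ <-]; apply: VD.
by rewrite -(pevalC iota t); exact: ratfield_peval.
Qed.

End RationalSubfield.

(** * Dimension growth along the poles of t *)

Section PoleFiltration.
Variables (k0 E F : fieldType) (j : {rmorphism k0 -> F}) (iota : {rmorphism E -> F}).
Hypothesis constE : constants j = range iota.
Hypothesis Hfin : forall x, exists N, forall n (u : 'I_n -> F), xfree iota x u -> (n <= N)%N.
Variable t : F.
Local Notation C := (constants j).
Hypothesis Nt : ~ C t.
Local Notation ev := (peval iota t).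
Let HC : subfield_set C := constants_subfield j.

(* In a relation over E[t], the leading terms in t have combined poles at most
   n times those of t. *)
Lemma graded_xfree n m (u : 'I_m -> F) :
  free_family C (poleb j t n.+1) (poleb j t n) u -> xfree iota t u.
Proof.
move=> [Vu fu] p eqp; pose N := (\max_i size (p i))%N.
have : forall i, (size (p i) <= N)%N by move=> i; exact: leq_bigmax.
move: N => N; elim: N => [|N IH] sp i; first by apply/eqP; rewrite -size_poly_leq0.
have t0 := nonconst_neq0 Nt.
suff top0 : forall l, (p l)`_N = 0.
  apply: IH => l; apply/leq_sizeP => k; rewrite leq_eqVlt => /predU1P[<-//|lt].
  by rewrite nth_default // (leq_trans (sp l)).
move=> l; apply: (fmorph_inj iota); rewrite rmorph0.
apply: (fu (fun l => iota (p l)`_N)) => [h|]; first exact: constants_iota constE _.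
set y := \sum_h _.
have yE : t ^+ N * y = - \sum_h ev (take_poly N (p h)) * u h.
  apply/eqP; rewrite -addr_eq0 mulr_sumr -big_split /= -[X in _ == X]eqp; apply/eqP.
  apply: eq_bigr => h _; rewrite mulrA -mulrDl; congr (_ * _).
  rewrite -[in RHS](poly_take_drop N (p h)) pevalD pevalM pevalXn addrC; congr (_ + _).
  rewrite mulrC -(pevalC iota t); congr (ev _ * _); apply/polyP => k.
  rewrite coefC coef_drop_poly; case: k => [|k] /=; first by [].
  by rewrite nth_default // (leq_trans (sp h)) // addSn addnC leq_addr.
apply/polebE => v.
have [v0|v0] := boolP (vz v t < 0); last first.
  have pv0 : poles t v = 0 by rewrite /poles (negPf v0).
  have /polebE/(_ v) : poleb j t n.+1 y.
    apply: (subspace_sum _ (poleb_subspace j t n.+1)) => // h _; exact: constants_iota constE _.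
  by rewrite pv0 !mulr0.
have yE' : y = - (t ^- N * \sum_h ev (take_poly N (p h)) * u h).
  by rewrite -mulrN -yE mulKf ?expf_neq0.
rewrite yE'; apply: vgeN; rewrite mulr_sumr.
apply: vge_sum => h _.
have [N0|N0] := posnP N.
  by rewrite N0 take_poly0l peval0 mul0r mulr0; exact: vge0.
have A1 : vge v (N%:Z * poles t v) (t ^- N).
  rewrite vgeE ?invr_eq0 ?expf_neq0 // vzV ?expf_neq0 // vzX // /poles v0.
  by rewrite mulrN -natz mulr_natl.
have A2 : vge v (- (N.-1%:Z * poles t v)) (ev (take_poly N (p h))).
  suff /polebE/(_ v) : poleb j t N.-1 (ev (take_poly N (p h))) by [].
  by apply: (poleb_peval constE); rewrite (leq_trans (size_take_poly _ _)) // prednK.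
have A3 : vge v (- (n.+1%:Z * poles t v)) (u h) by have /polebE := Vu h.
have := vgeM A1 (vgeM A2 A3); rewrite (_ : _ + _ = - (n%:Z * poles t v)) //.
by rewrite -{1}(prednK N0) !intS; ring.
Qed.

(** By [graded_xfree], each step of the filtration of M by multiples of the poles of t adds at most
    s dimensions; level 0 contains only constants. *)
Lemma pole_filtration_dim (M : set F) s : subspace C M ->
  (forall m (u : 'I_m -> F), (forall i, M (u i)) -> xfree iota t u -> (m <= s)%N) ->
  forall n m, indep C (poleb j t n `&` M) [set 0] m -> (m <= (s * n).+1)%N.
Proof.
move=> HM Ms n m.
suff [e le he] : exists2 e, (e <= (s * n).+1)%N & has_dim C (poleb j t n `&` M) [set 0] e.
  by move=> im; apply: leq_trans le; apply: (hd_indep_le HC (subspace_set0 C) he im).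
have HU k : subspace C (poleb j t k `&` M).
  have [P0 PD] := poleb_subspace j t k; have [M0 MD] := HM.
  by split=> // c u w Sc [Pu Mu] [Pw Mw]; split; [apply: PD|apply: MD].
elim: n {m} => [|n [e le he]].
  have [|e e1 he] := hd_sub HC (subspace_set0 C) _ (has_dim_constants j) (V := poleb j t 0 `&` M).
    move=> x [+ _]; rewrite -(RRspace0 constE Hfin) /poleb; congr (RRspace _ x).
    by apply: boolp.funext => v; rewrite mul0r.
  by exists e => //; rewrite muln0.
have [|f fs hf] := hd_exists HC (HU n) (V := poleb j t n.+1 `&` M) (N := s).
  move=> m [u [Vu fu]]; apply: (Ms _ u) => [i|]; first by case: (Vu i).
  apply: (graded_xfree (n := n)); split=> [i|c Cc Wc]; first by case: (Vu i).
  apply: fu => //; split=> //.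
  by apply: (subspace_sum _ HM) => // i _; case: (Vu i).
exists (f + e)%N; first by rewrite mulnS -addnS leq_add.
apply: hd_cat (subspace_set0 C) _ _ hf he => //.
  by move=> x [Px Mx]; split=> //; apply: poleb_le Px.
by move=> x ->; have [] := HU n.
Qed.

End PoleFiltration.

Section Adjoin.
Variables (F : fieldType) (S : set F) (HS : subfield_set S).

Lemma adjoin_min (T : set F) y : subring_set T -> S `<=` T -> T y -> adjoin S y `<=` T.
Proof.
move=> HT ST Ty _ [P HP ->]; rewrite horner_coef; apply: (subring_sum HT) => i _.
by apply: (subringM HT); [apply: ST|apply: (subringX HT)].
Qed.

Lemma adjoin_pth_power p y w : p \in [pchar F] -> adjoin S y w -> adjoin S (y ^+ p) (w ^+ p).
Proof.
move=> pF [P HP ->]; exists (\poly_(i < size P) P`_i ^+ p).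
  by move=> i; rewrite coef_poly; case: ifP => _; [apply: (subfieldX HS)|exact: (subfield0 HS)].
have pn : [pchar F].-nat p by rewrite pnatE ?pF // (pcharf_prime pF).
rewrite horner_poly horner_coef (exp_sum_pchar _ _ _ pn); apply: eq_bigr => i _.
by rewrite exprMn -!exprM mulnC.
Qed.

End Adjoin.

Section SmallGenerator.
Variables (k0 E F : fieldType) (j : {rmorphism k0 -> F}) (iota : {rmorphism E -> F}).
Hypothesis constE : constants j = range iota.
Hypothesis Hfin : forall x, exists N, forall n (u : 'I_n -> F), xfree iota x u -> (n <= N)%N.
Variables (t : F) (r : nat).
Local Notation C := (constants j).
Hypothesis Nt : ~ C t.
Hypothesis rt : xdeg iota t r.
Local Notation ev := (peval iota t).
Local Notation S := (ratfield iota t).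
Let Tt : forall p : {poly E}, ev p = 0 -> p = 0 := fun p => peval_eq0 constE Nt.
Let HC : subfield_set C := constants_subfield j.
Let HS : subfield_set S := ratfield_subfield iota t.

(* If poleb t (G + 1) only contained s < r elements independent over E(t), its
   dimension would be at most s (G + 1) + 1, contradicting Riemann's
   inequality. *)
Lemma small_basis : exists2 z : 'I_r -> F, xfree iota t z &
  forall i, poleb j t (`|genus j|.+1) (z i).
Proof.
set G := `|genus j|%N.
have Gg : is_genus j (genus j) by apply: (genus_exists constE Hfin); exists t.
have gE : genus j = G%:Z by rewrite gez0_abs // (genus_ge0 constE Hfin Gg).
pose P s := `[< exists2 z : 'I_s -> F, xfree iota t z & forall i, poleb j t G.+1 (z i) >].
have P0 : exists s, P s.
  by exists 0%N; apply/asboolP; exists (fun=> 0) => [p _ []|[]].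
have Pmax s : P s -> (s <= r)%N by move=> /asboolP [z fz _]; case: rt => _ /(_ _ _ fz).
case: (ex_maxnP P0 Pmax) => s Ps smax.
have sr := Pmax _ Ps; move: sr; rewrite leq_eqVlt => /predU1P[<-|sr]; first exact/asboolP.
pose D (v : place j) := G.+1%:Z * poles t v.
have HD : is_divisor D by apply/divisorZ/(poles_divisor constE Hfin).
have degD : divdeg D = G.+1%:Z * r%:Z.
  by rewrite divdegZ ?(poles_degE constE Hfin Nt rt) //; exact: (poles_divisor constE Hfin).
have [_ /(_ _ HD)] := Gg; rewrite degD gE => le.
have ind := hd_indep (RRdimP constE Hfin HD).
have ub := @pole_filtration_dim _ _ _ j iota constE Hfin t Nt (poleb j t G.+1) s
  (poleb_subspace j t G.+1) _ G.+1 (RRdim D).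
have : (RRdim D <= (s * G.+1).+1)%N.
  apply: ub => [m u Vu fu|]; first by apply: smax; apply/asboolP; exists u.
  by rewrite setIid.
by move: le sr; move: (RRdim D) => R; nia.
Qed.

Lemma algebraic_over_ratfield z :
  exists P, [/\ polyin S P, P != 0, root P z & (size P <= r.+1)%N].
Proof.
have : ~ xfree iota t (fun i : 'I_r.+1 => z ^+ i).
  by move=> fz; case: rt => _ /(_ _ _ fz); rewrite ltnn.
move=> /existsNP [p] /not_implyP [eqp /existsNP [i pi]].
exists (\poly_(k < r.+1) ev (p (inord k))); split; last exact: size_poly.
- move=> k; rewrite coef_poly; case: ifP => _; last exact: (subfield0 HS).
  exact: ratfield_peval.
- apply/eqP => /polyP /(_ i); rewrite coef_poly ltn_ord coef0 inord_val => /Tt.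
  exact: pi.
- rewrite rootE horner_poly -[X in _ == X]eqp; apply/eqP; apply: eq_bigr => k _.
  by rewrite inord_val.
Qed.

(** The finite field E may have too few elements to avoid the exceptional parameters; powers of t
    never run out, at the cost of poles bounded by the exponent. *)
Lemma power_avoiding_roots (R : {poly F}) : R != 0 ->
  exists2 i, (i < size R)%N & ~~ root R (t ^+ i).
Proof.
move=> R0; pose ts := mkseq (fun i => t ^+ i) (size R).
have Uts : uniq ts.
  apply: mkseq_uniq => a b; rewrite -!(pevalXn iota) => /(peval_inj Tt) e.
  by have := congr1 (fun P : {poly E} => size P) e; rewrite !size_polyXn => -[].
have : ~~ all (root R) ts.
  by apply/negP => /(max_poly_roots R0)/(_ Uts); rewrite size_mkseq ltnn.
by case/allPn => _ /mapP [i + ->] Ri; rewrite mem_iota add0n => iR; exists i.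
Qed.

Variable p : nat.
Hypothesis pchF : p \in [pchar F].
Let p1 : (1 < p)%N. Proof. by apply: prime_gt1; exact: pcharf_prime pchF. Qed.
Let Salg w : exists P, [/\ polyin S P, P != 0 & root P w].
Proof. by have [P [? ? ? _]] := algebraic_over_ratfield w; exists P. Qed.

(** In t^i w - x the power of t multiplies the new element w and not the accumulated x, so the bound
    N + 2 r^2 on the poles does not grow with the length of s. *)
Lemma primitive_combination N (s : seq F) :
  (forall w, w \in s -> poleb j t N w /\
     exists q, [/\ polyin S q, separable_poly q, root q w & (size q <= r.+1)%N]) ->
  exists y, [/\ poleb j t (N + 2 * r * r) y, forall w, w \in s -> adjoin S y w &
    forall T, subfield_set T -> S `<=` T -> (forall w, w \in s -> T w) -> T y].
Proof.
elim: s => [|w s IH] Hs.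
  exists 0; split=> //; first by case: (poleb_subspace j t (N + 2 * r * r)).
  by move=> T HT _ _; exact: (subfield0 HT).
have [|x [xP sx Tx]] := IH; first by move=> v vs; apply: Hs; rewrite inE vs orbT.
have [wP [q [Hq sq qw szq]]] := Hs w (mem_head _ _).
have [P [HP P0 Px szP]] := algebraic_over_ratfield x.
have [R [R0 szR HR]] := bounded_PET HS pchF Salg HP P0 Px Hq sq qw szP szq.
have [i iR Ri] := power_avoiding_roots R0.
have Sti : S (t ^+ i) by rewrite -(pevalXn iota); exact: ratfield_peval.
have [yx yw] := HR _ Sti Ri; exists (t ^+ i * w - x); split.
- apply: (subspaceB HC (poleb_subspace _ _ _)) => //.
  apply: (@poleb_le _ _ j t (i + N)); first by rewrite addnC leq_add2l -ltnS (leq_trans iR).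
  have : poleb j t (i * 1) (t ^+ i) by apply: polebX; exact: (@poleb_gen _ _ j t).
  by rewrite muln1 => tiP; exact: polebM tiP wP.
- move=> v; rewrite inE => /predU1P[->//|vs].
  have HA := adjoin_subring (subfield_subring HS) (t ^+ i * w - x).
  apply: (adjoin_min HA _ yx); last exact: sx.
  exact: (adjoin_sub (subfield_subring HS)).
- move=> T HT ST Ts; apply: (subfieldB HT).
    by apply: (subfieldM HT); [apply: ST|apply: Ts; rewrite mem_head].
  by apply: Tx => // v vs; apply: Ts; rewrite inE vs orbT.
Qed.

Lemma small_generator : exists y,
  [/\ poleb j t (p ^ r * `|genus j|.+1 + 2 * r * r) y, adjoin S (y ^+ p) y &
      forall z, adjoin S y (z ^+ (p ^ r))].
Proof.
have [z fz zP] := small_basis; set G := `|genus j|%N in zP *.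
have /choice [e He] : forall i, exists e, (e <= r)%N /\ exists q,
    [/\ polyin S q, separable_poly q, root q (z i ^+ (p ^ e)) & (size q <= r.+1)%N].
  move=> i; have [P [HP P0 Pz szP]] := algebraic_over_ratfield (z i).
  exact: (separable_power HS pchF HP P0 Pz szP).
(* The exponents e i, at most r, make the elements of the small basis separable; this multiplies
   their poles by at most p^r. *)
pose W i := z i ^+ (p ^ e i).
have [|y [yP yW yT]] := @primitive_combination (p ^ r * G.+1) (codom W).
  move=> _ /codomP [i ->]; have [ei Hq] := He i; split=> //.
  apply: (@poleb_le _ _ j t (p ^ e i * G.+1)); last exact/polebX/zP.
  by rewrite leq_mul2r leq_exp2l ?ei ?orbT.
exists y; split=> //.
  have HT := adjoin_subfield HS Salg (y ^+ p).
  apply: yT => //; first exact: (adjoin_sub (subfield_subring HS)).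
  move=> w ws; have [i wE] := codomP ws; have [_ [q [Hq sq qw _]]] := He i.
  have wp : adjoin S (w ^+ p) w by rewrite wE; exact: (sep_in_power HS pchF Salg Hq sq qw).
  apply: (adjoin_min (subfield_subring HT) _ _ wp).
    exact: (adjoin_sub (subfield_subring HS)).
  exact: (adjoin_pth_power HS pchF (yW _ ws)).
have HT := adjoin_subfield HS Salg y.
move=> x; pose u (i : 'I_r.+1) := if unlift ord0 i is Some k then z k else x.
have : ~ xfree iota t u by move=> fu; case: rt => _ /(_ _ _ fu); rewrite ltnn.
move=> /existsNP [c] /not_implyP [eqc /existsNP [i ci]].
have {}eqc : ev (c ord0) * x + \sum_k ev (c (lift ord0 k)) * z k = 0.
  rewrite -[RHS]eqc big_ord_recl {1}/u unlift_none; congr (_ + _).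
  by apply: eq_bigr => k _; rewrite /u liftK.
have c0 : c ord0 != 0.
  apply/eqP => c0; apply: ci; move: eqc; rewrite c0 peval0 mul0r add0r => /fz cz.
  by case: (unliftP ord0 i) => [k ->|->].
have xE : x = \sum_k (- ev (c (lift ord0 k)) / ev (c ord0)) * z k.
  apply: (mulfI (peval_neq0 Tt c0)); move/eqP: eqc; rewrite addr_eq0 => /eqP ->.
  rewrite -sumrN mulr_sumr; apply: eq_bigr => k _.
  by field; exact: (peval_neq0 Tt c0).
have pn : [pchar F].-nat (p ^ r)%N by rewrite pnatX pnatE ?pchF // (pcharf_prime pchF).
rewrite xE (exp_sum_pchar _ _ _ pn); apply: (subring_sum (subfield_subring HT)) => k _.
rewrite exprMn; apply: (subfieldM HT).
  apply: (adjoin_sub (subfield_subring HS)); apply: (subfieldX HS); apply: (subfieldM HS).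
    by apply: (subfieldN HS); exact: ratfield_peval.
  by apply: (subfieldV HS); exact: ratfield_peval.
have [ek _] := He k; rewrite -(subnK ek) addnC expnD exprM.
by apply: (subfieldX HT); apply: yW; exact: codom_f.
Qed.

End SmallGenerator.

(** * The plane model *)

Section SmallEquation.
Variables (k0 E F : fieldType) (j : {rmorphism k0 -> F}) (iota : {rmorphism E -> F}).
Hypothesis constE : constants j = range iota.
Hypothesis Hfin : forall x, exists N, forall n (u : 'I_n -> F), xfree iota x u -> (n <= N)%N.
Variables (t : F) (r : nat).
Local Notation C := (constants j).
Hypothesis Nt : ~ C t.
Hypothesis rt : xdeg iota t r.
Local Notation ev := (peval iota t).
Local Notation S := (ratfield iota t).
Let Tt : forall p : {poly E}, ev p = 0 -> p = 0 := fun p => peval_eq0 constE Nt.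
Let HS : subfield_set S := ratfield_subfield iota t.

Lemma minimal_degree y : exists r1, [/\ (0 < r1 <= r)%N,
  xfree iota t (fun i : 'I_r1 => y ^+ i) & ~ xfree iota t (fun i : 'I_r1.+1 => y ^+ i)].
Proof.
pose P n := `[< ~ xfree iota t (fun i : 'I_n.+1 => y ^+ i) >].
have Pr : P r.
  by apply/asboolP => fz; case: rt => _ /(_ _ _ fz); rewrite ltnn.
case: (ex_minnP (ex_intro _ r Pr)) => n /asboolP Pn nmin; exists n.
have n0 : (0 < n)%N.
  rewrite lt0n; apply/eqP => n0; apply: Pn; rewrite n0.
  move=> p; rewrite big_ord1 expr0 mulr1 => /Tt pE i.
  by rewrite (ord1 i).
split=> //; first by rewrite n0 nmin.
apply: contrapT => /asboolP Pn1; have := nmin n.-1.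
by rewrite /P prednK // => /(_ Pn1); rewrite leqNgt ltn_predL n0.
Qed.

(* With J = r1^2 eta, the (r1 + 1)(J + 1) products t^i y^k lie in a space of
   dimension at most n (n eta + J) + 1 over the constants. *)
Lemma small_relation y eta r1 : (0 < r1)%N -> poleb j t eta y ->
  xfree iota t (fun i : 'I_r1 => y ^+ i) -> ~ xfree iota t (fun i : 'I_r1.+1 => y ^+ i) ->
  exists f0 : 'I_r1.+1 -> {poly E}, [/\ \sum_i ev (f0 i) * y ^+ i = 0,
    f0 ord_max != 0 & forall i, (size (f0 i) <= (r1 * r1 * eta).+1)%N].
Proof.
move=> r1_0 Py fy nfy; set J := (r1 * r1 * eta)%N.
pose M : set F := [set w | exists2 s : 'I_r1 -> F, (forall i, S (s i)) & w = \sum_i s i * y ^+ i].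
have HMS : subspace S M.
  split; first by exists (fun=> 0) => [i|]; [exact: (subfield0 HS)|rewrite big1 // => i _; rewrite mul0r].
  move=> c _ _ Sc [s Hs ->] [s' Hs' ->]; exists (fun i => c * s i + s' i).
    by move=> i; apply: (subfieldD HS) => //; apply: (subfieldM HS).
  by rewrite mulr_sumr -big_split; apply: eq_bigr => i _; rewrite mulrDl mulrA.
have HM : subspace C M by rewrite constE; exact: (peval_iota_subspace (t := t)).
have Mlow (k : 'I_r1) : M (y ^+ k).
  exists (fun i => (i == k)%:R) => [i|].
    by case: eqP => _; [exact: (subfield1 HS)|exact: (subfield0 HS)].
  by rewrite (bigD1 k) //= eqxx mul1r big1 ?addr0 // => i /negPf ->; rewrite mul0r.
have tops (c : 'I_r1.+1 -> {poly E}) : \sum_i ev (c i) * y ^+ i = 0 ->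
    c ord_max = 0 -> forall i, c i = 0.
  move=> eqc cm; have := fy (fun i => c (widen_ord (leqnSn r1) i)).
  rewrite big_ord_recr /= cm peval0 mul0r addr0 in eqc => /(_ eqc) cl i.
  case: (unliftP ord_max i) => [k ->|-> //]; rewrite -[RHS](cl k); congr c.
  by apply: val_inj; rewrite /= /bump leqNgt ltn_ord.
have Mpow (k : 'I_r1.+1) : M (y ^+ k).
  have [kr|] := ltnP k r1; first exact: (Mlow (Ordinal kr)).
  move=> kr; have -> : (k : nat) = r1 by apply/eqP; rewrite eqn_leq kr -ltnS ltn_ord.
  move: nfy => /existsNP [c] /not_implyP [eqc /existsNP [i ci]].
  have c0 : ev (c ord_max) != 0.
    by apply: (peval_neq0 Tt); apply/eqP => /(tops _ eqc) cz; apply: ci.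
  exists (fun i => - ev (c (widen_ord (leqnSn r1) i)) / ev (c ord_max)).
    move=> l; apply: (subfieldM HS); first by apply: (subfieldN HS); exact: ratfield_peval.
    by apply: (subfieldV HS); exact: ratfield_peval.
  apply: (mulfI c0); move/eqP: eqc; rewrite big_ord_recr /= addrC addr_eq0 => /eqP ->.
  by rewrite -sumrN mulr_sumr; apply: eq_bigr => l _; field.
have Ms m (u : 'I_m -> F) : (forall i, M (u i)) -> xfree iota t u -> (m <= r1)%N.
  move=> Mu /xfree_ratfield [|fu1 fu2]; first exact: Tt.
  apply: (steinitz HS (subspace_set0 S) (b := fun i : 'I_r1 => y ^+ i) (u := u)) => // i.
  by have [s Hs ->] := Mu i; exists s; split=> //; rewrite subrr.
pose T := ('I_r1.+1 * 'I_J.+1)%type.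
pose b (x : T) := t ^+ x.2 * y ^+ x.1.
have bP x : (poleb j t (J + r1 * eta) `&` M) (b x).
  split.
    have tx : poleb j t (x.2 * 1) (t ^+ x.2) by apply: polebX; exact: (@poleb_gen _ _ j t).
    apply: poleb_le (polebM tx (polebX x.1 Py)).
    by rewrite muln1 leq_add // ?leq_mul2r -ltnS ltn_ord ?orbT.
  by apply: (subspaceZ HMS); [rewrite -(pevalXn iota); exact: ratfield_peval|exact: Mpow].
have : ~ forall c : T -> F, (forall x, C (c x)) -> \sum_x c x * b x = 0 -> forall x, c x = 0.
  move=> H; have ind := indep_fin bP H (W := [set 0]).
  have := pole_filtration_dim constE Hfin Nt HM Ms ind.
  by rewrite card_prod !card_ord mulnDr mulnA -/J mulSn mulnS; move: r1_0; lia.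
move=> /existsNP [c] /not_implyP [Cc] /not_implyP [eqc /existsNP [[k0' i0] cki]].
have /choice [e He] : forall x, exists e : E, iota e = c x.
  by move=> x; have := Cc x; rewrite constE => -[e _ <-]; exists e.
pose f0 (k : 'I_r1.+1) := \poly_(i < J.+1) e (k, inord i).
have eqf : \sum_i ev (f0 i) * y ^+ i = 0.
  rewrite -[RHS]eqc (eq_bigr (fun x : T => c (x.1, x.2) * b (x.1, x.2))); last by case.
  rewrite -(pair_bigA _ (fun k i => c (k, i) * b (k, i))) /=; apply: eq_bigr => k _.
  have sf : (size (map_poly iota (f0 k)) <= J.+1)%N by rewrite size_map_poly size_poly.
  rewrite /peval (horner_coef_wide _ sf) mulr_suml; apply: eq_bigr => i _.
  by rewrite coef_map coef_poly ltn_ord inord_val /= He /b /= mulrA.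
exists f0; split=> // [|i]; last exact: size_poly.
apply/eqP => /(tops _ eqf) /(_ k0') /polyP /(_ i0).
rewrite coef_poly ltn_ord inord_val coef0 => e0; apply: cki.
by rewrite -He e0 rmorph0.
Qed.


Lemma clear_denominators (Q : {poly F}) : polyin S Q ->
  exists2 c : {poly E}, c != 0 & exists P : {poly {poly E}}, map_poly ev P = ev c *: Q.
Proof.
move=> HQ; have [c c0 [P PE]] := ratfield_denominator (c := fun i : 'I_(size Q) => Q`_i) (fun i => HQ i).
exists c => //; exists (\poly_(i < size Q) oapp P 0 (insub i)); apply/polyP => i.
rewrite coef_map coefZ coef_poly; case: ltnP => iQ.
  by rewrite insubT /= -PE.
by rewrite nth_default // mulr0; exact: peval0.
Qed.

(** Since the identity has coefficients in E[T], it survives every specialization T = a and makes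
    f(a, Y) separable whenever D(a) != 0; the degree of D bounds the number of exceptions. *)
Lemma separability_certificate (f : {poly {poly E}}) n H : size f = n.+1 -> (0 < n)%N ->
  (forall i, size (f`_i)%R <= H.+1)%N -> separable_poly (map_poly ev f) ->
  exists (D : {poly E}) (u v : {poly {poly E}}), [/\ D != 0, (size D <= (2 * n * H).+1)%N &
    D%:P = u * f + v * f^`()].
Proof.
move=> szf n0 Hf sf.
have szm g : size (map_poly ev g) = size g.
  by apply: size_map_inj_poly; [exact: (peval_inj Tt)|exact: peval0].
have Hf' i : (size (f^`()`_i)%R <= H.+1)%N.
  by rewrite coef_deriv; apply/leq_sizeP => l Hl; rewrite coefMn (leq_sizeP _ _ (Hf _)) ?mul0rn.
(* When the derivative is constant in Y, [resultant_in_ideal] does not apply, but the derivative is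
   itself the certificate. *)
have [f'1|f'1] := leqP (size f^`()) 1.
  have f'E := size1_polyC f'1.
  exists (f^`()`_0); exists 0; exists 1; rewrite mul0r add0r mul1r -f'E; split=> //; last first.
    by apply: leq_trans (Hf' 0%N) _; rewrite ltnS leq_pmull // muln_gt0.
  apply/eqP => f'0; move: sf; rewrite unlock deriv_map f'E f'0 polyC0 rmorph0 coprimep0.
  by rewrite -size_poly_eq1 szm szf => /eqP [n1]; rewrite n1 in n0.
have f1 : (1 < size f)%N by rewrite szf.
have [[u v] _ /= uvE] := resultant_in_ideal f1 f'1.
exists (resultant f f^`()), u, v; split=> //.
- have lc0 (g : {poly {poly E}}) : (1 < size g)%N -> ev (lead_coef g) != 0.
    move=> g1; apply: (peval_neq0 Tt); rewrite lead_coef_eq0 -size_poly_gt0; exact: ltnW.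
  apply/eqP => R0; have /eqP : resultant (map_poly ev f) (map_poly ev f^`()) = 0.
    rewrite -(map_resultant (lc0 _ f1) (lc0 _ f'1)) R0; exact: peval0.
  by rewrite resultant_eq0; move: sf; rewrite unlock deriv_map coprimep_def => /eqP ->.
- apply: leq_trans (size_resultant Hf Hf') _.
  rewrite szf /= ltnS leq_mul2r; apply/orP; right.
  have := lt_size_deriv (_ : f != 0); rewrite -size_poly_gt0 szf => /(_ isT).
  by move: (size f^`()) => a; lia.
Qed.


Definition plane_model (y : F) (f : {poly {poly E}}) (n H : nat) : Prop :=
  [/\ size f = n.+1, f \is monic, forall i, (size (f`_i)%R <= H.+1)%N,
      (map_poly ev f).[y] = 0 &
      forall g : {poly {poly E}}, (size g <= n)%N -> (map_poly ev g).[y] = 0 -> g = 0].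

(* The leading coefficient c of the relation is absorbed in the generator. *)
Lemma monic_model y eta n : (0 < n)%N -> poleb j t eta y ->
  xfree iota t (fun i : 'I_n => y ^+ i) -> ~ xfree iota t (fun i : 'I_n.+1 => y ^+ i) ->
  exists (c : {poly E}) (f : {poly {poly E}}), [/\ c != 0,
    poleb j t (n * n * eta + eta) (ev c * y) &
    plane_model (ev c * y) f n (n * (n * n * eta))].
Proof.
move=> n0 Py fy nfy; have [f0 [f0E f0m szf0]] := small_relation n0 Py fy nfy.
set J := (n * n * eta)%N in szf0 *; set c := f0 ord_max in f0m.
have c0 := peval_neq0 Tt f0m.
pose h := \poly_(k < n) (f0 (inord k) * c ^+ (n.-1 - k)).
have szh : (size h < size ('X^n : {poly {poly E}})%R)%N by rewrite size_polyXn ltnS size_poly.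
pose f := 'X^n + h.
have szf : size f = n.+1 by rewrite size_polyDl // size_polyXn.
have szc i : (size (c ^+ i)%R <= (i * J).+1)%N.
  elim: i => [|i IH]; first by rewrite expr0 size_poly1.
  rewrite exprS mulSn; apply: leq_trans (size_polyMleq _ _) _.
  by have := szf0 ord_max; rewrite -/c; move: IH; move: (size _) (size _) => a b; lia.
exists c, f; split=> //.
  by apply: polebM Py; apply: (poleb_peval constE); exact: szf0.
split=> //.
- by rewrite monicE lead_coefDl // lead_coefXn.
- move=> i; rewrite coefD coefXn coef_poly; case: ltnP => [i_n|i_n].
    rewrite (ltn_eqF i_n) add0r; apply: leq_trans (size_polyMleq _ _) _.
    have := szf0 (inord i); have := szc (n.-1 - i)%N.
    move: (size _) (size _) => a b; have : (n.-1 - i <= n.-1)%N by exact: leq_subr.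
    have -> : (n * J = J + n.-1 * J)%N by rewrite -mulSn prednK.
    by move: (n.-1 - i)%N (n.-1) => a' b'; nia.
  by rewrite addr0; case: (i == n); rewrite ?size_poly1 ?size_poly0.
- rewrite rmorphD /= map_polyXn hornerD hornerXn.
  have -> : (map_poly ev h).[ev c * y] =
      ev c ^+ n.-1 * (\sum_(k < n) ev (f0 (widen_ord (leqnSn n) k)) * y ^+ k).
    have sm : (size (map_poly ev h) <= n)%N.
      by apply: leq_trans (size_poly _ _) _; exact: size_poly.
    rewrite (horner_coef_wide _ sm) mulr_sumr; apply: eq_bigr => k _.
    rewrite coef_map coef_poly ltn_ord /= pevalM rmorphXn /= exprMn.
    have -> : inord k = widen_ord (leqnSn n) k.
      by apply: val_inj; rewrite /= inordK // ltnS ltnW.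
    rewrite -[in RHS](subnK (_ : (k <= n.-1)%N)); last by rewrite -ltnS prednK.
    by rewrite exprD; ring.
  move: f0E; rewrite big_ord_recr /= -/c => f0E.
  rewrite exprMn -{1}(prednK n0) exprSr -mulrA -mulrDr.
  by rewrite -[X in _ * X = _]/(_ + _) addrC f0E mulr0.
- move=> g szg eqg; have sm : (size (map_poly ev g) <= n)%N.
    by apply: leq_trans (size_poly _ _) _.
  rewrite (horner_coef_wide _ sm) in eqg.
  have := fy (fun i => g`_i * c ^+ i) => H.
  apply/polyP => i; rewrite coef0; have [i_n|] := ltnP i n; last first.
    by move=> ni; rewrite nth_default // (leq_trans szg).
  have : g`_(Ordinal i_n) * c ^+ (Ordinal i_n) = 0.
    apply: H; rewrite -[RHS]eqg; apply: eq_bigr => k _.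
    by rewrite coef_map pevalM rmorphXn /= exprMn mulrA.
  by move/eqP; rewrite mulf_eq0 expf_eq0 (negPf f0m) andbF orbF => /eqP.
Qed.

Lemma plane_model_min_poly y f n H : plane_model y f n H -> min_poly_of S (map_poly ev f) y.
Proof.
move=> [szf fm _ fy fmin]; split.
- by move=> i; rewrite coef_map; exact: ratfield_peval.
- by apply/monic_neq0/monic_map.
- exact/eqP.
move=> P HP P0 Py; rewrite size_map_inj_poly; [|exact: (peval_inj Tt)|exact: peval0].
rewrite szf ltnNge; apply/negP => szP; have [c c0 [P' P'E]] := clear_denominators HP.
have P'0 : P' = 0.
  apply: fmin; last by rewrite P'E hornerZ (eqP Py) mulr0.
  rewrite -(size_map_inj_poly (peval_inj Tt) (peval0 iota t)) P'E.
  by rewrite size_scale // (peval_neq0 Tt).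
move/eqP: P'E; rewrite P'0 rmorph0 eq_sym scaler_eq0 (negPf P0) orbF.
by rewrite (negPf (peval_neq0 Tt c0)).
Qed.

(** In eta, p^r (g + 1) bounds the poles of the powers of the small basis, and 2 r^2 the exponent of
    t in the primitive combination. The further powers of n come from [small_relation] and from
    absorbing the leading coefficient. *)
Lemma small_equation p : p \in [pchar F] ->
  let eta := (p ^ r * `|genus j|.+1 + 2 * r * r)%N in
  exists n y f, [/\ (0 < n <= r)%N, poleb j t (n * n * eta + eta) y,
    plane_model y f n (n * (n * n * eta)),
    exists (D : {poly E}) (u v : {poly {poly E}}), [/\ D != 0,
      (size D <= (2 * n * (n * (n * n * eta))).+1)%N & D%:P = u * f + v * f^`()] &
    forall z, exists2 c : {poly E}, c != 0 &
      exists P : {poly {poly E}}, ev c * z ^+ (p ^ r) = (map_poly ev P).[y]].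
Proof.
move=> pF eta.
have Salg w : exists P, [/\ polyin S P, P != 0 & root P w].
  by have [P [? ? ? _]] := algebraic_over_ratfield constE Nt rt w; exists P.
have [y0 [Py0 y0p y0z]] := small_generator constE Hfin Nt rt pF.
have [n [nr fy nfy]] := minimal_degree y0; have /andP[n0 _] := nr.
have [c [f [c0 Py model]]] := monic_model n0 Py0 fy nfy.
set y := ev c * y0 in Py model; exists n, y, f; split=> //.
- have Hmin := plane_model_min_poly model; have [szf _ szfi _ _] := model.
  apply: (separability_certificate szf n0 szfi).
  have [//|f'0] := min_poly_separable HS Hmin.
  have HT := adjoin_subfield HS Salg (y ^+ p).
  have ST := adjoin_sub (subfield_subring HS) (y ^+ p).
  have Tc : adjoin S (y ^+ p) (ev c) by apply: ST; exact: ratfield_peval.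
  case: (inseparable_power HS pF Hmin f'0); apply: (subfieldM HT) => //.
  apply: (adjoin_min (subfield_subring HT) ST _ y0p).
  have -> : y0 ^+ p = y ^+ p / ev c ^+ p.
    by rewrite /y exprMn mulrC mulKf // expf_neq0 // (peval_neq0 Tt).
  apply: (subfieldM HT); first exact: (adjoin_gen (subfield_subring HS)).
  by apply: (subfieldV HT); exact: (subfieldX HT).
move=> z; have [] := adjoin_min (subfield_subring (adjoin_subfield HS Salg y)) _ _ (y0z z).
- exact: (adjoin_sub (subfield_subring HS)).
- have HT := adjoin_subfield HS Salg y.
  have -> : y0 = y / ev c by rewrite /y mulrC mulKf // (peval_neq0 Tt).
  apply: (subfieldM HT); first exact: (adjoin_gen (subfield_subring HS)).
  apply: (subfieldV HT); apply: (adjoin_sub (subfield_subring HS)); exact: ratfield_peval.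
move=> Q HQ ->; have [c' c'0 [P PE]] := clear_denominators HQ.
by exists c' => //; exists P; rewrite PE hornerZ.
Qed.

End SmallEquation.

(** * The place at a smooth point *)

Section EvaluationAtPoint.
Variables (E A : fieldType) (phi : {rmorphism E -> A}) (a b : A).

Definition eval2 (P : {poly {poly E}}) : A := (map_poly (peval phi a) P).[b].

Lemma eval2_nmod : nmod_morphism eval2.
Proof.
by split=> [|P Q]; rewrite /eval2 ?rmorph0 ?horner0 // rmorphD hornerD.
Qed.

Lemma eval2_monoid : monoid_morphism eval2.
Proof.
by split=> [|P Q]; rewrite /eval2 ?rmorph1 ?hornerC // rmorphM hornerM.
Qed.

HB.instance Definition _ := GRing.isNmodMorphism.Build _ _ eval2 eval2_nmod.
HB.instance Definition _ := GRing.isMonoidMorphism.Build _ _ eval2 eval2_monoid.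

Lemma eval2M P Q : eval2 (P * Q) = eval2 P * eval2 Q. Proof. exact: rmorphM. Qed.
Lemma eval2D P Q : eval2 (P + Q) = eval2 P + eval2 Q. Proof. exact: rmorphD. Qed.
Lemma eval2B P Q : eval2 (P - Q) = eval2 P - eval2 Q. Proof. exact: rmorphB. Qed.
Lemma eval2Xn P m : eval2 (P ^+ m) = eval2 P ^+ m. Proof. exact: rmorphXn. Qed.
Lemma eval2_0 : eval2 0 = 0. Proof. exact: rmorph0. Qed.
Lemma eval2_1 : eval2 1 = 1. Proof. exact: rmorph1. Qed.

Lemma eval2C c : eval2 c%:P = peval phi a c.
Proof. by rewrite /eval2 map_polyC hornerC. Qed.

Lemma eval2X : eval2 'X = b.
Proof. by rewrite /eval2 map_polyX hornerX. Qed.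

End EvaluationAtPoint.

Section SmoothPoint.
Variables (k0 E F : fieldType) (j : {rmorphism k0 -> F}) (iota : {rmorphism E -> F}).
Hypothesis constE : constants j = range iota.
Hypothesis Hfin : forall x, exists N, forall n (u : 'I_n -> F), xfree iota x u -> (n <= N)%N.
Variables (t y : F) (f : {poly {poly E}}) (n H : nat).
Hypothesis Nt : ~ constants j t.
Hypothesis model : plane_model iota t y f n H.
Variables (L : finFieldType) (phi : {rmorphism E -> L}) (a b : L).
Hypothesis fab : eval2 phi a b f = 0.
Hypothesis dfab : eval2 phi a b f^`() != 0.
Hypothesis gen_a : forall x : L, exists P : {poly E}, peval phi a P = x.
Local Notation ev := (peval iota t).
Local Notation evF := (eval2 iota t y).
Local Notation evL := (eval2 phi a b).

Lemma eval2_specialize P : evF P = 0 -> evL P = 0.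
Proof.
case: model => szf fm _ fy fmin.
rewrite (Pdiv.RingMonic.rdivp_eq fm P); set d := Pdiv.Ring.rdivp _ _; set e := Pdiv.Ring.rmodp _ _.
rewrite !eval2D !eval2M fab [evF f]fy !mulr0 !add0r => e0.
rewrite (fmin e) ?eval2_0 //.
by rewrite -ltnS -szf Pdiv.Ring.ltn_rmodpN0 // monic_neq0.
Qed.

(** The local ring of the curve f = 0 at the point (a, b), as a subring of F. *)
Definition local_ring : set F :=
  [set x | exists P s, evL s != 0 /\ x = evF P / evF s].

Lemma eval2_neq0 s : evL s != 0 -> evF s != 0.
Proof. by apply: contraNneq => /eval2_specialize ->. Qed.

Lemma local_ring_eval P : local_ring (evF P).
Proof. by exists P, 1; rewrite !eval2_1 oner_neq0 divr1. Qed.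

Lemma local_ring_inv s : evL s != 0 -> local_ring (evF s)^-1.
Proof. by move=> s0; exists 1, s; rewrite eval2_1 mul1r. Qed.

Lemma local_ring_subring : subring_set local_ring.
Proof.
split; first by rewrite -(eval2_1 iota t y); exact: local_ring_eval.
- move=> _ _ [P [s [s0 ->]]] [P' [s' [s0' ->]]]; exists (P * s' - P' * s), (s * s').
  rewrite eval2B !eval2M mulf_neq0 //; split; first by [].
  by field; rewrite !eval2_neq0.
- move=> _ _ [P [s [s0 ->]]] [P' [s' [s0' ->]]]; exists (P * P'), (s * s').
  rewrite !eval2M mulf_neq0 //; split; first by [].
  by field; rewrite !eval2_neq0.
Qed.

Lemma point_min_poly : exists pi0 : {poly E}, [/\ pi0 != 0, peval phi a pi0 = 0 &
  forall P, peval phi a P = 0 -> pi0 %| P].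
Proof.
pose Q m := `[< exists P : {poly E}, [/\ P != 0, peval phi a P = 0 & size P = m] >].
have Qex : exists m, Q m.
  exists (#|L|.+1); apply/asboolP; exists ('X^#|L| - 'X).
  have sz : size ('X^#|L| - 'X : {poly E})%R = #|L|.+1.
    by rewrite size_polyDl ?size_polyXn // size_polyN size_polyX ltnS finNzRing_gt1.
  split=> //; first by rewrite -size_poly_eq0 sz.
  by rewrite pevalD pevalN pevalXn pevalX expf_card subrr.
case: (ex_minnP Qex) => m /asboolP [pi0 [pi0_0 api0 sz]] mmin; exists pi0; split=> // P aP.
rewrite /dvdp; apply: contraT => r0.
have := mmin (size (P %% pi0)); rewrite -sz leqNgt ltn_modp pi0_0 => H'.
suff : false by []; apply: H'; apply/asboolP; exists (P %% pi0); split=> //.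
move: aP; rewrite {1}(divp_eq P pi0) pevalD pevalM api0 mulr0 add0r => <-.
by [].
Qed.

(* Write b = beta(a). Dividing by Y - beta gives f = B (Y - beta) + c' pi0 with
   B(a, b) = f_Y(a, b), so that y - beta(t) is a multiple of pi0(t) in the
   local ring. *)
Lemma local_parameter : exists pi0 : {poly E}, [/\ ev pi0 != 0, peval phi a pi0 = 0 &
  forall P, evL P = 0 -> exists2 x, local_ring x & evF P = ev pi0 * x].
Proof.
have Tt (p : {poly E}) : ev p = 0 -> p = 0 := peval_eq0 constE Nt.
have [pi0 [pi0_0 api0 pi0min]] := point_min_poly; exists pi0; split=> //.
  exact: (peval_neq0 Tt).
have [be beE] := gen_a b.
have hornE P : peval phi a P.[be] = evL P by rewrite /eval2 -beE horner_map.
have split_be P : exists Q, P = Q * ('X - be%:P) + (P.[be])%:P.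
  have /factor_theorem [Q QE] : root (P - (P.[be])%:P) be.
    by rewrite rootE hornerD hornerN hornerC subrr.
  by exists Q; rewrite -QE subrK.
have [B fE] := split_be f.
have /dvdpP [c' c'E] : pi0 %| f.[be] by apply: pi0min; rewrite hornE.
have B0 : evL B != 0.
  have := congr1 (@deriv _) fE; rewrite derivD derivC addr0 derivM derivXsubC mulr1 => f'E.
  move: dfab; rewrite f'E eval2D eval2M eval2B eval2X eval2C beE subrr mulr0 add0r.
  by [].
have yE : y - ev be = - (ev c' * ev pi0 / evF B).
  have : evF f = 0 by case: model.
  rewrite {1}fE eval2D eval2M eval2B eval2X !eval2C c'E pevalM => e0.
  apply: (mulfI (eval2_neq0 B0)); move/eqP: e0; rewrite addr_eq0 => /eqP ->.
  by field; exact: eval2_neq0.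
move=> P P0; have [Q PE] := split_be P.
have /dvdpP [c cE] : pi0 %| P.[be] by apply: pi0min; rewrite hornE.
exists (ev c - evF Q * (ev c' / evF B)).
  have HR := local_ring_subring; apply: (subringB HR).
    by rewrite -(eval2C iota t y); exact: local_ring_eval.
  apply: (subringM HR); first exact: local_ring_eval.
  apply: (subringM HR); last exact: local_ring_inv.
  by rewrite -(eval2C iota t y); exact: local_ring_eval.
rewrite [in LHS]PE eval2D eval2M eval2B eval2X !eval2C cE pevalM yE.
by ring.
Qed.

(* For q a power of p, z^q is a quotient of elements of E[t, y], and q-th roots
   exist in the finite field L: this gives the residue of z. *)
Lemma place_at_point q p r : p \in [pchar F] -> q = (p ^ r)%N ->
  (forall z, exists2 c : {poly E}, c != 0 & exists P, ev c * z ^+ q = evF P) ->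
  exists v : place j, [/\ vge v 0 t,
    forall P : {poly E}, vge v 1 (ev P) <-> peval phi a P = 0 &
    forall z, vge v 0 z -> exists P : {poly E}, vge v 1 (z - ev P)].
Proof.
move=> pF qE Hq; have [pi0 [pi_0 api0 piP]] := local_parameter.
have HR := local_ring_subring; set pi := ev pi0 in pi_0 piP.
have Rpi : local_ring pi by rewrite /pi -(eval2C iota t y); exact: local_ring_eval.
have NRpi : ~ local_ring pi^-1.
  move=> [P [s [s0 piE]]]; have : evF (s - pi0%:P * P) = 0.
    rewrite eval2B eval2M eval2C -/pi.
    have -> : evF P = pi^-1 * evF s by rewrite piE; field; exact: eval2_neq0.
    by rewrite mulrA mulfV // mul1r subrr.
  move/eval2_specialize; rewrite eval2B eval2M eval2C api0 mul0r subr0 => s00.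
  by rewrite s00 eqxx in s0.
have constR : constants j `<=` local_ring.
  rewrite constE => _ [c _ <-]; rewrite -(pevalC iota t) -(eval2C iota t y).
  exact: local_ring_eval.
have [v [Rv vpi]] := place_exists constE Hfin HR constR pi_0 Rpi NRpi.
have RvF P : vge v 0 (evF P) by apply: Rv; exact: local_ring_eval.
have unit0 s : evL s != 0 -> vz v (evF s) = 0.
  move=> s0; have sF := eval2_neq0 s0; apply/eqP; rewrite eq_le.
  have := RvF s; rewrite vgeE // => ->; rewrite andbT.
  have := Rv _ (local_ring_inv s0); rewrite vgeE ?invr_eq0 // vzV.
  by rewrite oppr_ge0.
have vL P : evL P = 0 -> vge v 1 (evF P).
  by move=> /piP [x Rx ->]; rewrite -[1]addr0; apply: vgeM => //; exact: Rv.
have vpi1 : 1 <= vz v pi by move: vpi; rewrite vgeE.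
(* A nonunit numerator is divisible by pi in the local ring. Removing this factor lowers the
   valuation by at least 1, so the process stops at a power of pi times a unit. *)
have normal x : local_ring x -> x != 0 -> exists N P s,
    [/\ evL P != 0, evL s != 0 & x = pi ^+ N * (evF P / evF s)].
  move=> Rx x0; have vx : 0 <= vz v x by have := Rv _ Rx; rewrite vgeE.
  have [m] := ubnP `|vz v x|%N; elim: m x Rx x0 vx => // m IH x [P [s [s0 xE]]] x0 vx le.
  have [P0|P0] := eqVneq (evL P) 0; last by exists 0%N, P, s; rewrite expr0 mul1r.
  have [x' Rx' PE] := piP _ P0.
  have Rx'' : local_ring (x' / evF s) by apply: (subringM HR) => //; exact: local_ring_inv.
  have xE' : x = pi * (x' / evF s) by rewrite xE PE mulrA.
  have x''0 : x' / evF s != 0 by apply: contraNneq x0 => e; rewrite xE' e mulr0.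
  have vx' : 0 <= vz v (x' / evF s) by have := Rv _ Rx''; rewrite vgeE.
  have [] := IH _ Rx'' x''0 vx'.
    by move: le; rewrite xE' vzM //; move: vpi1 vx'; move: (vz v pi) (vz v _) => c d; lia.
  move=> N [P' [s' [P'0 s'0 e]]]; exists N.+1, P', s'; split=> //.
  by rewrite xE' e exprS mulrA.
have q0 : (0 < q)%N by rewrite qE expn_gt0 prime_gt0 // (pcharf_prime pF).
have pL : p \in [pchar L] by rewrite (fmorph_pchar phi) -(fmorph_pchar iota).
have nF : [pchar F].-nat q by rewrite qE pnatX pnatE ?pF // (pcharf_prime pF).
have nL : [pchar L].-nat q by rewrite qE pnatX pnatE ?pL // (pcharf_prime pL).
have qsub (R : fieldType) (x z : R) : [pchar R].-nat q -> (x - z) ^+ q = x ^+ q - z ^+ q.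
  by move=> nR; apply/eqP; rewrite eq_sym subr_eq -exprDn_pchar // subrK.
have qroot (c : L) : exists d, d ^+ q = c.
  have qinj : injective (fun d : L => d ^+ q).
    move=> x z /eqP; rewrite -subr_eq0 -qsub // expf_eq0 q0 subr_eq0 => /eqP.
    by [].
  by have /codomP [d ->] := injF_onto qinj c; exists d.
exists v; split=> [|P|z vz0].
- by rewrite -(pevalX iota t) -(eval2C iota t y); exact: RvF.
- rewrite -(eval2C iota t y) -(eval2C phi a b); split=> [vP|]; last exact: vL.
  apply/eqP; apply: contraT => P0; move: vP; rewrite vgeE ?unit0 //.
  exact: eval2_neq0.
have [->|z0] := eqVneq z 0.
  by exists 0; rewrite peval0 subr0; exact: vge0.
have [c c0 [P PE]] := Hq z.
have Tt (p' : {poly E}) : ev p' = 0 -> p' = 0 := peval_eq0 constE Nt.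
have cF0 : evF c%:P != 0 by rewrite eval2C; exact: (peval_neq0 Tt).
have PF0 : evF P != 0 by rewrite -PE mulf_neq0 ?expf_neq0 // -(eval2C iota t y).
have [N1 [P1 [s1 [P10 s10 E1]]]] := normal _ (local_ring_eval P) PF0.
have [N2 [P2 [s2 [P20 s20 E2]]]] := normal _ (local_ring_eval c%:P) cF0.
have zqE : z ^+ q * (pi ^+ N2 * (evF P2 / evF s2)) = pi ^+ N1 * (evF P1 / evF s1).
  by rewrite -E1 -E2 -PE eval2C mulrC.
have nz s : evL s != 0 -> evF s != 0 := @eval2_neq0 s.
have le : (N2 <= N1)%N.
  have := congr1 (vz v) zqE.
  rewrite !vzM ?vzV ?mulf_neq0 ?invr_eq0 ?expf_neq0 ?nz // !vzX !unit0 //.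
  have : 0 <= vz v z by move: vz0; rewrite vgeE.
  move: vpi1; move: (vz v z) (vz v pi) => c' d'; rewrite (subrr 0) !addr0.
  move=> d1 c0' e; rewrite leqNgt; apply/negP => lt.
  have : d' *+ N1 < d' *+ N2 by rewrite ltr_pMn2l // (lt_le_trans _ d1).
  by rewrite ltNge -e lerDr mulrn_wge0.
(* With N2 <= N1 the power of pi cancels from the denominator, so z^q lies in the local ring and can
   be specialized at (a, b). *)
have zq : z ^+ q = evF (pi0%:P ^+ (N1 - N2) * P1 * s2) / evF (s1 * P2).
  apply: (mulIf (_ : pi ^+ N2 * (evF P2 / evF s2) != 0)).
    by rewrite !mulf_neq0 ?invr_eq0 ?expf_neq0 ?nz.
  rewrite zqE !eval2M eval2Xn eval2C -/pi -{1}(subnK le) exprD.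
  by field; rewrite !nz.
set P' := (pi0%:P ^+ (N1 - N2) * P1 * s2) in zq; set s' := s1 * P2 in zq.
have s'0 : evL s' != 0 by rewrite eval2M mulf_neq0.
clearbody P' s'.
have [d dE] := qroot (evL P' / evL s'); have [Q QE] := gen_a d.
exists Q; suff : vge v 1 ((z - ev Q) ^+ q).
  have [->|w0] := eqVneq (z - ev Q) 0; first by move=> _; exact: vge0.
  rewrite !vgeE ?expf_neq0 // vzX -!gtz0_ge1.
  by rewrite pmulrn_lgt0.
rewrite qsub // zq.
have -> : evF P' / evF s' - ev Q ^+ q = evF (P' - Q%:P ^+ q * s') / evF s'.
  by rewrite eval2B eval2M eval2Xn eval2C; field; exact: nz.
rewrite -[1]addr0; apply: vgeM; last by apply: Rv; exact: local_ring_inv.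
apply: vL; rewrite eval2B eval2M eval2Xn eval2C QE dE.
by rewrite divfK ?subrr.
Qed.

End SmoothPoint.

(** * Existence of a smooth generic point *)

(** With r = r' + 1, constraints and unknowns grow like r' l A and r l m. Taking m + 1 >= (1 -
    1/(2r)) A uses only half of the gap between r'/r and 1; the other half, with l at least 2 r' r
    H, covers the terms in H. *)
Lemma stepanov_unknowns r' H l m A : (m.+1 <= A)%N ->
  ((2 * r' + 1) * A <= 2 * (r'.+1 * m.+1))%N -> (2 * r' * r'.+1 * H <= l)%N ->
  (r' * (l * A + m + H + r' * A * H).+1 < l.+1 * r'.+1 * m.+1)%N.
Proof.
move=> mA h1 hl; have h4 : (H <= H * A)%N by rewrite leq_pmulr //; lia.
have h2 : ((l * A + m + H + r' * A * H).+1 <= A * (l.+1 + H + r' * H))%N by nia.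
have h3 : (2 * (r' * (A * (l.+1 + H + r' * H))) < l.+1 * ((2 * r' + 1) * A))%N by nia.
have h5 : (l.+1 * ((2 * r' + 1) * A) <= 2 * (l.+1 * r'.+1 * m.+1))%N by nia.
have h6 : (r' * (l * A + m + H + r' * A * H).+1 <= r' * (A * (l.+1 + H + r' * H)))%N.
  by rewrite leq_mul2l h2 orbT.
by move: h3 h5 h6; move: (r' * _)%N (r' * (A * _))%N (l.+1 * _)%N (_ * m.+1)%N; lia.
Qed.

Lemma stepanov_room r' d A : (d * (2 * r'.+1) <= A)%N ->
  ((2 * r' + 1) * A <= 2 * (r'.+1 * (A - d)))%N.
Proof. by rewrite !mulnBr => h; lia. Qed.

(** The three losses are degenerate points (2 w), zeros of D (dD) and Stepanov's count. As m = A -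
    (d + 1), the term m B leaves (d + 1) B > A B / (2r) free; all the rest is at most A (2 + dD + l
    + r' H) <= A B / (2r). *)
Lemma stepanov_budget r' A B d m dD l H w : (0 < B <= A)%N -> (w <= A)%N ->
  (A < d.+1 * (2 * r'.+1))%N -> (2 * r'.+1 * (2 + dD + l + r' * H) <= B)%N ->
  (m + d.+1 = A)%N -> (2 * w + dD + (l + m * B + r' * B * H) < A * B)%N.
Proof.
move=> /andP[B0 BA] wA dA BX mA; rewrite -[X in (_ < X * B)%N]mA mulnDl.
have A0 : (0 < A)%N by exact: leq_trans BA.
have h1 : (r' * B * H <= A * (r' * H))%N by rewrite mulnAC mulnC leq_mul2r BA orbT.
have h2 : (dD <= A * dD)%N by rewrite leq_pmull.
have h3 : (l <= A * l)%N by rewrite leq_pmull.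
have h4 : (A * (2 + dD + l + r' * H) < d.+1 * B)%N.
  rewrite -(ltn_pmul2l (isT : (0 < 2 * r'.+1)%N)) mulnCA.
  apply: leq_ltn_trans (_ : (A * B < _)%N); first by rewrite leq_mul2l BX orbT.
  by rewrite mulnA [(_ * d.+1)%N]mulnC ltn_pmul2r.
move: h4; rewrite !mulnDr; move: h1 h2 h3.
move: (A * (r' * H))%N => e1; move: (A * dD)%N => e2; move: (A * l)%N => e3.
by move: (r' * B * H)%N => e4; move: (m * B)%N (d.+1 * B)%N => e5 e6; clear -wA; lia.
Qed.

Section StepanovCount.
Variables (k0 : fieldType) (E : finFieldType) (F : fieldType).
Variables (j : {rmorphism k0 -> F}) (iota : {rmorphism E -> F}).
Hypothesis constE : constants j = range iota.
Hypothesis Hfin : forall x, exists N, forall n (u : 'I_n -> F), xfree iota x u -> (n <= N)%N.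
Variables (t y : F) (f : {poly {poly E}}) (r' H rt eta : nat).
Local Notation r := r'.+1.
Hypothesis Nt : ~ constants j t.
Hypothesis Hrt : xdeg iota t rt.
Hypothesis yeta : poleb j t eta y.
Hypothesis model : plane_model iota t y f r H.
Variables (L : finFieldType) (phi : {rmorphism E -> L}) (a b : nat).
Local Notation A := (#|E| ^ a)%N.
Local Notation B := (#|E| ^ b)%N.
Hypothesis cardL : #|L| = (#|E| ^ (a + b))%N.
Local Close Scope classical_set_scope.

Lemma eval2_stepanov_poly l m (c : nat -> nat -> nat -> nat -> E) :
  eval2 iota t y (stepanov_poly r' b l m c) =
    \sum_(k < r) \sum_(h < m.+1) \sum_(i < r) \sum_(e < l.+1)
      iota (c e i h k) * t ^+ (e + h * B) * y ^+ (i + k * B).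
Proof.
rewrite /stepanov_poly rmorph_sum; apply: eq_bigr => k _.
rewrite rmorph_sum; apply: eq_bigr => h _; rewrite rmorph_sum; apply: eq_bigr => i _.
rewrite rmorph_sum; apply: eq_bigr => e _.
by rewrite /= -mul_polyC eval2M eval2C eval2Xn eval2X pevalM pevalC pevalXn.
Qed.

Lemma stepanov_count l m (Z : {set L}) :
  (r' * (l * A + m + H + r' * A * H).+1 < l.+1 * r * m.+1)%N ->
  (2 * r * (l.+1 + r * eta) * rt < B)%N ->
  (forall z, z \in Z -> separable_poly (map_poly (peval phi z) f) /\
     forall x, ~~ root (map_poly (peval phi z) f) x) ->
  (#|Z| <= l + m * B + r' * B * H)%N.
Proof.
move=> C1 C2 HZ; have [szf fm fH fy fmin] := model.
have [c [c0 cc]] := stepanov_coefficients fm szf fH cardL C1.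
pose G := stepanov_poly r' b l m c; pose R := Pdiv.Ring.rmodp G f.
have GF : eval2 iota t y G != 0.
  by rewrite eval2_stepanov_poly; apply: (nonvanishing_sum constE Hfin Nt fm szf fy fmin Hrt yeta C2).
have R0 : R != 0.
  apply: contraNneq GF => R0; rewrite (Pdiv.RingMonic.rdivp_eq fm G) -/R R0 addr0 eval2M.
  by rewrite [eval2 _ _ _ f]fy mulr0.
have : lead_coef R != 0 by rewrite lead_coef_eq0.
rewrite lead_coefE; set i := (size R).-1 => Ri0.
have szR : (size (R`_i)%R <= (l + m * B + r' * B * H).+1)%N.
  apply: (rem_bound fm szf fH (n := (r' * B)%N)); last first.
    exact: (stepanov_poly_bounded l m fm szf cardL).
  by apply: leq_trans (size_stepanov_poly l m fm szf cardL c) _; rewrite addSn.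
have P0 : map_poly phi R`_i != 0 by rewrite map_poly_eq0.
rewrite -ltnS; apply: leq_trans szR; rewrite -(size_map_poly phi) cardE.
apply: (max_poly_roots P0 _ (enum_uniq _)).
apply/allP => z; rewrite mem_enum => /HZ [sz rz]; rewrite rootE; apply/eqP.
exact: (stepanov_vanishing fm szf cardL sz rz cc).
Qed.

Variables (k1 : finFieldType) (psi : {rmorphism k1 -> L}) (N : nat).
Hypothesis N0 : (0 < N)%N.
Hypothesis cardLN : #|L| = (#|k1| ^ N)%N.
Hypothesis ab : (b <= a)%N.
Hypothesis halfN : (#|k1| ^ N./2 <= A)%N.
Variables (D : {poly E}) (u v : {poly {poly E}}) (dD : nat).
Hypotheses (D0 : D != 0) (szD : (size D <= dD.+1)%N) (DE : D%:P = u * f + v * f^`()).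
Let l := (2 * r' * r * H)%N.
Hypothesis B1 : (2 * r * (l.+1 + r * eta) * rt < B)%N.
Hypothesis B2 : (2 * r * (2 + dD + l + r' * H) <= B)%N.

Lemma smooth_generic_point : exists x z : L,
  [/\ ~~ degenerate k1 N x, eval2 phi x z f = 0 & eval2 phi x z f^`() != 0].
Proof.
have E1 : (0 < #|E|)%N by exact: ltnW (finNzRing_gt1 E).
have A0 : (0 < A)%N by rewrite expn_gt0 E1.
have BA : (B <= A)%N by rewrite leq_pexp2l.
pose m := (A - A %/ (2 * r)).-1.
have dA := divn_eq A (2 * r); have rA := ltn_pmod A (isT : 0 < 2 * r)%N.
have mE : (m.+1 = A - A %/ (2 * r))%N.
  by rewrite /m prednK // subn_gt0 ltn_Pdiv // mulnS.
have C1 : (r' * (l * A + m + H + r' * A * H).+1 < l.+1 * r * m.+1)%N.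
  apply: stepanov_unknowns => //; first by rewrite mE leq_subr.
  by rewrite mE; apply: stepanov_room; exact: leq_trunc_div.
pose Z := [set z : L | (peval phi z D != 0) && [forall x, ~~ root (map_poly (peval phi z) f) x]]%SET.
have specD z : (peval phi z D)%:P = map_poly (peval phi z) u * map_poly (peval phi z) f +
    map_poly (peval phi z) v * (map_poly (peval phi z) f)^`().
  have := congr1 (map_poly (peval phi z)) DE.
  by rewrite rmorphD !rmorphM /= map_polyC /= deriv_map.
have HZ z : z \in Z -> separable_poly (map_poly (peval phi z) f) /\
    forall x, ~~ root (map_poly (peval phi z) f) x.
  rewrite inE => /andP[Dz /forallP Hz]; split=> //.
  rewrite unlock; apply/Bezout_coprimepP.
  exists (map_poly (peval phi z) u, map_poly (peval phi z) v).
  by rewrite /= -specD polyC_eqp1.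
have cZ := stepanov_count C1 B1 HZ.
pose RD := [set z : L | peval phi z D == 0]%SET.
have cD : (#|RD| <= dD)%N.
  rewrite -ltnS; apply: leq_trans szD; rewrite -(size_map_poly phi) cardE.
  apply: max_poly_roots (enum_uniq _); first by rewrite map_poly_eq0.
  by apply/allP => z; rewrite mem_enum inE rootE.
have cN := card_degenerate cardLN N0.
have lt : (#|[set x : L | degenerate k1 N x]%SET :|: RD :|: Z| < #|L|)%N.
  have cU (X Y : {set L}) : (#|(X :|: Y)%SET| <= #|X| + #|Y|)%N by rewrite cardsU leq_subr.
  apply: leq_ltn_trans (cU _ _) _.
  apply: leq_ltn_trans (leq_add (leq_trans (cU _ _) (leq_add cN cD)) cZ) _.
  rewrite cardL expnD.
  apply: (stepanov_budget (d := (A %/ (2 * r))%N) _ halfN) => //; first by rewrite BA expn_gt0 E1.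
    by rewrite mulSn addnC [X in (X < _)%N]dA ltn_add2l.
  by rewrite addnS -addSn mE subnK // leq_div.
have /subsetPn [x _ nx] : ~~ ([set: L] \subset ([set x : L | degenerate k1 N x] :|: RD :|: Z))%SET.
  by apply/negP => /subset_leq_card; rewrite cardsT leqNgt lt.
move: nx; rewrite !inE !negb_or => /andP[/andP[nd Dx]]; rewrite Dx /= negb_forall.
move=> /existsP [z]; rewrite negbK => /eqP fz; exists x, z; split=> //.
apply: contraNneq Dx => f'z.
have := congr1 (eval2 phi x z) DE; rewrite eval2D !eval2M eval2C f'z mulr0 addr0.
by rewrite [eval2 _ _ _ f]fz mulr0 => ->.
Qed.

Local Open Scope classical_set_scope.
End StepanovCount.

(** This dictates the degree n' = g + 2 (c + 1): in the exponent n' / 2, the part g / 2 + 1 absorbs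
    the factor g + 1 and the remaining c absorbs c. *)
Lemma half_exp_bound G c : (G.+1 * c < 2 ^ (G + 2 * c.+1)./2)%N.
Proof.
have -> : (G + 2 * c.+1)./2 = (G./2 + c.+1)%N by rewrite mul2n halfD odd_double andbF doubleK.
have h1 : (c < 2 ^ c)%N by exact: ltn_expl.
have h2 : (G.+1 <= 2 ^ (G./2).+1)%N.
  have h3 : (G./2 < 2 ^ G./2)%N by exact: ltn_expl.
  by rewrite expnS -[X in (X.+1 <= _)%N](odd_double_half G); move: h3 (leq_b1 (odd G)); lia.
rewrite -addSnnS expnD; apply: leq_ltn_trans (_ : (2 ^ (G./2).+1 * c < _)%N).
  by rewrite leq_mul2r h2 orbT.
by rewrite ltn_pmul2l ?expn_gt0.
Qed.

(* Here e bounds eta / (g + 1) and h bounds H / (g + 1); the two summands make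
   #|E| ^ (n' / 2) large enough for the two inequalities required by
   smooth_generic_point. *)
Definition stepanov_constant (p d : nat) : nat :=
  let e := (p ^ d + 2 * d * d)%N in let h := (d * d * d * e)%N in
  (2 * d * d * (2 * d * d * h + 1 + d * (d * d + 1) * e) +
   2 * d * (2 + 2 * d * h + 2 * d * d * h + d * h))%N.

Lemma stepanov_constant_bound p d r rt G : (0 < p)%N -> (0 < r <= rt)%N -> (rt <= d)%N ->
  let eta := (p ^ rt * G.+1 + 2 * rt * rt)%N in
  let H := (r * (r * r * eta))%N in let l := (2 * r.-1 * r * H)%N in
  (2 * r * (l.+1 + r * (r * r * eta + eta)) * rt <= G.+1 * stepanov_constant p d)%N /\
  (2 * r * (2 + 2 * r * H + l + r.-1 * H) <= G.+1 * stepanov_constant p d)%N.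
Proof.
move=> p0 /andP[r0 rrt] rtd eta H l; rewrite /stepanov_constant.
set e := (p ^ d + _)%N; set h := (d * d * d * e)%N.
have rd : (r <= d)%N by exact: leq_trans rtd.
have r'd : (r.-1 <= d)%N by exact: leq_trans (leq_pred r) rd.
have He : (eta <= G.+1 * e)%N.
  rewrite /eta /e mulnDr leq_add //; first by rewrite mulnC leq_mul2l leq_pexp2l.
  by apply: leq_trans (leq_pmull _ _) => //; rewrite -!mulnA leq_mul2l /= leq_mul.
have HH : (H <= G.+1 * h)%N.
  have -> : (G.+1 * h = d * (d * d * (G.+1 * e)))%N by rewrite /h; ring.
  exact: leq_mul rd (leq_mul (leq_mul rd rd) He).
have Hl : (l <= G.+1 * (2 * d * d * h))%N.
  rewrite /l; apply: leq_trans (leq_mul (leq_mul (leq_mul (leqnn 2) r'd) rd) HH) _.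
  by rewrite mulnCA.
have g1 : (1 <= G.+1)%N by [].
move: (G.+1) He HH Hl g1 => g He HH Hl g1; split.
  have h1 : (l.+1 + r * (r * r * eta + eta) <= g * (2 * d * d * h + 1 + d * (d * d + 1) * e))%N.
    have h2 : (r * (r * r * eta + eta) <= g * (d * (d * d + 1) * e))%N.
      have -> : (r * (r * r * eta + eta) = (r * (r * r + 1)) * eta)%N by ring.
      rewrite [(g * _)%N]mulnCA; apply: leq_mul He; apply: leq_mul => //.
      by rewrite leq_add2r leq_mul.
    rewrite [X in (_ <= X)%N]mulnDr leq_add // [X in (_ <= X)%N]mulnDr muln1 -addn1 leq_add //.
  rewrite [X in (_ <= X)%N]mulnDr; apply: leq_trans (leq_addr _ _).
  move: h1; set W := (_ + _ + _)%N; move=> h1.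
  have -> : (g * (2 * d * d * W) = 2 * d * (g * W) * d)%N by ring.
  by apply: leq_mul rtd; apply: leq_mul h1; rewrite leq_mul2l rd orbT.
rewrite [(g * _)%N]mulnDr; apply: leq_trans (leq_addl _ _).
rewrite mulnCA; apply: leq_mul; first by rewrite leq_mul2l rd.
rewrite !mulnDr; apply: leq_add; last by rewrite mulnCA leq_mul.
apply: leq_add => //; apply: leq_add; first by rewrite leq_pmull.
by rewrite mulnCA; apply: leq_mul => //; rewrite leq_mul2l rd.
Qed.

Section SpecialPlace.
Variables (k0 E : finFieldType) (F : fieldType).
Variables (j : {rmorphism k0 -> F}) (iota : {rmorphism E -> F}) (iota0 : {rmorphism k0 -> E}).
Hypothesis constE : constants j = range iota.
Hypothesis Hfin : forall x, exists N, forall n (u : 'I_n -> F), xfree iota x u -> (n <= N)%N.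
Hypothesis jE : forall c, j c = iota (iota0 c).
Variables (t : F) (rt d m p : nat).
Hypothesis Nt : ~ constants j t.
Hypothesis Hrt : xdeg iota t rt.
Hypothesis rtd : (rt <= d)%N.
Hypothesis cardE : #|E| = (#|k0| ^ m)%N.
Hypothesis pk0 : p \in [pchar k0].
Local Notation G := `|genus j|%N.
Local Notation n' := (G + 2 * (stepanov_constant p d).+1)%N.

(* The powers t^i, i < m n', are independent over k0 in the residue field. *)
Lemma special_place : exists v : place j, [/\ pdeg v = n', vge v 0 t &
  forall P : {poly k0}, P != 0 -> (size P <= m * n')%N -> ~ vge v 1 (peval j t P)].
Proof.
have HC := constants_subfield j.
have pF : p \in [pchar F] by rewrite (fmorph_pchar j).
have p0 : (0 < p)%N by rewrite prime_gt0 // (pcharf_prime pk0).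
have [r [y [f [rrt Py model [D [u [w [D0 szD DE]]]] Hz]]]] :=
  small_equation constE Hfin Nt Hrt pF.
have [] := stepanov_constant_bound G p0 rrt rtd.
case: r rrt Py model szD => // r' rrt Py model szD bd1 bd2.
have E1 : (1 < #|E|)%N by exact: finNzRing_gt1.
have m0 : (0 < m)%N by rewrite lt0n; apply: contraTneq E1 => m0; rewrite cardE m0 expn0.
have n'0 : (0 < n')%N by rewrite addnS.
have N0 : (0 < m * n')%N by rewrite muln_gt0 m0.
have [L [phi cardL]] := finite_extension_exists E n'0.
have bigB : (G.+1 * stepanov_constant p d < #|E| ^ n'./2)%N.
  by apply: leq_trans (half_exp_bound _ _) _; rewrite leq_exp2r // half_gt0 mulnS addnC.
(* A takes the upper and B the lower half of n', so that AB = |L| and B <= A; A also dominates the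
   bound for degenerate elements. *)
have cardL' : #|L| = (#|E| ^ (uphalf n' + n'./2))%N by rewrite uphalf_half -addnA addnn odd_double_half.
have hu : (n'./2 <= uphalf n')%N by rewrite uphalf_half leq_addl.
have halfN : (#|k0| ^ (m * n')./2 <= #|E| ^ uphalf n')%N.
  rewrite cardE -expnM leq_exp2l ?finNzRing_gt1 // leq_half_double leqW //.
  by rewrite -muln2 -mulnA muln2 uphalfK leq_mul2l leq_addl orbT.
have cardLN : #|L| = (#|k0| ^ (m * n'))%N by rewrite cardL cardE -expnM.
have [x [z [nd fxz dfxz]]] := smooth_generic_point constE Hfin Nt Hrt Py model phi cardL' N0 cardLN
  hu halfN D0 szD DE (leq_ltn_trans bd1 bigB) (ltnW (leq_ltn_trans bd2 bigB)).
(* Nondegeneracy over k0 passes to E: the exponent #|E|^i is #|k0|^(m i), and i <= n' / 2 gives m i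
   <= m n' / 2. *)
have ndE : ~~ degenerate E n' x.
  apply: contra nd => /existsP [i xi].
  have im : ((m * i.+1).-1 < (m * n')./2)%N.
    by rewrite prednK ?muln_gt0 ?m0 // geq_half_double doubleMr leq_mul2l -geq_half_double ltn_ord orbT.
  apply/existsP; exists (Ordinal im); rewrite /= prednK ?muln_gt0 ?m0 //.
  by rewrite expnM -cardE.
have rootE_size P : P != 0 -> peval phi x P = 0 -> (n' < size P)%N.
  exact: (generic_root_size (psi := phi) cardL n'0 ndE).
pose ps (c : {ffun 'I_n' -> E}) : {poly E} := \poly_(i < n') oapp c 0 (insub i).
have ps_coef c (i : 'I_n') : (ps c)`_i = c i by rewrite coef_poly ltn_ord valK.
have gen' z' : exists c, peval phi x (ps c) = z'.
  have inj : injective (fun c => peval phi x (ps c)).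
    move=> c1 c2 /eqP; rewrite -subr_eq0 -pevalN -pevalD => /eqP e.
    have e0 : ps c1 - ps c2 = 0.
      apply/eqP; apply: contraT => n0; have := rootE_size _ n0 e.
      rewrite ltnNge (leq_trans (size_polyD _ _)) // size_polyN geq_max.
      by rewrite !size_poly.
    apply/ffunP => i; apply/eqP; rewrite -subr_eq0 -!ps_coef -coefB e0 coef0.
    by [].
  have [|g _ gK] := inj_card_bij inj; first by rewrite card_ffun card_ord cardL.
  by exists (g z').
have gen z' : exists P, peval phi x P = z' by have [c <-] := gen' z'; exists (ps c).
have [v [vt vker vres]] := place_at_point constE Hfin Nt model fxz dfxz gen pF erefl Hz.
exists v; split=> // [|P P0 szP].
  apply: (hd_uniq HC (vge_subspace v 1) (pdegP constE Hfin v).1).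
  exists (fun i => t ^+ i); split=> [i|c Cc|z' vz'].
  - by have := vgeX i vt; rewrite mul0rn.
  - have /choice [e He] : forall i, exists e, iota e = c i.
      by move=> i; have := Cc i; rewrite constE => -[e _ <-]; exists e.
    have psE : \sum_i c i * t ^+ i = peval iota t (ps [ffun i => e i]).
      have sp : (size (map_poly iota (ps [ffun i => e i])) <= n')%N by rewrite size_map_poly size_poly.
      rewrite /peval (horner_coef_wide _ sp); apply: eq_bigr => i _.
      by rewrite coef_map ps_coef ffunE /= He.
    rewrite psE => /vker e0 i; rewrite -He; have -> : e i = (ps [ffun i => e i])`_i by rewrite ps_coef ffunE.
    suff -> : ps [ffun i => e i] = 0 by rewrite coef0; exact: rmorph0.
    apply/eqP; apply: contraT => n0; have := rootE_size _ n0 e0.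
    by rewrite ltnNge size_poly.
  - have [P vP] := vres _ vz'; have [c cE] := gen' (peval phi x P).
    exists (fun i => iota (c i)); split=> [i|]; first exact: constants_iota constE _.
    have -> : \sum_i iota (c i) * t ^+ i = peval iota t (ps c).
      have sp : (size (map_poly iota (ps c)) <= n')%N by rewrite size_map_poly size_poly.
      rewrite /peval (horner_coef_wide _ sp); apply: eq_bigr => i _.
      by rewrite coef_map ps_coef.
    have -> : z' - peval iota t (ps c) = (z' - peval iota t P) + peval iota t (P - ps c).
      by rewrite pevalD pevalN; ring.
    apply: vgeD => //; apply/vker; rewrite pevalD pevalN cE subrr.
    by [].
have -> : peval j t P = peval iota t (map_poly iota0 P).
  by rewrite /peval -map_poly_comp; congr (_.[t]); apply: eq_map_poly => c; exact: jE.
move=> /vker; rewrite /peval -map_poly_comp => Px.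
have := generic_root_size cardLN N0 nd P0 (psi := phi \o iota0) Px.
by rewrite ltnNge szP.
Qed.

End SpecialPlace.

(** * The field of constants *)

Section FiniteAlias.
Variables (T : fieldType) (A : finType) (e : T -> A) (g : A -> T).

Definition fin_alias of cancel e g : Type := T.

Variable eK : cancel e g.
HB.instance Definition _ := GRing.Field.on (fin_alias eK).
HB.instance Definition _ : isCountable (fin_alias eK) := CanIsCountable eK.
HB.instance Definition _ : isFinite (fin_alias eK) := @CanIsFinite (fin_alias eK) A e g eK.

Definition fin_field : finFieldType := fin_alias eK.
Definition fin_field_val : {rmorphism fin_field -> T} := idfun.

End FiniteAlias.

Lemma steinitz_fin (F : fieldType) (S : set F) (HS : subfield_set S) (I J : finType)
    (b : I -> F) (w : J -> F) :
  (forall i, exists2 c : J -> F, forall h, S (c h) & b i = \sum_h c h * w h) ->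
  (forall c : I -> F, (forall i, S (c i)) -> \sum_i c i * b i = 0 -> forall i, c i = 0) ->
  (#|I| <= #|J|)%N.
Proof.
move=> Hb fb; have sumE (K : finType) (x : K -> F) : \sum_(k : K) x k = \sum_(i < #|K|) x (enum_val i).
  by rewrite -(big_enum_val (A := K) x); apply: eq_bigl => k.
apply: (steinitz HS (subspace_set0 S) (b := fun h => w (enum_val h)) (u := fun i => b (enum_val i))).
  move=> i; have [c Sc ->] := Hb (enum_val i); exists (fun h => c (enum_val h)); split=> //.
  by rewrite sumE subrr.
split=> // c Sc c0 i.
have := fb (fun x => c (enum_rank x)) (fun x => Sc _); rewrite sumE => H.
have := H _ (enum_val i); rewrite enum_valK; apply.
by rewrite -[RHS]c0; apply: eq_bigr => h _; rewrite enum_valK.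
Qed.

Section FiniteOverRational.
Variables (k0 F : fieldType) (j : {rmorphism k0 -> F}) (t : F) (T : finType) (e : T -> F).
Hypothesis Tt : forall p : {poly k0}, peval j t p = 0 -> p = 0.
Hypothesis span : forall z, exists2 s : T -> F, forall h, ratfield j t (s h) & z = \sum_h s h * e h.
Local Notation ev := (peval j t).

Lemma range_subfield : subfield_set (range j).
Proof.
split; first by exists 1; rewrite ?rmorph1.
  by move=> _ _ [a _ <-] [b _ <-]; exists (a - b); rewrite ?rmorphB.
by move=> _ _ [a _ <-] [b _ <-]; exists (a / b); rewrite ?fmorph_div.
Qed.

Lemma xfree_span n (u : 'I_n -> F) : xfree j t u -> (n <= #|T|)%N.
Proof.
move=> /(xfree_ratfield Tt) [_ fu]; rewrite -[n]card_ord.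
exact: (steinitz_fin (ratfield_subfield j t) (b := u) (w := e)).
Qed.

(** A filtration by degree in t that does not refer to places: it yields the finiteness statement on
    which their theory rests here. *)
Definition deg_span (s : nat) : set F := [set z | exists2 Q : T -> {poly k0},
  forall h, (size (Q h) <= s.+1)%N & z = \sum_h ev (Q h) * e h].

Lemma deg_span_sum s I (r : seq I) (Q : pred I) (z : I -> F) :
  (forall i, Q i -> deg_span s (z i)) -> deg_span s (\sum_(i <- r | Q i) z i).
Proof.
move=> Hz; elim/big_rec: _ => [|i x /Hz [Q1 s1 ->] [Q2 s2 ->]].
  by exists (fun=> 0) => [h|]; [rewrite size_poly0|rewrite big1 // => h _; rewrite peval0 mul0r].
exists (fun h => Q1 h + Q2 h) => [h|].
  by apply: leq_trans (size_polyD _ _) _; rewrite geq_max s1 s2.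
by rewrite -big_split; apply: eq_bigr => h _; rewrite pevalD mulrDl.
Qed.

Lemma deg_span_mul s d (q : {poly k0}) z : (size q <= d.+1)%N -> deg_span s z ->
  deg_span (s + d) (ev q * z).
Proof.
move=> sq [Q sQ ->]; exists (fun h => q * Q h) => [h|].
  by rewrite addnC; exact: size_mul_leq_add.
by rewrite mulr_sumr; apply: eq_bigr => h _; rewrite pevalM mulrA.
Qed.

Lemma clear_span (I : finType) (z : I -> F) : exists2 c : {poly k0}, c != 0 &
  exists s, (size c <= s.+1)%N /\ forall i, deg_span s (ev c * z i).
Proof.
have /choice [s Hs] : forall i, exists s : T -> F, (forall h, ratfield j t (s h)) /\ z i = \sum_h s h * e h.
  by move=> i; have [s Ss zE] := span (z i); exists s.
pose c0 (k : 'I_#|{: I * T}|) := s (enum_val k).1 (enum_val k).2.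
have [q q0 [p pE]] := ratfield_denominator (iota := j) (t := t) (c := c0) (fun k => (Hs _).1 _).
pose N := (\max_k size (p k) + size q)%N; exists q => //; exists N; split.
  by rewrite /N; lia.
move=> i; exists (fun h => p (enum_rank (i, h))) => [h|].
  by have := leq_bigmax (F := fun k => size (p k)) (enum_rank (i, h)); rewrite /N; move: (\max_k _)%N; lia.
rewrite (Hs i).2 mulr_sumr; apply: eq_bigr => h _.
by rewrite -pE /c0 enum_rankK mulrA.
Qed.

(* For a suitable c, the elements c^M x^i u, i <= M, have degree at most M s +
   O(1) in t; comparing dimensions over k0 as M grows bounds the number of
   independent u. *)
Lemma finite_over_any x : exists N, forall n (u : 'I_n -> F), xfree j x u -> (n <= N)%N.
Proof.
have [c c0 [s [sc sx]]] := clear_span (fun h => x * e h).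
have cF := peval_neq0 Tt c0.
have step d z : deg_span d z -> deg_span (d + s) (ev c * x * z).
  move=> [Q sQ ->]; rewrite mulr_sumr; apply: deg_span_sum => h _.
  have -> : ev c * x * (ev (Q h) * e h) = ev (Q h) * (ev c * (x * e h)) by ring.
  by rewrite addnC; exact: deg_span_mul (sQ h) (sx h).
have steps d z M i : (i <= M)%N -> deg_span d z -> deg_span (d + M * s) (ev c ^+ M * x ^+ i * z).
  elim: M i => [|M IH] i; first by rewrite leqn0 => /eqP ->; rewrite !expr0 !mul1r addn0.
  case: i => [_|i iM] dz.
    rewrite expr0 mulr1 exprS -mulrA mulSn addnCA addnC.
    by apply: deg_span_mul => //; rewrite -[_ ^+ M]mulr1 -(expr0 x); exact: IH.
  rewrite !exprS mulSn addnCA addnC.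
  have -> : ev c * ev c ^+ M * (x * x ^+ i) * z = ev c * x * (ev c ^+ M * x ^+ i * z) by ring.
  by apply: step; exact: IH.
exists (#|T| * s)%N => n u fu.
have [c1 c1_0 [s1 [_ su]]] := clear_span u.
have c1F := peval_neq0 Tt c1_0.
(* This M compensates the part |T| (s1 + 1) of the size of J that does not grow with M. *)
rewrite leqNgt; apply/negP => ln; pose M := (#|T| * s1.+1)%N.
pose I := ('I_M.+1 * 'I_n)%type; pose J := (T * 'I_(s1 + M * s).+1)%type.
pose b (i : I) := ev c ^+ M * x ^+ i.1 * (ev c1 * u i.2).
pose w (h : J) := t ^+ h.2 * e h.1.
have : (#|{: I}| <= #|{: J}|)%N.
  apply: (steinitz_fin range_subfield (b := b) (w := w)) => [i|a Sa ab].
    have [Q sQ ->] : deg_span (s1 + M * s) (b i) by apply: steps (su _); rewrite -ltnS.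
    exists (fun h : J => j (Q h.1)`_h.2) => [h|]; first by exists (Q h.1)`_h.2.
    rewrite (eq_bigr (fun h : J => j (Q h.1)`_h.2 * w (h.1, h.2))); last by case.
    rewrite -(pair_bigA _ (fun h (k : 'I_(s1 + M * s).+1) => j (Q h)`_k * w (h, k))) /=; apply: eq_bigr => h _.
    rewrite /peval (horner_coef_wide (n := (s1 + M * s).+1)) ?size_map_poly // mulr_suml.
    by apply: eq_bigr => k _; rewrite coef_map mulrA.
  have /choice [a' Ha'] : forall i, exists c' : k0, j c' = a i by move=> i; case: (Sa i) => c' _ <-; exists c'.
  pose P l := \poly_(i < M.+1) a' (inord i, l).
  have P0 l : P l = 0.
    apply: fu; apply: (mulfI (mulf_neq0 (expf_neq0 M cF) c1F)); rewrite mulr0 -[RHS]ab mulr_sumr.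
    rewrite (eq_bigr (fun x : I => a (x.1, x.2) * b (x.1, x.2))); last by case.
    rewrite -(pair_bigA _ (fun i l => a (i, l) * b (i, l))) exchange_big; apply: eq_bigr => h _.
    have -> : peval j x (P h) = \sum_(k < M.+1) a (k, h) * x ^+ k.
      rewrite /peval (horner_coef_wide (n := M.+1)) ?size_map_poly ?size_poly //.
      by apply: eq_bigr => k _; rewrite coef_map coef_poly ltn_ord inord_val /= Ha'.
    by rewrite mulr_suml mulr_sumr; apply: eq_bigr => k _; rewrite /b /=; ring.
  move=> [i l]; rewrite -Ha'; have /polyP/(_ i) := P0 l.
  by rewrite coef_poly ltn_ord inord_val coef0 => ->; rewrite rmorph0.
rewrite !card_prod !card_ord => le.
have : (M.+1 * (#|T| * s).+1 <= M.+1 * n)%N by rewrite leq_mul2l ln orbT.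
move: le; rewrite /M; move: (#|T|) => T'; move: (M.+1 * n)%N; nia.
Qed.

End FiniteOverRational.

Section FactorMorphism.
Variables (A B F : fieldType) (j : {rmorphism A -> F}) (iota : {rmorphism B -> F}).
Variables (h : A -> B) (hE : forall c, iota (h c) = j c).

(** h is produced by choice; injectivity of [iota] makes it a morphism. The equation is an argument
    so that the instances can be inferred. *)
Definition factor_morphism of forall c, iota (h c) = j c := h.

Lemma factor_nmod : nmod_morphism (factor_morphism hE).
Proof.
by split=> [|x y]; apply: (fmorph_inj iota); rewrite /factor_morphism ?rmorphD !hE ?rmorph0 ?rmorphD.
Qed.

Lemma factor_monoid : monoid_morphism (factor_morphism hE).
Proof.
by split=> [|x y]; apply: (fmorph_inj iota); rewrite /factor_morphism ?rmorphM !hE ?rmorph1 ?rmorphM.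
Qed.

HB.instance Definition _ := GRing.isNmodMorphism.Build _ _ (factor_morphism hE) factor_nmod.
HB.instance Definition _ := GRing.isMonoidMorphism.Build _ _ (factor_morphism hE) factor_monoid.

End FactorMorphism.

Lemma sfval_lift (F : fieldType) (S : set F) (HS : subfield_set S) x : S x ->
  exists y : sftype HS, sfval HS y = x.
Proof.
move=> Sx; have : range (sfval HS) x by rewrite sfval_range.
by move=> [y _ <-]; exists y.
Qed.

Section FiniteConstants.
Variables (k0 : finFieldType) (F : fieldType) (j : {rmorphism k0 -> F}) (t : F) (T : finType) (e : T -> F).
Hypothesis Nt : ~ constants j t.
Hypothesis span : forall z, exists2 s : T -> F, forall h, ratfield j t (s h) & z = \sum_h s h * e h.
Local Notation C := (constants j).
Let HC : subfield_set C := constants_subfield j.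
Let HR : subfield_set (range j) := range_subfield j.

Lemma range_constants c : C (j c).
Proof.
exists ('X - c%:P); first by rewrite polyXsubC_eq0.
by rewrite rootE rmorphB /= map_polyX map_polyC hornerXsubC subrr.
Qed.

Lemma transcendental (p : {poly k0}) : peval j t p = 0 -> p = 0.
Proof.
move=> pt; apply/eqP; apply: contraT => p0; case: Nt; exists p => //.
by rewrite rootE; apply/eqP.
Qed.

(* A relation over k0[t] is a polynomial with coefficients in C vanishing at t,
   which is transcendental over C. *)
Lemma constants_xfree n (c : 'I_n -> F) : free_family (range j) C [set 0] c -> xfree j t c.
Proof.
move=> [Cc fc] p eqp i; pose N := (\max_i size (p i))%N.
have sN l : (size (p l) <= N)%N by exact: leq_bigmax.
have constE' : constants j = range (sfval HC) by rewrite sfval_range.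
have /choice [q qE] : forall l : nat, exists q : sftype HC, sfval HC q = \sum_i j (p i)`_l * c i.
  move=> l; apply: sfval_lift; apply: (subring_sum (subfield_subring HC)) => h _.
  by apply: (subfieldM HC) => //; exact: range_constants.
have Q0 : \poly_(l < N) q l = 0.
  apply: (peval_eq0 constE' Nt).
  rewrite /peval (horner_coef_wide (n := N)) ?size_map_poly ?size_poly //.
  rewrite -[RHS]eqp (eq_bigr (fun l : 'I_N => \sum_h j (p h)`_l * c h * t ^+ l)).
    rewrite exchange_big; apply: eq_bigr => h _ /=.
    rewrite /peval (horner_coef_wide (n := N)) ?size_map_poly // mulr_suml.
    by apply: eq_bigr => l _; rewrite coef_map mulrAC.
  move=> l _; transitivity (sfval HC (q l) * t ^+ l); last by rewrite qE mulr_suml.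
  by rewrite coef_map coef_poly ltn_ord.
apply/polyP => l; rewrite coef0; have [lN|] := ltnP l N; last first.
  by move=> Nl; rewrite nth_default // (leq_trans (sN i)).
apply: (fmorph_inj j); rewrite rmorph0.
apply: (fc (fun i => j (p i)`_l)) => [h|]; first by exists (p h)`_l.
have /polyP/(_ l) := Q0; rewrite coef_poly lN coef0 => q0.
by have := qE l; rewrite q0 => <-; exact: rmorph0.
Qed.

Lemma constants_dim : exists2 m, (m <= #|T|)%N & has_dim (range j) C [set 0] m.
Proof.
apply: (hd_exists HR (subspace_set0 _)) => m [c fc].
exact: (xfree_span transcendental span (constants_xfree fc)).
Qed.

(** Coordinates in a basis identify the constants with k0^m; finiteness and cardinality are
    transported along this bijection. *)
Lemma constant_field m : has_dim (range j) C [set 0] m ->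
  exists (E : finFieldType) (iota : {rmorphism E -> F}) (iota0 : {rmorphism k0 -> E}),
    [/\ C = range iota, forall c, j c = iota (iota0 c) & #|E| = (#|k0| ^ m)%N].
Proof.
move=> [b [Cb fb gb]].
have /choice [g gE] : forall c : {ffun 'I_m -> k0}, exists y : sftype HC,
    sfval HC y = \sum_i j (c i) * b i.
  move=> c; apply: sfval_lift; apply: (subring_sum (subfield_subring HC)) => h _.
  by apply: (subfieldM HC) => //; exact: range_constants.
have /choice [co coK] : forall y : sftype HC, exists c, g c = y.
  move=> y; have [c [Sc cE]] := gb _ (sfval_in y).
  have /choice [c' c'E] : forall i, exists c', j c' = c i.
    by move=> i; case: (Sc i) => c' _ <-; exists c'.
  exists [ffun i => c' i]; apply: (fmorph_inj (sfval HC)); rewrite gE.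
  apply/esym/eqP; rewrite -subr_eq0 -[X in _ == X]cE; apply/eqP; congr (_ - _).
  by apply: eq_bigr => i _; rewrite ffunE c'E.
pose E := fin_field (coK : cancel co g).
pose iota : {rmorphism E -> F} := sfval HC \o fin_field_val coK.
have iotaE : C = range iota.
  by rewrite -(sfval_range HC); apply/seteqP; split=> x [y _ <-]; exists y.
have /choice [h hE] : forall c, exists y : E, iota y = j c.
  move=> c; have : range iota (j c) by rewrite -iotaE; exact: range_constants.
  by move=> [y _ <-]; exists y.
exists E, iota, (factor_morphism hE : {rmorphism k0 -> E}); split=> //.
rewrite -[m in RHS]card_ord -card_ffun; apply: (@bij_eq_card E _ co).
exists g => // c; apply/ffunP => i; apply: (fmorph_inj j); apply/eqP; rewrite -subr_eq0; apply/eqP.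
apply: (fb (fun i => j ((co (g c)) i) - j (c i))) => [l|].
  by exists (co (g c) l - c l); rewrite ?rmorphB.
under eq_bigr do rewrite mulrBl.
by rewrite sumrB -!gE coK subrr.
Qed.

End FiniteConstants.

(** * An element with a single simple pole *)

Section SmallPoleElement.
Variables (k0 E : finFieldType) (F : fieldType) (j : {rmorphism k0 -> F}).
Variables (iota : {rmorphism E -> F}) (iota0 : {rmorphism k0 -> E}).
Hypothesis constE : constants j = range iota.
Hypothesis Hfin : forall x, exists N, forall n (u : 'I_n -> F), xfree iota x u -> (n <= N)%N.
Hypothesis jE : forall c, j c = iota (iota0 c).
Local Notation C := (constants j).
Let HC : subfield_set C := constants_subfield j.
Let HR : subfield_set (range j) := range_subfield j.

Lemma peval_comp x (P : {poly k0}) : peval j x P = peval iota x (map_poly iota0 P).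
Proof.
by rewrite /peval -map_poly_comp; congr (_.[x]); apply: eq_map_poly => c; exact: jE.
Qed.

Lemma xfree_comp x n (u : 'I_n -> F) : xfree iota x u -> xfree j x u.
Proof.
move=> fu P Pz i; apply/eqP; rewrite -(map_poly_eq0 iota0); apply/eqP.
apply: (fu (fun i => map_poly iota0 (P i))); rewrite -[RHS]Pz.
by apply: eq_bigr => l _; rewrite peval_comp.
Qed.

Lemma RRspace_one_place (v : place j) : (`|genus j| < pdeg v)%N -> (exists x, ~ C x) ->
  exists2 x, ~ C x & poles x =1 (fun w => if w == v then 1 else 0).
Proof.
move=> gv ncst; pose D (w : place j) : int := if w == v then 1 else 0.
have Dv w : w \notin [:: v] -> D w = 0 by rewrite inE /D => /negPf ->.
have HD : is_divisor D := seq_divisor Dv.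
have degD : divdeg D = pdeg v by rewrite (divdeg_seq (s := [:: v])) // big_seq1 /D eqxx mul1r.
have Gg := genus_exists constE Hfin ncst.
have [_ /(_ _ HD)] := Gg; rewrite degD => le.
have R2 : (1 < RRdim D)%N.
  by move: le gv; rewrite -{1}(gez0_abs (genus_ge0 constE Hfin Gg)); lia.
have [x [Dx Cx]] : exists x, RRspace D x /\ ~ C x.
  apply: contrapT => H; have sub : RRspace D `<=` C.
    by move=> x Dx; apply: contrapT => Cx; apply: H; exists x.
  have := hd_indep_le HC (subspace_set0 _) (has_dim_constants j)
    (indepS sub (hd_indep (RRdimP constE Hfin HD))).
  by rewrite leqNgt R2.
have x0 := nonconst_neq0 Cx; exists x => // w.
have Hx w' : - D w' <= vz w' x by move/RRspaceE: Dx => /(_ w'); rewrite vgeE.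
have vx : vz v x < 0.
  rewrite ltNge; apply/negP => vx; apply: Cx; apply: (no_poles constE Hfin) => w'.
  rewrite vgeE //; have := Hx w'; rewrite /D; case: eqP => [->//|_].
  by rewrite oppr0.
rewrite /poles; have := Hx w; rewrite /D; case: eqP => [->|_].
  by rewrite vx; move: vx; lia.
by rewrite oppr0 leNgt => /negPf ->.
Qed.

Lemma clear_poles_family x (u : nat -> F) n : ~ C x -> exists2 p : {poly E}, p != 0 &
  exists N, forall i, (i < n)%N -> poleb j x N (peval iota x p * u i).
Proof.
move=> Nx; elim: n => [|n [p p0 [N HN]]]; first by exists 1; [exact: oner_neq0|exists 0%N].
have [p' p'0 [N' HN']] := clear_poles constE Hfin (u n) Nx.
have Pp (q : {poly E}) : poleb j x (size q) (peval iota x q).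
  exact: (poleb_peval constE).
exists (p * p'); first exact: mulf_neq0.
exists (size p + size p' + N + N')%N => i; rewrite ltnS leq_eqVlt => /predU1P[->|/HN Hi].
  rewrite pevalM -mulrA; apply: poleb_le (polebM (Pp p) HN'); move: (size p) (size p') => a b; lia.
rewrite pevalM mulrAC mulrC; apply: poleb_le (polebM (Pp p') Hi); move: (size p) (size p') => a b; lia.
Qed.

(* Counting of k0-dimensions in poleb x M as M grows. *)
Lemma xfree_over_constants x n (m N : nat) (u : 'I_n -> F) : ~ C x ->
  has_dim (range j) C [set 0] m -> divdeg (poles x : place j -> int) = N%:Z ->
  xfree j x u -> (n <= m * N)%N.
Proof.
move=> Nx [b [Cb _ gb]] degx fu; rewrite leqNgt; apply/negP => ln.
have [p p0 [N1 HN1]] := clear_poles_family (fun i => oapp u 0 (insub i)) n Nx.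
have pF : peval iota x p != 0.
  by apply: contraNneq p0 => /(peval_eq0 constE Nx) ->.
have Hu (i : 'I_n) : poleb j x N1 (peval iota x p * u i).
  by have := HN1 i (ltn_ord i); rewrite valK.
(* With this M the dimension bound m ((M + N1) N + 1) equals m N M + M, which is less than (M + 1)
   (m N + 1). *)
pose M := (m * N1 * N + m)%N; pose Dv (v : place j) := (M + N1)%:Z * poles x v.
have HP : is_divisor (poles x : place j -> int) by exact: (poles_divisor constE Hfin).
have HD : is_divisor Dv by exact: divisorZ.
have := RRdim_le constE Hfin HD; rewrite divdegZ // degx => leR.
have {}leR : (RRdim Dv <= ((M + N1) * N).+1)%N.
  rewrite -lez_nat; apply: le_trans (leR _) _ => [v|]; first by rewrite mulr_ge0 ?poles_ge0.
  by rewrite -PoszM -natz natr1 natz.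
have [z [_ _ gz]] := RRdimP constE Hfin HD.
pose I := ('I_M.+1 * 'I_n)%type; pose J := ('I_m * 'I_(RRdim Dv))%type.
pose bI (i : I) := x ^+ i.1 * (peval iota x p * u i.2).
pose w (h : J) := b h.1 * z h.2.
have : (#|{: I}| <= #|{: J}|)%N.
  apply: (steinitz_fin HR (b := bI) (w := w)) => [i|a Sa ab].
    have : poleb j x (M + N1) (bI i).
      have xi : poleb j x (i.1 * 1) (x ^+ i.1) by apply: polebX; exact: (@poleb_gen _ _ j x).
      apply: poleb_le (polebM xi (Hu _)); rewrite muln1 leq_add2r -ltnS; exact: ltn_ord.
    move=> /gz [c [Cc /eqP]]; rewrite subr_eq0 => /eqP ->.
    have /choice [c' Hc'] : forall h, exists c' : 'I_m -> F, (forall i, range j (c' i)) /\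
        c h = \sum_i c' i * b i.
      move=> h; have [c' [Sc' /eqP]] := gb _ (Cc h); rewrite subr_eq0 => /eqP E'.
      by exists c'.
    exists (fun h : J => c' h.2 h.1) => [h|]; first exact: (Hc' h.2).1.
    rewrite (eq_bigr (fun h : J => c' h.2 h.1 * w (h.1, h.2))); last by case.
    rewrite -(pair_bigA _ (fun h k => c' k h * w (h, k))) exchange_big; apply: eq_bigr => h _ /=.
    rewrite (Hc' h).2 mulr_suml; apply: eq_bigr => k _.
    by rewrite /w /= mulrA.
  have /choice [a' Ha'] : forall i, exists c' : k0, j c' = a i.
    by move=> i; case: (Sa i) => c' _ <-; exists c'.
  pose P l := \poly_(i < M.+1) a' (inord i, l).
  have P0 l : P l = 0.
    apply: fu; apply: (mulfI pF); rewrite mulr0 -[RHS]ab mulr_sumr.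
    rewrite (eq_bigr (fun h : I => a (h.1, h.2) * bI (h.1, h.2))); last by case.
    rewrite -(pair_bigA _ (fun i l => a (i, l) * bI (i, l))) exchange_big; apply: eq_bigr => h _.
    have -> : peval j x (P h) = \sum_(k < M.+1) a (k, h) * x ^+ k.
      rewrite /peval (horner_coef_wide (n := M.+1)) ?size_map_poly ?size_poly //.
      by apply: eq_bigr => k _; rewrite coef_map coef_poly ltn_ord inord_val /= Ha'.
    by rewrite mulr_suml mulr_sumr; apply: eq_bigr => k _; rewrite /bI /=; ring.
  move=> [i l]; rewrite -Ha'; have /polyP/(_ i) := P0 l.
  by rewrite coef_poly ltn_ord inord_val coef0 => ->; rewrite rmorph0.
rewrite !card_prod !card_ord => le.
have h1 : (M.+1 * (m * N).+1 <= M.+1 * n)%N by rewrite leq_mul2l ln orbT.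
have h2 : (m * RRdim Dv <= m * ((M + N1) * N).+1)%N by rewrite leq_mul2l leR orbT.
have := leq_trans h1 (leq_trans le h2); rewrite mulnS mulSn [X in (_ <= X)%N]mulnS mulnDl mulnDr.
rewrite [(M * (m * N))%N]mulnCA mulnA /M; move: (m * (M * N))%N; lia.
Qed.

Lemma xfree_at_simple_pole (v : place j) x t N : vz v x = -1 -> vge v 0 t ->
  (forall P : {poly k0}, P != 0 -> (size P <= N)%N -> ~ vge v 1 (peval j t P)) ->
  xfree j x (fun i : 'I_N => t ^+ i).
Proof.
move=> vx vt Ht; have x0 : x != 0 by apply/eqP => x0; move: vx; rewrite x0 /vz place_ord0.
have v1 : vge v 1 x^-1 by rewrite vgeE ?invr_eq0 // vzV vx opprK.
have vti i : vge v 0 (t ^+ i) by have := vgeX i vt; rewrite mul0rn.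
apply: (xfree_inv x0); apply: (xfree_indep (V := vge v 0) (W := vge v 1)).
- by rewrite invr_eq0.
- move=> c a b va vb; apply: vgeD => //; rewrite -[0]addr0; apply: vgeM => //.
  by apply: vge_const; exact: range_constants.
- exact: vge0.
- by move=> z vz0; apply: (vgeS (ler01 : 0 <= 1 :> int)); rewrite -[1]addr0; exact: vgeM.
- by move=> z vz0; apply: vgeN; rewrite -[1]addr0; exact: vgeM.
split=> // c Sc; have /choice [c' Hc'] : forall i, exists c', j c' = c i.
  by move=> i; case: (Sc i) => c' _ <-; exists c'.
pose P := \poly_(i < N) oapp c' 0 (insub i).
have PE : \sum_i c i * t ^+ i = peval j t P.
  rewrite /peval (horner_coef_wide (n := N)) ?size_map_poly ?size_poly //.
  by apply: eq_bigr => i _; rewrite coef_map coef_poly ltn_ord valK /= Hc'.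
rewrite PE => vP i; rewrite -Hc'.
have -> : c' i = P`_i by rewrite coef_poly ltn_ord valK.
suff -> : P = 0 by rewrite coef0 rmorph0.
by apply/eqP; apply: contraT => P0; case: (Ht _ P0 (size_poly _ _) vP).
Qed.

End SmallPoleElement.

(** * The primitive element and its height *)

Lemma small_primitive_element (k0 : finFieldType) (F : fieldType) (j : {rmorphism k0 -> F}) (t : F)
    (T : finType) (e : T -> F) (p : nat) : p \in [pchar k0] -> ~ constants j t ->
  (forall z, exists2 s : T -> F, forall h, ratfield j t (s h) & z = \sum_h s h * e h) ->
  exists m, [/\ (m <= #|T|)%N, has_dim (range j) (constants j) [set 0] m, 0 <= genus j &
    exists x, [/\ - divdeg (fun v : place j => - poles x v) =
        genus j + (2 * (stepanov_constant p #|T|).+1)%N%:Z,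
      x != 0 & forall z, exists P0 : {poly k0}, peval j x P0 != 0 /\
        exists N (P : 'I_N -> {poly k0}), peval j x P0 * z = \sum_i peval j x (P i) * t ^+ i]].
Proof.
move=> pk0 Nt span; have Tt := transcendental Nt.
have [m mT hm] := constants_dim Nt span; exists m.
have [E [iota [iota0 [constE jE cardE]]]] := constant_field hm.
have Hfin x : exists N, forall n (u : 'I_n -> F), xfree iota x u -> (n <= N)%N.
  have [N HN] := finite_over_any Tt span x; exists N => n u fu; apply: (HN _ u).
  exact: (xfree_comp jE fu).
have [rt rtT Hrt] : exists2 r, (r <= #|T|)%N & xdeg iota t r.
  apply: xdeg_exists => n u fu; apply: (xfree_span Tt span (u := u)).
  exact: (xfree_comp jE fu).
have ncst : exists x, ~ constants j x by exists t.
have g0 : 0 <= genus j := genus_ge0 constE Hfin (genus_exists constE Hfin ncst).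
split=> //.
have [v [pv vt vP]] := special_place constE Hfin jE Nt Hrt rtT cardE pk0.
have [|x Nx px] := RRspace_one_place constE Hfin (v := v) _ ncst.
  by rewrite pv addnS ltnS leq_addr.
have x0 := nonconst_neq0 Nx.
have vx : vz v x = -1.
  by have := px v; rewrite eqxx /poles; case: ifP => // _ /eqP; rewrite eqr_oppLR => /eqP.
have degx : divdeg (poles x : place j -> int) = pdeg v.
  have Dv w : w \notin [:: v] -> poles x w = 0 by rewrite inE px => /negPf ->.
  by rewrite (divdeg_seq (s := [:: v])) // big_seq1 px eqxx mul1r.
exists x; split=> //.
  have Dv w : w \notin [:: v] -> - poles x w = 0 by rewrite inE px => /negPf ->.
  rewrite (divdeg_seq (s := [:: v])) // big_seq1 px eqxx mulN1r opprK.
  by rewrite pv PoszD gez0_abs.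
have fx := xfree_at_simple_pole vx vt vP.
move=> z; set N := (m * _)%N in fx.
(* z together with the N powers of t exceeds the bound N of [xfree_over_constants]; as the powers
   alone are independent, z has a nonzero coefficient in the resulting relation. *)
pose u (i : 'I_N.+1) := if unlift ord0 i is Some k then t ^+ k else z.
have : ~ xfree j x u.
  by move=> /(xfree_over_constants constE Hfin Nx hm degx); rewrite pv ltnn.
move=> /existsNP [c] /not_implyP [eqc /existsNP [i ci]].
have {}eqc : peval j x (c ord0) * z + \sum_(k < N) peval j x (c (lift ord0 k)) * t ^+ k = 0.
  rewrite -[RHS]eqc big_ord_recl {1}/u unlift_none; congr (_ + _).
  by apply: eq_bigr => k _; rewrite /u liftK.
exists (c ord0); split.
  apply/eqP => c0; apply: ci; move: eqc; rewrite c0 mul0r add0r => /fx cz.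
  case: (unliftP ord0 i) => [k ->|->]; first exact: cz.
  exact: (transcendental Nx c0).
exists N, (fun k => - c (lift ord0 k)); move/eqP: eqc; rewrite addr_eq0 => /eqP ->.
by rewrite -sumrN; apply: eq_bigr => k _; rewrite pevalN mulNr.
Qed.

Lemma vdiv_one_poles (k0 F : fieldType) (j : {rmorphism k0 -> F}) (x : F) : x != 0 ->
  vdiv (j := j) [tuple 1; x] = (fun v => - poles x v).
Proof.
move=> x0; apply: boolp.funext => v; rewrite /vdiv /ordv /= !big_cons big_nil.
rewrite miney (ordE v (oner_neq0 F)) (ordE v x0) vz1 -EFin_min /= /poles.
by case: (ltP (vz v x) 0) => h; rewrite ?opprK ?oppr0 ?min_r ?min_l // ltW.
Qed.

Section ConstantExtension.
Variables (k0 k : fieldType) (iota : {rmorphism k0 -> k}) (K : fieldExtType k).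
Local Notation j := (const_emb iota K).

Lemma peval_const_emb (t0 : k) (p : {poly k0}) : peval j (t0%:A : K) p = (peval iota t0 p)%:A.
Proof.
rewrite /peval /const_emb /= (map_poly_comp (in_alg K) iota).
by rewrite -[t0%:A]/(in_alg K t0) horner_map.
Qed.

Lemma nonconstant_const_emb (t0 : k) : ~ algebraicOver iota t0 -> ~ constants j (t0%:A : K).
Proof.
move=> Nt0 [p p0 pt]; apply: Nt0; exists p => //; move: pt.
rewrite !rootE -/(peval j _ p) peval_const_emb scaler_eq0 oner_eq0 orbF.
by [].
Qed.

Lemma span_const_emb (t0 : k) n0 : has_dim (ratfield iota t0) setT [set 0] n0 ->
  exists e : 'I_(\dim {:K}) * 'I_n0 -> K, forall z,
    exists2 s, forall h, ratfield j (t0%:A : K) (s h) & z = \sum_h s h * e h.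
Proof.
move=> [b [_ _ gb]]; pose X := vbasis {:K}.
exists (fun h : 'I_(\dim {:K}) * 'I_n0 => b h.2 *: X`_h.1) => z.
have /choice [s Hs] : forall i : 'I_(\dim {:K}), exists s : 'I_n0 -> k,
    (forall l, ratfield iota t0 (s l)) /\ coord X i z = \sum_l s l * b l.
  move=> i; have [s [Ss /eqP]] := gb (coord X i z) I; rewrite subr_eq0 => /eqP sE.
  by exists s.
exists (fun h : 'I_(\dim {:K}) * 'I_n0 => (s h.1 h.2)%:A) => [h|].
  have [p [q [q0 ->]]] := (Hs h.1).1 h.2; exists p, q.
  rewrite -!/(peval _ _ _) !peval_const_emb in q0 *; split.
    by rewrite scaler_eq0 oner_eq0 orbF.
  by rewrite -[LHS]/(in_alg K _) fmorph_div.
have zX : z = \sum_i coord X i z *: X`_i by apply: coord_vbasis; rewrite memvf.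
rewrite {1}zX (eq_bigr (fun i => \sum_l (s i l)%:A * (b l *: X`_i))).
  by rewrite pair_bigA.
move=> i _; rewrite (Hs i).2 scaler_suml; apply: eq_bigr => l _.
by rewrite -scalerAl mul1r scalerA.
Qed.

Lemma adjoin_const_emb (t0 : k) (x : K) :
  (forall z, exists P0 : {poly k0}, peval j x P0 != 0 /\ exists N (P : 'I_N -> {poly k0}),
     peval j x P0 * z = \sum_i peval j x (P i) * (t0%:A) ^+ i) ->
  <<1; x>>%VS = {:K}%VS.
Proof.
move=> H; apply/eqP; rewrite eqEsubv subvf /=; apply/subvP => z _.
have [P0 [P0x [N [P PE]]]] := H z.
have Px (Q : {poly k0}) : peval j x Q \in <<1; x>>%VS.
  rewrite /peval horner_coef rpred_sum // => i _; rewrite coef_map rpredM ?rpredX ?memv_adjoin //.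
  by rewrite /= rpredZ // mem1v.
have -> : z = (peval j x P0)^-1 * \sum_i peval j x (P i) * (t0%:A) ^+ i by rewrite -PE mulKf.
rewrite rpredM ?rpredV // rpred_sum // => i _.
by rewrite rpredM // rpredX // rpredZ // mem1v.
Qed.

End ConstantExtension.

Local Close Scope classical_set_scope.

Theorem theorem1 (k0 : finFieldType) (k : fieldType)
    (iota : {rmorphism k0 -> k}) (hk : function_field iota)
    (d : nat) (hd : (0 < d)%N) :
  exists C : rat,
    forall K : fieldExtType k, \dim {:K} = d ->
      exists alpha : K,
        <<1; alpha>>%VS = {:K}%VS /\
        height iota [tuple 1; alpha]
          <= (genus (const_emb iota K))%:~R / geomdeg iota K + C.
Proof.
have [[t0 [Nt0 [n0 hn]]] _] := hk; have [p _ pk0] := finPcharP k0.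
(* K is spanned over k0(t0) by d * n0 elements, so m <= d * n0. Division by the geometric degree d /
   m turns the surplus c into c * m / d <= c * n0. *)
pose c := (2 * (stepanov_constant p (d * n0)).+1)%N; exists (c * n0)%:R => K dimK.
have [e span] := span_const_emb K hn.
have [m [mT hm g0 [x [degx x0 Hx]]]] :=
  small_primitive_element pk0 (nonconstant_const_emb (K := K) Nt0) span.
exists x; split; first exact: adjoin_const_emb Hx.
rewrite /height vdiv_one_poles // -mulrNz degx card_prod !card_ord dimK -/c.
have -> : geomdeg iota K = d%:R / m%:R.
  by rewrite /geomdeg dimK (dimqE (range_subfield _) (subspace_set0 _) hm).
rewrite intrD mulrDl lerD2l invf_div mulrA ler_pdivrMr ?ltr0n //.
rewrite -pmulrn -!natrM ler_nat -mulnA leq_mul2l.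
by move: mT; rewrite card_prod !card_ord dimK mulnC => ->; rewrite orbT.
Qed.
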